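(* Let $X:\Sigma\to\mathbb{I}^3$ be a zero mean curvature immersion that is also affine minimal. Then, up to isometries and homotheties of isotropic space, $X$ must be a piece of one, and only one, of the following surfaces, given with their Weierstrass data $(h,\eta)$: - plane: $(0,\ 1\,dz)$; - trivial Enneper-type surface: $(z,\ i\,dz)$; - helicoid: $(e^{z},\ i e^{-z}\,dz)$; - Enneper-type surface: $(\frac1z,\ i z^2\,dz)$; - one of the Thomsen-type surfaces: $\left(\frac{\alpha}{\beta}\coth\frac{\alpha z}{2},\ i\,\frac{2\beta}{\alpha^2}\sinh^2\frac{\alpha z}{2}\,dz\right)$ with real $\alpha>0$, $\beta>0$.
   Context: Isotropic space: $\mathbb{R}^{3,1}$ is Minkowski $4$-space with bilinear form $\langle\cdot,\cdot\rangle$ of signature $(-+++)$, $\mathcal{L}=\{Y:\langle Y,Y\rangle=0\}$, $\mathfrak{p}=(1,0,0,1)^t\in\mathcal{L}$, and $\mathbb{I}^3=\{Y\in\mathbb{R}^{3,1}:\langle Y,\mathfrak{p}\rangle=0\}=\{(\mathbf l,\mathbf x,\mathbf y,\mathbf l)^t\}$, with degenerate induced metric $d\mathbf x^2+d\mathbf y^2$; it is identified with coordinate space $\{(\mathbf l,\mathbf x,\mathbf y)\}\cong\mathbb{R}^3$. Isometries of $\mathbb{I}^3$ are compositions of translations of $\mathbb{I}^3$ and the restrictions to $\mathbb{I}^3$ of $A\in\mathrm{SO}(3,1)$ with $A\mathfrak p=\mathfrak p$; homotheties are the maps $Y\mapsto\lambda Y$, $\lambda\in\mathbb{R}\setminus\{0\}$.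 Surfaces: $\Sigma$ is a simply-connected domain and $X:\Sigma\to\mathbb{I}^3$ is a spacelike immersion (the induced metric is Riemannian), with conformal coordinates $z=u+iv$ and $ds^2=e^{2\omega}(du^2+dv^2)$. The lightlike Gauss map $n:\Sigma\to\mathcal L$ is the unique map with $\langle dX,n\rangle=0$, $\langle n,\mathfrak p\rangle=1$. Put $L=\langle X_{uu},n\rangle$, $M=\langle X_{uv},n\rangle$, $N=\langle X_{vv},n\rangle$. The mean curvature is $H=\tfrac12e^{-2\omega}(L+N)$ and the Hopf differential is $Q\,dz^2=\tfrac14(L-N-2iM)\,dz^2$; zero mean curvature means $H\equiv0$. Affine minimality: view $X$ as an affine surface in $\mathbb{R}^3$ and put $\tilde L=\det(X_u,X_v,X_{uu})$, $\tilde M=\det(X_u,X_v,X_{uv})$, $\tilde N=\det(X_u,X_v,X_{vv})$. When $X$ is non-degenerate ($\tilde L\tilde N-\tilde M^2\ne0$), the Berwald–Blaschke metric is $d\tilde s^2=|\tilde L\tilde N-\tilde M^2|^{-1/4}(\tilde L\,du^2+2\tilde M\,du\,dv+\tilde N\,dv^2)$. For a zero mean curvature surface in conformal asymptotic coordinates normalized so that $Q=-\tfrac i2$, this is $d\tilde s^2=2e^{\omega}\,du\,dv$, and the affine normal is $\tilde n=e^{-\omega}X_{uv}$. The affine shape operator $\tilde S$ is defined by $d\tilde n=-dX\circ\tilde S$, the affine mean curvature is $\tilde H=\tfrac12\mathrm{tr}\,\tilde S$, and $X$ is affine minimal if it is non-degenerate with $\tilde H\equiv0$; planes are also counted as affine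 minimal. Weierstrass data: the zero mean curvature surface with data $(h,\eta)$, where $h$ is meromorphic and $\eta$ is a holomorphic $1$-form, is $X=\mathrm{Re}\int(h,1,-i)\,\eta$ in the coordinates $(\mathbf l,\mathbf x,\mathbf y)$. ''A piece of'' means: after reparametrization, $X$ is a restriction of the given surface.
   Formalization: ''A piece of'' allows a reparametrization that is only a local diffeomorphism, since X = (0, Re e^z, Im e^z) on ℂ is a non-injective planar example; for injective X the reparametrization is injective. *)

(* Defs.v *)
From Stdlib Require Import Reals.
From Coquelicot Require Import Coquelicot.

Open Scope R_scope.

Definition R31 : Type := (R * R * R * R)%type.

Definition mink (a b : R31) : R :=
  let '(a0, a1, a2, a3) := a in
  let '(b0, b1, b2, b3) := b in
  - (a0 * b0) + a1 * b1 + a2 * b2 + a3 * b3.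

Definition pvec : R31 := (1, 0, 0, 1).

(* Coordinates (l, x, y) of the point (l, x, y, l) of the hyperplane
   orthogonal to [pvec]; [emb] is the inclusion. *)
Definition I3 : Type := (R * R * R)%type.
Definition lc (Y : I3) : R := fst (fst Y).
Definition xc (Y : I3) : R := snd (fst Y).
Definition yc (Y : I3) : R := snd Y.
Definition emb (Y : I3) : R31 := (lc Y, xc Y, yc Y, lc Y).

Definition det3 (a b c : I3) : R :=
  let '(a1, a2, a3) := a in
  let '(b1, b2, b3) := b in
  let '(c1, c2, c3) := c in
  a1 * (b2 * c3 - b3 * c2) - b1 * (a2 * c3 - a3 * c2) + c1 * (a2 * b3 - a3 * b2).

Definition det4 (a b c d : R31) : R :=
  let '(a0, a1, a2, a3) := a in
  let '(b0, b1, b2, b3) := b in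
  let '(c0, c1, c2, c3) := c in
  let '(d0, d1, d2, d3) := d in
  a0 * det3 (b1, b2, b3) (c1, c2, c3) (d1, d2, d3)
  - b0 * det3 (a1, a2, a3) (c1, c2, c3) (d1, d2, d3)
  + c0 * det3 (a1, a2, a3) (b1, b2, b3) (d1, d2, d3)
  - d0 * det3 (a1, a2, a3) (b1, b2, b3) (c1, c2, c3).

Definition is_SO31 (A : R31 -> R31) : Prop :=
  (forall a b : R31, A (plus a b) = plus (A a) (A b)) /\
  (forall (k : R) (a : R31), A (scal k a) = scal k (A a)) /\
  (forall a b : R31, mink (A a) (A b) = mink a b) /\
  det4 (A (1, 0, 0, 0)) (A (0, 1, 0, 0)) (A (0, 0, 1, 0)) (A (0, 0, 0, 1)) = 1.

Inductive isometry : (I3 -> I3) -> Prop :=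
| iso_translation (t : I3) : isometry (fun Y => plus Y t)
| iso_linear (A : R31 -> R31) (T : I3 -> I3) :
    is_SO31 A -> A pvec = pvec -> (forall Y, emb (T Y) = A (emb Y)) -> isometry T
| iso_comp (T1 T2 : I3 -> I3) :
    isometry T1 -> isometry T2 -> isometry (fun Y => T1 (T2 Y)).

Inductive similarity : (I3 -> I3) -> Prop :=
| sim_isometry (T : I3 -> I3) : isometry T -> similarity T
| sim_homothety (lambda : R) : lambda <> 0 -> similarity (fun Y => scal lambda Y)
| sim_comp (T1 T2 : I3 -> I3) :
    similarity T1 -> similarity T2 -> similarity (fun Y => T1 (T2 Y)).

(* Paths and homotopies are total continuous maps constrained to S only over
   [0,1]; every map continuous on [0,1] or [0,1]^2 extends by clamping. *)
Definition path_connected (S : C -> Prop) : Prop :=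
  forall a b : C, S a -> S b ->
  exists g : R -> C,
    (forall t : R, continuous g t) /\
    (forall t : R, 0 <= t <= 1 -> S (g t)) /\ g 0 = a /\ g 1 = b.

Definition null_homotopic_in (S : C -> Prop) (g : R -> C) : Prop :=
  exists (H : R * R -> C) (c : C),
    (forall q : R * R, continuous H q) /\
    (forall s t : R, 0 <= s <= 1 -> 0 <= t <= 1 -> S (H (s, t))) /\
    (forall t : R, 0 <= t <= 1 -> H (0, t) = g t) /\
    (forall t : R, 0 <= t <= 1 -> H (1, t) = c) /\
    (forall s : R, 0 <= s <= 1 -> H (s, 0) = H (s, 1)).

Definition simply_connected_domain (S : C -> Prop) : Prop :=
  (exists z : C, S z) /\ open S /\ path_connected S /\
  (forall g : R -> C,
     (forall t : R, continuous g t) ->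
     (forall t : R, 0 <= t <= 1 -> S (g t)) ->
     g 0 = g 1 ->
     null_homotopic_in S g).

Definition pu (f : R -> R -> R) : R -> R -> R :=
  fun u v => Derive (fun t => f t v) u.
Definition pv (f : R -> R -> R) : R -> R -> R :=
  fun u v => Derive (fun t => f u t) v.

Definition lcf (X : R -> R -> I3) : R -> R -> R := fun u v => lc (X u v).
Definition xcf (X : R -> R -> I3) : R -> R -> R := fun u v => xc (X u v).
Definition ycf (X : R -> R -> I3) : R -> R -> R := fun u v => yc (X u v).

Definition Du (X : R -> R -> I3) : R -> R -> I3 :=
  fun u v => (pu (lcf X) u v, pu (xcf X) u v, pu (ycf X) u v).
Definition Dv (X : R -> R -> I3) : R -> R -> I3 :=
  fun u v => (pv (lcf X) u v, pv (xcf X) u v, pv (ycf X) u v).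

Definition smooth_fun (S : C -> Prop) (f : R -> R -> R) : Prop :=
  forall (k : nat) (u v : R), S (u, v) -> ex_diff_n f k u v.

Definition smooth_map (S : C -> Prop) (X : R -> R -> I3) : Prop :=
  smooth_fun S (lcf X) /\ smooth_fun S (xcf X) /\ smooth_fun S (ycf X).

Definition gI (a b : I3) : R := mink (emb a) (emb b).

Definition spacelike_immersion (S : C -> Prop) (X : R -> R -> I3) : Prop :=
  smooth_map S X /\
  forall u v : R, S (u, v) ->
  forall a b : R, (a, b) <> (0, 0) ->
    let w := plus (scal a (Du X u v)) (scal b (Dv X u v)) in 0 < gI w w.

Definition conformal_coordinates
    (S : C -> Prop) (X : R -> R -> I3) (omega : R -> R -> R) : Prop :=
  forall u v : R, S (u, v) ->
    gI (Du X u v) (Du X u v) = exp (2 * omega u v) /\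
    gI (Du X u v) (Dv X u v) = 0 /\
    gI (Dv X u v) (Dv X u v) = exp (2 * omega u v).

Definition lightlike_gauss_map
    (S : C -> Prop) (X : R -> R -> I3) (n : R -> R -> R31) : Prop :=
  forall u v : R, S (u, v) ->
    mink (n u v) (n u v) = 0 /\
    mink (emb (Du X u v)) (n u v) = 0 /\
    mink (emb (Dv X u v)) (n u v) = 0 /\
    mink (n u v) pvec = 1.

Definition mean_curvature
    (X : R -> R -> I3) (omega : R -> R -> R) (n : R -> R -> R31) (u v : R) : R :=
  let L := mink (emb (Du (Du X) u v)) (n u v) in
  let N := mink (emb (Dv (Dv X) u v)) (n u v) in
  / 2 * exp (- 2 * omega u v) * (L + N).

Definition zero_mean_curvature
    (S : C -> Prop) (X : R -> R -> I3) (omega : R -> R -> R) (n : R -> R -> R31) :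
    Prop :=
  forall u v : R, S (u, v) -> mean_curvature X omega n u v = 0.

Definition Lt (X : R -> R -> I3) (u v : R) : R :=
  det3 (Du X u v) (Dv X u v) (Du (Du X) u v).
Definition Mt (X : R -> R -> I3) (u v : R) : R :=
  det3 (Du X u v) (Dv X u v) (Dv (Du X) u v).
Definition Nt (X : R -> R -> I3) (u v : R) : R :=
  det3 (Du X u v) (Dv X u v) (Dv (Dv X) u v).
Definition discr (X : R -> R -> I3) (u v : R) : R :=
  Lt X u v * Nt X u v - Mt X u v * Mt X u v.

Definition nondegenerate (S : C -> Prop) (X : R -> R -> I3) : Prop :=
  forall u v : R, S (u, v) -> discr X u v <> 0.

(* The Berwald--Blaschke metric is bE du^2 + 2 bF du dv + bG dv^2. *)
Definition bE (X : R -> R -> I3) (u v : R) : R :=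
  Rpower (Rabs (discr X u v)) (- / 4) * Lt X u v.
Definition bF (X : R -> R -> I3) (u v : R) : R :=
  Rpower (Rabs (discr X u v)) (- / 4) * Mt X u v.
Definition bG (X : R -> R -> I3) (u v : R) : R :=
  Rpower (Rabs (discr X u v)) (- / 4) * Nt X u v.

(* Laplace--Beltrami operator |g|^(-1/2) d_i (|g|^(1/2) g^ij d_j f) of the
   possibly indefinite metric E du^2 + 2 F du dv + G dv^2, with W = det g. *)
Definition laplace_beltrami (E F G : R -> R -> R) (f : R -> R -> R) (u v : R) : R :=
  let W a b := E a b * G a b - F a b * F a b in
  let r a b := sqrt (Rabs (W a b)) in
  / r u v *
  (pu (fun a b => r a b * (G a b * pu f a b - F a b * pv f a b) / W a b) u v
   + pv (fun a b => r a b * (E a b * pv f a b - F a b * pu f a b) / W a b) u v).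

(* The affine normal is half the Laplacian of X for the Berwald--Blaschke
   metric, in arbitrary coordinates. When that metric is 2 e^w du dv the
   Laplacian is 2 e^(-w) d_u d_v, and this is e^(-w) X_uv. *)
Definition affine_normal (X : R -> R -> I3) (u v : R) : I3 :=
  let lap f := laplace_beltrami (bE X) (bF X) (bG X) f u v in
  (/ 2 * lap (lcf X), / 2 * lap (xcf X), / 2 * lap (ycf X)).

(* d(affine normal) = - dX o S, where S has matrix (s11 s12; s21 s22) in the
   frame (d_u, d_v). *)
Definition affine_shape_operator
    (X : R -> R -> I3) (u v s11 s12 s21 s22 : R) : Prop :=
  Du (affine_normal X) u v
    = opp (plus (scal s11 (Du X u v)) (scal s21 (Dv X u v))) /\
  Dv (affine_normal X) u v
    = opp (plus (scal s12 (Du X u v)) (scal s22 (Dv X u v))).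

Definition is_affine_mean_curvature (X : R -> R -> I3) (u v h : R) : Prop :=
  exists s11 s12 s21 s22 : R,
    affine_shape_operator X u v s11 s12 s21 s22 /\ h = / 2 * (s11 + s22).

Definition planar (S : C -> Prop) (X : R -> R -> I3) : Prop :=
  exists a b c d : R, (a, b, c) <> (0, 0, 0) /\
  forall u v : R, S (u, v) ->
    a * lc (X u v) + b * xc (X u v) + c * yc (X u v) = d.

Definition affine_minimal (S : C -> Prop) (X : R -> R -> I3) : Prop :=
  (nondegenerate S X /\
   forall u v : R, S (u, v) -> is_affine_mean_curvature X u v 0)
  \/ planar S X.

(* (h, f) encodes the data (h, f dz). *)
Definition wdata : Type := ((C -> C) * (C -> C))%type.

(* The surface is considered where f <> 0: zeros of f are not points of
   immersion, and for all the data below they contain the poles of h. *)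
Definition wdomain (w : wdata) : C -> Prop := fun z => snd w z <> 0%C.

(* dY = Re (psi dz), that is, Y = Re \int psi dz, for a real function Y. *)
Definition is_Re_primitive_at (Y : R -> R -> R) (psi : C -> C) (u v : R) : Prop :=
  differentiable_pt_lim Y u v (Re (psi (u, v))) (- Im (psi (u, v))).

Definition weierstrass_surface (w : wdata) (Y : R -> R -> I3) : Prop :=
  let (h, f) := w in
  forall u v : R, wdomain w (u, v) ->
    is_Re_primitive_at (lcf Y) (fun z => (h z * f z)%C) u v /\
    is_Re_primitive_at (xcf Y) (fun z => (1 * f z)%C) u v /\
    is_Re_primitive_at (ycf Y) (fun z => (- Ci * f z)%C) u v.

Definition local_diffeo_on (S : C -> Prop) (phi : C -> C) : Prop :=
  let p1 u v := fst (phi (u, v)) in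
  let p2 u v := snd (phi (u, v)) in
  smooth_fun S p1 /\ smooth_fun S p2 /\
  forall u v : R, S (u, v) ->
    pu p1 u v * pv p2 u v - pv p1 u v * pu p2 u v <> 0.

(* The reparametrization phi is a local diffeomorphism, not required to be
   injective: X(z) = (0, Re e^z, Im e^z) on C counts as a piece of
   the plane. If X is injective then so is phi, and X o phi^-1 is the restriction of Y to phi(S). *)
Definition piece_of (S : C -> Prop) (X : R -> R -> I3)
    (D : C -> Prop) (Y : R -> R -> I3) : Prop :=
  exists phi : C -> C,
    local_diffeo_on S phi /\
    forall u v : R, S (u, v) ->
      D (phi (u, v)) /\ X u v = Y (fst (phi (u, v))) (snd (phi (u, v))).

Definition piece_up_to_similarity
    (S : C -> Prop) (X : R -> R -> I3) (w : wdata) : Prop :=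
  exists (T : I3 -> I3) (Y : R -> R -> I3),
    similarity T /\ weierstrass_surface w Y /\
    piece_of S (fun u v => T (X u v)) (wdomain w) Y.

Definition cexp (z : C) : C := (exp (Re z) * cos (Im z), exp (Re z) * sin (Im z)).
Definition csinh (z : C) : C := ((cexp z - cexp (- z)) / 2)%C.
Definition ccosh (z : C) : C := ((cexp z + cexp (- z)) / 2)%C.
Definition ccoth (z : C) : C := (ccosh z / csinh z)%C.

Inductive kind : Set :=
| Plane | TrivialEnneper | Helicoid | EnneperType | ThomsenType.

Inductive listed : kind -> wdata -> Prop :=
| listed_plane :
    listed Plane (fun _ => RtoC 0, fun _ => RtoC 1)
| listed_trivial_enneper :
    listed TrivialEnneper (fun z => z, fun _ => Ci)
| listed_helicoid :
    listed Helicoid (fun z => cexp z, fun z => (Ci * cexp (- z))%C)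
| listed_enneper :
    listed EnneperType (fun z => (1 / z)%C, fun z => (Ci * (z * z))%C)
| listed_thomsen (alpha beta : R) :
    0 < alpha -> 0 < beta ->
    listed ThomsenType
      (fun z => (alpha / beta * ccoth (alpha * z / 2))%C,
       fun z => (Ci * (2 * beta / (alpha * alpha))
                 * (csinh (alpha * z / 2) * csinh (alpha * z / 2)))%C).

(* Main.v *)
Require Import Defs.
From Stdlib Require Import Reals Lra FunctionalExtensionality.
From Coquelicot Require Import Coquelicot.

(* In conformal coordinates x + i e y is holomorphic for a constant sign e; call
   it F and put f = F'.  Zero mean curvature makes l harmonic, so
   l_u - i l_v = h f with h holomorphic.  Put s = h'/f = dh/dF and differentiate
   with respect to h.  The trace of the affine shape operator is a nonzero real
   function times Re (3/4 s_h^2 / s - s_hh), so affine minimality forces the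
   holomorphic function 3/4 s_h^2 / s - s_hh to be an imaginary constant.
   Writing s = q^2, this says q_hhh = 0: hence s = q(h)^2 for a polynomial
   q = A + B h + D h^2 with imaginary discriminant B^2 - 4 A D.  A similarity
   acts on h by affine maps and on s by scaling; the vanishing of D, B and of the
   discriminant separates the listed surfaces, and in each case the
   reparametrization is a single-valued explicit expression in h, F and l.  So
   only the connectedness of the domain is used, and no monodromy arises. *)

Open Scope R_scope.

(** * Smooth functions of two real variables *)

(** Two obstacles shape the proof. Orientation: isometries come from matrices of determinant 1
    fixing [pvec], and these only rotate the (x, y)-plane, so the sign [e] cannot be removed by a
    similarity. It is removed by conjugating the parameter, which acts on every listed surface as a
    reflection up to a sign. Phase: a similarity multiplies the discriminant of [q] by a real factor
    only, so no rotation can change its phase modulo sign. When [q] has distinct roots (one possibly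
    at infinity), it is the imaginary discriminant that makes the scaling factor real, as a
    homothety requires; when the roots coincide, the rotation absorbs the phase instead. Uniqueness
    rests on the same equation [dh = q(h)^2 dF]: it is recovered from any listed surface of which
    [X] is a piece, and [q^2] is determined by the surface because [h] is not constant off the
    plane. *)

Lemma open_locally_2d (S : C -> Prop) (P : R -> R -> Prop) (u v : R) :
  open S -> S (u, v) -> (forall a b, S (a, b) -> P a b) -> locally_2d P u v.
Proof.
  intros HO Hz HP. apply locally_2d_locally.
  generalize (HO _ Hz). apply filter_imp.
  intros [a b] H. now apply HP.
Qed.

Lemma open_locally_fst (S : C -> Prop) (P : R -> Prop) (u v : R) :
  open S -> S (u, v) -> (forall a, S (a, v) -> P a) -> locally u P.
Proof.
  intros HO Hz HP.
  destruct (open_locally_2d S (fun a b => S (a, b)) u v HO Hz (fun _ _ H => H)) as [d Hd].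
  exists d. intros a Ha. apply HP, Hd; [exact Ha|].
  rewrite Rminus_diag, Rabs_R0. apply cond_pos.
Qed.

Lemma open_locally_snd (S : C -> Prop) (P : R -> Prop) (u v : R) :
  open S -> S (u, v) -> (forall b, S (u, b) -> P b) -> locally v P.
Proof.
  intros HO Hz HP.
  destruct (open_locally_2d S (fun a b => S (a, b)) u v HO Hz (fun _ _ H => H)) as [d Hd].
  exists d. intros a Ha. apply HP, Hd; [|exact Ha].
  rewrite Rminus_diag, Rabs_R0. apply cond_pos.
Qed.

Lemma pu_ext (S : C -> Prop) (f g : R -> R -> R) (u v : R) :
  open S -> S (u, v) -> (forall a b, S (a, b) -> f a b = g a b) ->
  pu f u v = pu g u v.
Proof.
  intros HO Hz H. apply Derive_ext_loc.
  apply (open_locally_fst S _ u v HO Hz). intros a Ha. now apply H.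
Qed.

Lemma pv_ext (S : C -> Prop) (f g : R -> R -> R) (u v : R) :
  open S -> S (u, v) -> (forall a b, S (a, b) -> f a b = g a b) ->
  pv f u v = pv g u v.
Proof.
  intros HO Hz H. apply Derive_ext_loc.
  apply (open_locally_snd S _ u v HO Hz). intros a Ha. now apply H.
Qed.

(** [ex_diff_n] fixes the partial derivatives as the total functions given by [Derive]. Here they
    are any functions that are right on [S], so closure under products, inverses and [ln] follows
    from explicit formulas. On an open [S] the two notions agree, by [smooth_fun_class_k] and
    [class_k_smooth_fun]. *)
Fixpoint class_k (k : nat) (S : C -> Prop) (f : R -> R -> R) : Prop :=
  (forall u v, S (u, v) -> continuity_2d_pt f u v) /\
  match k with
  | O => True
  | S k' => exists fu fv : R -> R -> R,
      (forall u v, S (u, v) -> is_derive (fun t => f t v) u (fu u v)) /\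
      (forall u v, S (u, v) -> is_derive (fun t => f u t) v (fv u v)) /\
      class_k k' S fu /\ class_k k' S fv
  end.

Lemma smooth_fun_pu (S : C -> Prop) (f : R -> R -> R) :
  smooth_fun S f -> smooth_fun S (pu f).
Proof.
  intros H k u v Hz. exact (ex_diff_n_deriv_aux1 f k u v (H (Datatypes.S k) u v Hz)).
Qed.

Lemma smooth_fun_pv (S : C -> Prop) (f : R -> R -> R) :
  smooth_fun S f -> smooth_fun S (pv f).
Proof.
  intros H k u v Hz. exact (ex_diff_n_deriv_aux2 f k u v (H (Datatypes.S k) u v Hz)).
Qed.

Lemma smooth_fun_cont (S : C -> Prop) (f : R -> R -> R) (u v : R) :
  smooth_fun S f -> S (u, v) -> continuity_2d_pt f u v.
Proof. intros H Hz. exact (proj1 (H 0%nat u v Hz)). Qed.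

Lemma smooth_fun_derive_u (S : C -> Prop) (f : R -> R -> R) (u v : R) :
  smooth_fun S f -> S (u, v) -> is_derive (fun t => f t v) u (pu f u v).
Proof.
  intros H Hz. apply Derive_correct. exact (proj1 (proj2 (H 1%nat u v Hz))).
Qed.

Lemma smooth_fun_derive_v (S : C -> Prop) (f : R -> R -> R) (u v : R) :
  smooth_fun S f -> S (u, v) -> is_derive (fun t => f u t) v (pv f u v).
Proof.
  intros H Hz. apply Derive_correct. exact (proj1 (proj2 (proj2 (H 1%nat u v Hz)))).
Qed.

Lemma smooth_fun_class_k (S : C -> Prop) (f : R -> R -> R) (k : nat) :
  smooth_fun S f -> class_k k S f.
Proof.
  revert f; induction k as [|k IH]; intros f H; split; auto.
  1, 2: intros u v Hz; now apply smooth_fun_cont with S.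
  exists (pu f), (pv f). split; [|split; [|split]].
  - intros u v Hz. now apply smooth_fun_derive_u with S.
  - intros u v Hz. now apply smooth_fun_derive_v with S.
  - apply IH. now apply smooth_fun_pu.
  - apply IH. now apply smooth_fun_pv.
Qed.

Lemma class_k_ext (S : C -> Prop) (f g : R -> R -> R) (k : nat) :
  open S -> (forall u v, S (u, v) -> f u v = g u v) -> class_k k S f -> class_k k S g.
Proof.
  intros HO E H.
  assert (Hc : forall u v, S (u, v) -> continuity_2d_pt g u v).
  { intros u v Hz. apply continuity_2d_pt_ext_loc with f.
    - now apply (open_locally_2d S _ u v HO Hz).
    - destruct k; now apply H. }
  destruct k as [|k]; split; auto.
  destruct H as (_ & fu & fv & Hu & Hv & Hk).
  exists fu, fv. split; [|split; [|split]]; try tauto.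
  - intros u v Hz. apply is_derive_ext_loc with (fun t => f t v); auto.
    apply (open_locally_fst S _ u v HO Hz). auto.
  - intros u v Hz. apply is_derive_ext_loc with (fun t => f u t); auto.
    apply (open_locally_snd S _ u v HO Hz). auto.
Qed.

Lemma class_k_smooth_fun (S : C -> Prop) (f : R -> R -> R) :
  open S -> (forall k, class_k k S f) -> smooth_fun S f.
Proof.
  intros HO H k. specialize (H k). revert f H.
  induction k as [|k IH]; intros f H u v Hz.
  - split; [now apply H|trivial].
  - destruct H as (Hc & fu & fv & Hu & Hv & Hku & Hkv).
    assert (Eu : forall a b, S (a, b) -> fu a b = pu f a b).
    { intros a b Hab. symmetry. now apply is_derive_unique, Hu. }
    assert (Ev : forall a b, S (a, b) -> fv a b = pv f a b).
    { intros a b Hab. symmetry. now apply is_derive_unique, Hv. }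
    split; [now apply Hc|]. split; [eexists; now apply Hu|].
    split; [eexists; now apply Hv|].
    split; apply IH; trivial.
    + now apply class_k_ext with fu.
    + now apply class_k_ext with fv.
Qed.

Lemma smooth_fun_ext (S : C -> Prop) (f g : R -> R -> R) :
  open S -> (forall u v, S (u, v) -> f u v = g u v) -> smooth_fun S f -> smooth_fun S g.
Proof.
  intros HO E H. apply class_k_smooth_fun; trivial. intros k.
  apply class_k_ext with f; trivial. now apply smooth_fun_class_k.
Qed.

Lemma class_k_pred (S : C -> Prop) (f : R -> R -> R) (k : nat) :
  class_k (Datatypes.S k) S f -> class_k k S f.
Proof.
  revert f; induction k as [|k IH]; intros f (Hc & fu & fv & Hu & Hv & Hku & Hkv).
  - now split.
  - split; trivial. exists fu, fv. split; [|split; [|split]]; auto.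
Qed.

Lemma class_k_const (S : C -> Prop) (c : R) (k : nat) : class_k k S (fun _ _ => c).
Proof.
  revert c; induction k as [|k IH]; intros c; (split; [intros; apply continuity_2d_pt_const|trivial]).
  exists (fun _ _ => 0), (fun _ _ => 0).
  split; [|split; [|split]]; auto; intros; apply (is_derive_const (V := R_NormedModule)).
Qed.

Lemma class_k_plus (S : C -> Prop) (f g : R -> R -> R) (k : nat) :
  class_k k S f -> class_k k S g -> class_k k S (fun u v => f u v + g u v).
Proof.
  revert f g; induction k as [|k IH]; intros f g [Hf Hf'] [Hg Hg'];
    (split; [intros; apply continuity_2d_pt_plus; auto|trivial]).
  destruct Hf' as (fu & fv & Hfu & Hfv & Hku & Hkv).
  destruct Hg' as (gu & gv & Hgu & Hgv & Hlu & Hlv).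
  exists (fun u v => fu u v + gu u v), (fun u v => fv u v + gv u v).
  split; [|split; [|split]]; auto; intros; apply (is_derive_plus (V := R_NormedModule)); auto.
Qed.

Lemma class_k_mult (S : C -> Prop) (f g : R -> R -> R) (k : nat) :
  class_k k S f -> class_k k S g -> class_k k S (fun u v => f u v * g u v).
Proof.
  revert f g; induction k as [|k IH]; intros f g Hf Hg;
    (split; [intros; apply continuity_2d_pt_mult; [now apply Hf|now apply Hg]|trivial]).
  pose proof (class_k_pred _ _ _ Hf) as Hf0. pose proof (class_k_pred _ _ _ Hg) as Hg0.
  destruct Hf as (_ & fu & fv & Hfu & Hfv & Hku & Hkv).
  destruct Hg as (_ & gu & gv & Hgu & Hgv & Hlu & Hlv).
  exists (fun u v => fu u v * g u v + f u v * gu u v),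
         (fun u v => fv u v * g u v + f u v * gv u v).
  split; [|split; [|split]]; try (apply class_k_plus; now apply IH); intros.
  - apply (is_derive_mult (fun t => f t v) (fun t => g t v)); auto. intros; apply Rmult_comm.
  - apply (is_derive_mult (fun t => f u t) (fun t => g u t)); auto. intros; apply Rmult_comm.
Qed.

Lemma class_k_inv (S : C -> Prop) (f : R -> R -> R) (k : nat) :
  (forall u v, S (u, v) -> f u v <> 0) ->
  class_k k S f -> class_k k S (fun u v => / f u v).
Proof.
  intros Hn. induction k as [|k IH]; intros Hf;
    (split; [intros; apply continuity_2d_pt_inv; [now apply Hf|auto]|trivial]).
  pose proof (IH (class_k_pred _ _ _ Hf)) as Hi.
  destruct Hf as (_ & fu & fv & Hfu & Hfv & Hku & Hkv).
  (* Written this way the partials involve only constants, [fu], [fv] and [/ f], whose class is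
     given by the induction hypothesis. *)
  exists (fun u v => (-1 * fu u v) * (/ f u v * / f u v)),
         (fun u v => (-1 * fv u v) * (/ f u v * / f u v)).
  split; [|split; [|split]]; try (repeat apply class_k_mult; auto; apply class_k_const); intros u v Hz.
  - replace (_ * _) with (- fu u v / f u v ^ 2) by (field; auto).
    apply (is_derive_inv (fun t => f t v)); auto.
  - replace (_ * _) with (- fv u v / f u v ^ 2) by (field; auto).
    apply (is_derive_inv (fun t => f u t)); auto.
Qed.

Lemma class_k_ln (S : C -> Prop) (f : R -> R -> R) (k : nat) :
  (forall u v, S (u, v) -> 0 < f u v) ->
  class_k k S f -> class_k k S (fun u v => ln (f u v)).
Proof.
  intros Hp Hf.
  assert (Hc : forall u v, S (u, v) -> continuity_2d_pt (fun u v => ln (f u v)) u v).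
  { intros u v Hz. apply (continuity_1d_2d_pt_comp ln).
    - apply derivable_continuous_pt. exists (/ f u v). now apply derivable_pt_lim_ln, Hp.
    - destruct k; now apply Hf. }
  destruct k as [|k]; split; auto.
  assert (Hi : class_k k S (fun u v => / f u v)).
  { apply class_k_inv; [|now apply class_k_pred]. intros u v Hz.
    apply Rgt_not_eq. now apply Hp. }
  destruct Hf as (_ & fu & fv & Hfu & Hfv & Hku & Hkv).
  exists (fun u v => fu u v * / f u v), (fun u v => fv u v * / f u v).
  split; [|split; [|split]]; try (apply class_k_mult; now auto); intros u v Hz.
  - apply (is_derive_comp ln (fun t => f t v)); auto.
    now apply is_derive_Reals, derivable_pt_lim_ln, Hp.
  - apply (is_derive_comp ln (fun t => f u t)); auto.
    now apply is_derive_Reals, derivable_pt_lim_ln, Hp.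
Qed.

Lemma smooth_fun_const (S : C -> Prop) (c : R) : open S -> smooth_fun S (fun _ _ => c).
Proof. intros HO. apply class_k_smooth_fun; auto. intros k. apply class_k_const. Qed.

Lemma smooth_fun_plus (S : C -> Prop) (f g : R -> R -> R) :
  open S -> smooth_fun S f -> smooth_fun S g -> smooth_fun S (fun u v => f u v + g u v).
Proof.
  intros HO Hf Hg. apply class_k_smooth_fun; auto. intros k.
  apply class_k_plus; now apply smooth_fun_class_k.
Qed.

Lemma smooth_fun_mult (S : C -> Prop) (f g : R -> R -> R) :
  open S -> smooth_fun S f -> smooth_fun S g -> smooth_fun S (fun u v => f u v * g u v).
Proof.
  intros HO Hf Hg. apply class_k_smooth_fun; auto. intros k.
  apply class_k_mult; now apply smooth_fun_class_k.
Qed.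

Lemma smooth_fun_opp (S : C -> Prop) (f : R -> R -> R) :
  open S -> smooth_fun S f -> smooth_fun S (fun u v => - f u v).
Proof.
  intros HO Hf. apply smooth_fun_ext with (fun u v => -1 * f u v); trivial.
  - intros; ring.
  - apply smooth_fun_mult; trivial. now apply smooth_fun_const.
Qed.

Lemma smooth_fun_inv (S : C -> Prop) (f : R -> R -> R) :
  open S -> (forall u v, S (u, v) -> f u v <> 0) ->
  smooth_fun S f -> smooth_fun S (fun u v => / f u v).
Proof.
  intros HO Hn Hf. apply class_k_smooth_fun; auto. intros k.
  apply class_k_inv; auto. now apply smooth_fun_class_k.
Qed.

Lemma smooth_fun_ln (S : C -> Prop) (f : R -> R -> R) :
  open S -> (forall u v, S (u, v) -> 0 < f u v) ->
  smooth_fun S f -> smooth_fun S (fun u v => ln (f u v)).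
Proof.
  intros HO Hn Hf. apply class_k_smooth_fun; auto. intros k.
  apply class_k_ln; auto. now apply smooth_fun_class_k.
Qed.

Lemma pu_pv_comm (S : C -> Prop) (f : R -> R -> R) (u v : R) :
  open S -> smooth_fun S f -> S (u, v) -> pu (pv f) u v = pv (pu f) u v.
Proof.
  intros HO Hf Hz. apply (Schwarz f).
  - apply (open_locally_2d S _ u v HO Hz). intros a b Hab. repeat split.
    + exact (proj1 (proj2 (Hf 1%nat a b Hab))).
    + exact (proj1 (proj2 (proj2 (Hf 1%nat a b Hab)))).
    + exact (proj1 (proj2 (smooth_fun_pv S f Hf 1%nat a b Hab))).
    + exact (proj1 (proj2 (proj2 (smooth_fun_pu S f Hf 1%nat a b Hab)))).
  - exact (smooth_fun_cont S _ u v (smooth_fun_pu _ _ (smooth_fun_pv _ _ Hf)) Hz).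
  - exact (smooth_fun_cont S _ u v (smooth_fun_pv _ _ (smooth_fun_pu _ _ Hf)) Hz).
Qed.

(* By the mean value theorem along the axes [f] is constant near each point, so
   its composite with a continuous path has zero derivative. *)
Lemma locally_constant (S : C -> Prop) (f : R -> R -> R) :
  open S -> path_connected S ->
  (forall u v, S (u, v) -> is_derive (fun t => f t v) u 0) ->
  (forall u v, S (u, v) -> is_derive (fun t => f u t) v 0) ->
  forall z w : C, S z -> S w -> f (fst z) (snd z) = f (fst w) (snd w).
Proof.
  intros HO HC Hu Hv z w Hz Hw.
  destruct (HC z w Hz Hw) as (g & Hg & HgS & <- & <-).
  assert (Hloc : forall u v, S (u, v) -> locally_2d (fun a b => f a b = f u v) u v).
  { intros u v Huv.
    destruct (open_locally_2d S (fun a b => S (a, b)) u v HO Huv (fun _ _ H => H)) as [d Hd].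
    exists d. intros a b Ha Hb.
    assert (E1 : f a b = f a v).
    { destruct (MVT_gen (fun t => f a t) v b (fun _ => 0)) as (c & _ & E); [| |lra].
      - intros x Hx. apply Hv, Hd; trivial.
        eapply Rle_lt_trans; [|exact Hb].
        unfold Rmin, Rmax in Hx. destruct (Rle_dec v b); unfold Rabs; repeat destruct Rcase_abs; lra.
      - intros x Hx. apply derivable_continuous_pt. exists 0. apply is_derive_Reals. apply Hv, Hd; trivial.
        eapply Rle_lt_trans; [|exact Hb].
        unfold Rmin, Rmax in Hx. destruct (Rle_dec v b); unfold Rabs; repeat destruct Rcase_abs; lra. }
    assert (E2 : f a v = f u v).
    { assert (Hvv : Rabs (v - v) < d) by (rewrite Rminus_diag, Rabs_R0; apply cond_pos).
      destruct (MVT_gen (fun t => f t v) u a (fun _ => 0)) as (c & _ & E); [| |lra].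
      - intros x Hx. apply Hu, Hd; trivial.
        eapply Rle_lt_trans; [|exact Ha].
        unfold Rmin, Rmax in Hx. destruct (Rle_dec u a); unfold Rabs; repeat destruct Rcase_abs; lra.
      - intros x Hx. apply derivable_continuous_pt. exists 0. apply is_derive_Reals. apply Hu, Hd; trivial.
        eapply Rle_lt_trans; [|exact Ha].
        unfold Rmin, Rmax in Hx. destruct (Rle_dec u a); unfold Rabs; repeat destruct Rcase_abs; lra. }
    now rewrite E1. }
  apply (eq_is_derive (V := R_NormedModule) (fun t => f (fst (g t)) (snd (g t))) 0 1); [|lra].
  intros t Ht.
  apply is_derive_ext_loc with (fun _ => f (fst (g t)) (snd (g t)));
    [|apply (is_derive_const (V := R_NormedModule))].
  assert (HS : S (fst (g t), snd (g t))) by (rewrite <- surjective_pairing; auto).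
  pose proof (proj1 (locally_2d_locally _ _ _) (Hloc _ _ HS)) as H.
  rewrite <- surjective_pairing in H.
  generalize (Hg t _ H). unfold filtermap. apply filter_imp. intros; now symmetry.
Qed.

(** * Holomorphic functions *)

Lemma is_derive_eq (f : R -> R) (x a b : R) : is_derive f x a -> a = b -> is_derive f x b.
Proof. now intros H <-. Qed.

Lemma C_eq (a b : C) : fst a = fst b -> snd a = snd b -> a = b.
Proof. destruct a, b; simpl; congruence. Qed.

(** All complex differentiation below runs along real curves: partial derivatives are the case of
    coordinate lines, and chain rules take an arbitrary curve. *)
Definition cderiv (g : R -> C) (t : R) (a : C) : Prop :=
  is_derive (fun s => fst (g s)) t (fst a) /\ is_derive (fun s => snd (g s)) t (snd a).

Lemma cderiv_eq (g : R -> C) (t : R) (a b : C) : cderiv g t a -> a = b -> cderiv g t b.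
Proof. now intros H <-. Qed.

Lemma cderiv_unique (g : R -> C) (t : R) (a b : C) : cderiv g t a -> cderiv g t b -> a = b.
Proof.
  intros [H1 H2] [K1 K2]. apply C_eq.
  - rewrite <- (is_derive_unique _ _ _ H1). now apply is_derive_unique.
  - rewrite <- (is_derive_unique _ _ _ H2). now apply is_derive_unique.
Qed.

Lemma cderiv_ext_loc (f g : R -> C) (t : R) (a : C) :
  locally t (fun s => f s = g s) -> cderiv f t a -> cderiv g t a.
Proof.
  intros E [H1 H2]. split.
  - apply is_derive_ext_loc with (fun s => fst (f s)); trivial.
    generalize E. apply filter_imp. intros s Es. now rewrite Es.
  - apply is_derive_ext_loc with (fun s => snd (f s)); trivial.
    generalize E. apply filter_imp. intros s Es. now rewrite Es.
Qed.

Lemma cderiv_const (c : C) (t : R) : cderiv (fun _ => c) t 0.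
Proof. split; apply (is_derive_const (V := R_NormedModule)). Qed.

Lemma cderiv_plus (f g : R -> C) (t : R) (a b : C) :
  cderiv f t a -> cderiv g t b -> cderiv (fun s => f s + g s)%C t (a + b)%C.
Proof. intros [H1 H2] [K1 K2]. split; now apply (is_derive_plus (V := R_NormedModule)). Qed.

Lemma cderiv_opp (f : R -> C) (t : R) (a : C) :
  cderiv f t a -> cderiv (fun s => - f s)%C t (- a)%C.
Proof. intros [H1 H2]. split; now apply (is_derive_opp (V := R_NormedModule)). Qed.

Lemma is_derive_Rmult (f g : R -> R) (t a b : R) :
  is_derive f t a -> is_derive g t b -> is_derive (fun s => f s * g s) t (a * g t + f t * b).
Proof. intros H K. apply (is_derive_mult f g t a b); auto. intros; apply Rmult_comm. Qed.

Lemma cderiv_mult (f g : R -> C) (t : R) (a b : C) :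
  cderiv f t a -> cderiv g t b -> cderiv (fun s => f s * g s)%C t (a * g t + f t * b)%C.
Proof.
  intros [H1 H2] [K1 K2]. split; simpl.
  - eapply is_derive_eq.
    + apply (is_derive_minus (V := R_NormedModule));
        [exact (is_derive_Rmult _ _ _ _ _ H1 K1)|exact (is_derive_Rmult _ _ _ _ _ H2 K2)].
    + unfold minus, plus, opp; simpl. ring.
  - eapply is_derive_eq.
    + apply (is_derive_plus (V := R_NormedModule));
        [exact (is_derive_Rmult _ _ _ _ _ H1 K2)|exact (is_derive_Rmult _ _ _ _ _ H2 K1)].
    + unfold plus; simpl. ring.
Qed.

Lemma Cnorm2_pos (z : C) : z <> 0 -> 0 < fst z ^ 2 + snd z ^ 2.
Proof.
  intros H. destruct z as [x y]; simpl.
  destruct (Req_dec x 0) as [->|Hx]; [destruct (Req_dec y 0) as [->|Hy]|].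
  - now contradict H.
  - generalize (pow2_gt_0 y Hy). simpl. lra.
  - generalize (pow2_gt_0 x Hx) (pow2_ge_0 y). simpl. lra.
Qed.

Lemma cderiv_inv (f : R -> C) (t : R) (a : C) :
  f t <> 0 -> cderiv f t a -> cderiv (fun s => / f s)%C t (- a / (f t * f t))%C.
Proof.
  intros Hn [H1 H2]. pose proof (Cnorm2_pos _ Hn) as Hp.
  assert (Hq : is_derive (fun s => fst (f s) ^ 2 + snd (f s) ^ 2) t
                 (2 * (fst (f t) * fst a + snd (f t) * snd a))).
  { apply is_derive_ext with (fun s => fst (f s) * fst (f s) + snd (f s) * snd (f s)).
    - intros; simpl; ring.
    - eapply is_derive_eq.
      + apply (is_derive_plus (V := R_NormedModule));
          [exact (is_derive_Rmult _ _ _ _ _ H1 H1)|exact (is_derive_Rmult _ _ _ _ _ H2 H2)].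
      + unfold plus; simpl. ring. }
  assert (Hi := is_derive_inv _ _ _ Hq (Rgt_not_eq _ _ Hp)).
  assert (Hp' : fst (f t) * fst (f t) + snd (f t) * snd (f t) <> 0).
  { simpl in Hp. lra. }
  assert (Hsq : (fst (f t) * fst (f t) - snd (f t) * snd (f t)) *
                (fst (f t) * fst (f t) - snd (f t) * snd (f t)) +
                (fst (f t) * snd (f t) + snd (f t) * fst (f t)) *
                (fst (f t) * snd (f t) + snd (f t) * fst (f t)) <> 0).
  { replace (_ + _) with ((fst (f t) * fst (f t) + snd (f t) * snd (f t)) ^ 2) by ring.
    now apply pow_nonzero. }
  split; simpl.
  - eapply is_derive_eq; [exact (is_derive_Rmult _ _ _ _ _ H1 Hi)|].
    simpl. field. split; trivial.
  - eapply is_derive_eq.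
    { exact (is_derive_Rmult _ _ _ _ _ (is_derive_opp (V := R_NormedModule) _ _ _ H2) Hi). }
    unfold opp; simpl. field. split; trivial.
Qed.

Lemma cderiv_conj (f : R -> C) (t : R) (a : C) :
  cderiv f t a -> cderiv (fun s => Cconj (f s)) t (Cconj a).
Proof.
  intros [H1 H2]. split; simpl; trivial. now apply (is_derive_opp (V := R_NormedModule)).
Qed.

Lemma cderiv_RtoC (f : R -> R) (t a : R) :
  is_derive f t a -> cderiv (fun s => RtoC (f s)) t (RtoC a).
Proof. intros H. split; simpl; trivial. apply (is_derive_const (V := R_NormedModule)). Qed.

Lemma cderiv_cexp (f : R -> C) (t : R) (a : C) :
  cderiv f t a -> cderiv (fun s => cexp (f s)) t (cexp (f t) * a)%C.
Proof.
  intros [H1 H2].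
  assert (He : is_derive (fun s => exp (fst (f s))) t (fst a * exp (fst (f t)))).
  { apply (is_derive_comp exp (fun s => fst (f s))); trivial. apply is_derive_exp. }
  assert (Hc : is_derive (fun s => cos (snd (f s))) t (snd a * - sin (snd (f t)))).
  { apply (is_derive_comp cos (fun s => snd (f s))); trivial. apply is_derive_cos. }
  assert (Hs : is_derive (fun s => sin (snd (f s))) t (snd a * cos (snd (f t)))).
  { apply (is_derive_comp sin (fun s => snd (f s))); trivial. apply is_derive_sin. }
  split; simpl; unfold Re, Im.
  - eapply is_derive_eq; [exact (is_derive_Rmult _ _ _ _ _ He Hc)|]. simpl. ring.
  - eapply is_derive_eq; [exact (is_derive_Rmult _ _ _ _ _ He Hs)|]. simpl. ring.
Qed.

Definition csmooth (S : C -> Prop) (f : C -> C) : Prop :=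
  smooth_fun S (fun u v => fst (f (u, v))) /\ smooth_fun S (fun u v => snd (f (u, v))).

Definition cpartials (f : C -> C) (z a b : C) : Prop :=
  cderiv (fun t => f (t, snd z)) (fst z) a /\ cderiv (fun t => f (fst z, t)) (snd z) b.

(** The partials [d] and [i d] encode the Cauchy-Riemann equations. Smoothness is built in, so that
    derivatives stay holomorphic by an elementary argument instead of an integral formula. *)
Definition Hol (S : C -> Prop) (f d : C -> C) : Prop :=
  csmooth S f /\ forall z, S z -> cpartials f z (d z) (Ci * d z)%C.

Lemma cpartials_ext (S : C -> Prop) (f g : C -> C) (z a b : C) :
  open S -> S z -> (forall w, S w -> f w = g w) -> cpartials f z a b -> cpartials g z a b.
Proof.
  intros HO Hz E [H1 H2]. destruct z as [u v]. split.
  - apply cderiv_ext_loc with (fun t => f (t, v)); trivial.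
    apply (open_locally_fst S _ u v HO Hz). auto.
  - apply cderiv_ext_loc with (fun t => f (u, t)); trivial.
    apply (open_locally_snd S _ u v HO Hz). auto.
Qed.

Lemma csmooth_ext (S : C -> Prop) (f g : C -> C) :
  open S -> (forall w, S w -> f w = g w) -> csmooth S f -> csmooth S g.
Proof.
  intros HO E [H1 H2]. split.
  - apply smooth_fun_ext with (fun u v => fst (f (u, v))); trivial.
    intros u v Hz. now rewrite E.
  - apply smooth_fun_ext with (fun u v => snd (f (u, v))); trivial.
    intros u v Hz. now rewrite E.
Qed.

Lemma Hol_ext (S : C -> Prop) (f g d e : C -> C) :
  open S -> (forall w, S w -> f w = g w) -> (forall w, S w -> d w = e w) ->
  Hol S f d -> Hol S g e.
Proof.
  intros HO E E' [H1 H2]. split; [now apply csmooth_ext with f|].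
  intros z Hz. rewrite <- E' by trivial. apply cpartials_ext with S f; auto.
Qed.

Lemma Hol_unique (S : C -> Prop) (f g d e : C -> C) (z : C) :
  open S -> (forall w, S w -> f w = g w) -> Hol S f d -> Hol S g e -> S z -> d z = e z.
Proof.
  intros HO E H K Hz.
  apply (Hol_ext S f g d d HO E (fun _ _ => eq_refl)) in H.
  exact (cderiv_unique _ _ _ _ (proj1 (proj2 H z Hz)) (proj1 (proj2 K z Hz))).
Qed.

Lemma Hol_const (S : C -> Prop) (c : C) : open S -> Hol S (fun _ => c) (fun _ => RtoC 0).
Proof.
  intros HO. split; [split; now apply smooth_fun_const|].
  intros z _. split; [apply cderiv_const|].
  eapply cderiv_eq; [apply cderiv_const|]. ring.
Qed.

Lemma Hol_plus (S : C -> Prop) (f g d e : C -> C) :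
  open S -> Hol S f d -> Hol S g e ->
  Hol S (fun z => f z + g z)%C (fun z => d z + e z)%C.
Proof.
  intros HO [[H1 H2] H3] [[K1 K2] K3]. split.
  - split; simpl; now apply (smooth_fun_plus S _ _ HO).
  - intros z Hz. destruct (H3 z Hz) as [Hu Hv], (K3 z Hz) as [Ku Kv]. split.
    + now apply cderiv_plus.
    + eapply cderiv_eq; [apply cderiv_plus; eassumption|]. ring.
Qed.

Lemma Hol_opp (S : C -> Prop) (f d : C -> C) :
  open S -> Hol S f d -> Hol S (fun z => - f z)%C (fun z => - d z)%C.
Proof.
  intros HO [[H1 H2] H3]. split.
  - split; simpl; now apply (smooth_fun_opp S _ HO).
  - intros z Hz. destruct (H3 z Hz) as [Hu Hv]. split.
    + now apply cderiv_opp.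
    + eapply cderiv_eq; [apply cderiv_opp; eassumption|]. ring.
Qed.

Lemma Hol_minus (S : C -> Prop) (f g d e : C -> C) :
  open S -> Hol S f d -> Hol S g e ->
  Hol S (fun z => f z - g z)%C (fun z => d z - e z)%C.
Proof. intros HO H K. apply Hol_plus; trivial. now apply Hol_opp. Qed.

Lemma Hol_mult (S : C -> Prop) (f g d e : C -> C) :
  open S -> Hol S f d -> Hol S g e ->
  Hol S (fun z => f z * g z)%C (fun z => d z * g z + f z * e z)%C.
Proof.
  intros HO [[H1 H2] H3] [[K1 K2] K3]. split.
  - split; simpl.
    + apply (smooth_fun_plus S (fun u v => fst (f (u, v)) * fst (g (u, v)))
        (fun u v => - (snd (f (u, v)) * snd (g (u, v)))) HO); [|apply (smooth_fun_opp S (fun u v => snd (f (u, v)) * snd (g (u, v))) HO)];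
        now apply (smooth_fun_mult S _ _ HO).
    + apply (smooth_fun_plus S (fun u v => fst (f (u, v)) * snd (g (u, v)))
        (fun u v => (snd (f (u, v)) * fst (g (u, v)))) HO);
        now apply (smooth_fun_mult S _ _ HO).
  - intros z Hz. destruct (H3 z Hz) as [Hu Hv], (K3 z Hz) as [Ku Kv]. destruct z as [u v]. split.
    + exact (cderiv_mult _ _ _ _ _ Hu Ku).
    + eapply cderiv_eq; [exact (cderiv_mult _ _ _ _ _ Hv Kv)|]. cbv beta; cbn [fst snd]. ring.
Qed.

Lemma Hol_scal (S : C -> Prop) (c : C) (f d : C -> C) :
  open S -> Hol S f d -> Hol S (fun z => c * f z)%C (fun z => c * d z)%C.
Proof.
  intros HO H. apply Hol_ext with (fun z => c * f z)%C (fun z => 0 * f z + c * d z)%C; trivial.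
  - intros; ring.
  - apply (Hol_mult S (fun _ => c) f); trivial. now apply Hol_const.
Qed.

Lemma Hol_inv (S : C -> Prop) (f d : C -> C) :
  open S -> (forall z, S z -> f z <> 0) -> Hol S f d ->
  Hol S (fun z => / f z)%C (fun z => - d z / (f z * f z))%C.
Proof.
  intros HO Hn [[H1 H2] H3].
  assert (Hi : smooth_fun S (fun u v => / (fst (f (u, v)) ^ 2 + snd (f (u, v)) ^ 2))).
  { apply smooth_fun_inv; trivial.
    - intros u v Hz. apply Rgt_not_eq, Cnorm2_pos. auto.
    - apply smooth_fun_ext with (fun u v => fst (f (u, v)) * fst (f (u, v)) + snd (f (u, v)) * snd (f (u, v))); trivial.
      + intros; simpl; ring.
      + apply smooth_fun_plus; trivial; now apply smooth_fun_mult. }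
  split.
  - split; simpl; unfold Rdiv.
    + now apply (smooth_fun_mult S _ _ HO H1 Hi).
    + apply (smooth_fun_mult S (fun u v => - snd (f (u, v))) _ HO); trivial.
      now apply smooth_fun_opp.
  - intros z Hz. destruct (H3 z Hz) as [Hu Hv]. pose proof (Hn z Hz) as Hnz.
    destruct z as [u v]. split.
    + exact (cderiv_inv _ _ _ Hnz Hu).
    + eapply cderiv_eq; [exact (cderiv_inv _ _ _ Hnz Hv)|].
      cbv beta; cbn [fst snd]. field. trivial.
Qed.

Lemma Hol_div (S : C -> Prop) (f g d e : C -> C) :
  open S -> (forall z, S z -> g z <> 0) -> Hol S f d -> Hol S g e ->
  Hol S (fun z => f z / g z)%C (fun z => (d z * g z - f z * e z) / (g z * g z))%C.
Proof.
  intros HO Hn H K.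
  apply Hol_ext with (fun z => f z * / g z)%C
     (fun z => d z * / g z + f z * (- e z / (g z * g z)))%C; trivial.
  - intros z Hz. field. auto.
  - apply (Hol_mult S f (fun z => / g z)%C); trivial. now apply Hol_inv.
Qed.

(** [d] is the u-partial of [f], and its Cauchy-Riemann equations are the u-derivatives of those of
    [f], after exchanging mixed partials. *)
Lemma Hol_deriv (S : C -> Prop) (f d : C -> C) :
  open S -> Hol S f d -> exists d', Hol S d d'.
Proof.
  intros HO [[H1 H2] H3].
  set (f1 := fun u v => fst (f (u, v))) in *. set (f2 := fun u v => snd (f (u, v))) in *.
  assert (E : forall z, S z -> (pu f1 (fst z) (snd z), pu f2 (fst z) (snd z)) = d z).
  { intros z Hz. destruct (H3 z Hz) as [[Ha Hb] _]. destruct z as [u v].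
    apply C_eq; simpl; now apply is_derive_unique. }
  assert (Ev1 : forall u v, S (u, v) -> pv f1 u v = - pu f2 u v).
  { intros u v Hz. pose proof (E _ Hz) as Ez. destruct (H3 _ Hz) as [_ [Ha _]].
    rewrite <- Ez in Ha. simpl in Ha. apply is_derive_unique in Ha.
    unfold pv, f1. rewrite Ha. simpl. ring. }
  assert (Ev2 : forall u v, S (u, v) -> pv f2 u v = pu f1 u v).
  { intros u v Hz. pose proof (E _ Hz) as Ez. destruct (H3 _ Hz) as [_ [_ Ha]].
    rewrite <- Ez in Ha. simpl in Ha. apply is_derive_unique in Ha.
    unfold pv, f2. rewrite Ha. simpl. ring. }
  exists (fun z => (pu (pu f1) (fst z) (snd z), pu (pu f2) (fst z) (snd z))).
  apply Hol_ext with (fun z => (pu f1 (fst z) (snd z), pu f2 (fst z) (snd z)))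
                     (fun z => (pu (pu f1) (fst z) (snd z), pu (pu f2) (fst z) (snd z)));
    trivial.
  assert (K1 := smooth_fun_pu _ _ H1). assert (K2 := smooth_fun_pu _ _ H2).
  split; [now split|].
  intros [u v] Hz. simpl. split; split; simpl.
  - now apply (smooth_fun_derive_u S).
  - now apply (smooth_fun_derive_u S).
  - eapply is_derive_eq; [now apply (smooth_fun_derive_v S (pu f1) u v K1)|].
    rewrite <- (pu_pv_comm S f1 u v HO H1 Hz).
    rewrite (pu_ext S (pv f1) (fun a b => - pu f2 a b) u v HO Hz Ev1).
    unfold pu at 1. rewrite Derive_opp. unfold pu. ring.
  - eapply is_derive_eq; [now apply (smooth_fun_derive_v S (pu f2) u v K2)|].
    rewrite <- (pu_pv_comm S f2 u v HO H2 Hz).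
    rewrite (pu_ext S (pv f2) (pu f1) u v HO Hz Ev2). ring.
Qed.

Lemma cpartials_constant (S : C -> Prop) (f : C -> C) :
  open S -> path_connected S -> (forall z, S z -> cpartials f z 0 0) ->
  forall z w, S z -> S w -> f z = f w.
Proof.
  intros HO HC K z w Hz Hw.
  rewrite (surjective_pairing z), (surjective_pairing w). apply C_eq.
  - apply (locally_constant S (fun a b => fst (f (a, b))) HO HC); trivial; intros u v Huv.
    + exact (proj1 (proj1 (K (u, v) Huv))).
    + exact (proj1 (proj2 (K (u, v) Huv))).
  - apply (locally_constant S (fun a b => snd (f (a, b))) HO HC); trivial; intros u v Huv.
    + exact (proj2 (proj1 (K (u, v) Huv))).
    + exact (proj2 (proj2 (K (u, v) Huv))).
Qed.

Lemma Hol_constant (S : C -> Prop) (f d : C -> C) :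
  open S -> path_connected S -> Hol S f d -> (forall z, S z -> d z = 0) ->
  forall z w, S z -> S w -> f z = f w.
Proof.
  intros HO HC [_ H] Hd. apply cpartials_constant; trivial.
  intros z Hz. specialize (H z Hz). rewrite Hd in H by trivial.
  now rewrite Cmult_0_r in H.
Qed.

(** The two partials [d] and [i d] both have vanishing real part, which kills both components of
    [d]. *)
Lemma Hol_imaginary (S : C -> Prop) (f d : C -> C) :
  open S -> Hol S f d -> (forall z, S z -> fst (f z) = 0) -> forall z, S z -> d z = 0.
Proof.
  intros HO [_ H] Hf [u v] Hz. destruct (H _ Hz) as [[Hu _] [Hv _]]. simpl in *.
  assert (Eu : fst (d (u, v)) = 0).
  { rewrite <- (is_derive_unique _ _ _ Hu).
    rewrite <- (Derive_const 0 u). apply Derive_ext_loc.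
    apply (open_locally_fst S _ u v HO Hz). intros a Ha. now apply (Hf (a, v)). }
  assert (Ev : 0 * fst (d (u, v)) - 1 * snd (d (u, v)) = 0).
  { rewrite <- (is_derive_unique _ _ _ Hv).
    rewrite <- (Derive_const 0 v). apply Derive_ext_loc.
    apply (open_locally_snd S _ u v HO Hz). intros a Ha. now apply (Hf (u, a)). }
  apply C_eq; simpl; lra.
Qed.

(** * Conformal coordinates and Weierstrass data *)

Definition wsurf (l : R -> R -> R) (F : C -> C) : R -> R -> I3 :=
  fun u v => (l u v, fst (F (u, v)), snd (F (u, v))).

Definition refl (e : R) (Y : I3) : I3 := (lc Y, xc Y, e * yc Y).

(** Weierstrass data [(h, f dz)] of the surface up to the reflection [refl e], with
    [h f = l_u - i l_v]. Only the real primitive [l] of [h f] is carried along; no complex primitive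
    is chosen. *)
Record wsurf_data (S : C -> Prop) (l : R -> R -> R) (F f h h1 : C -> C) : Prop := {
  wd_open : open S;
  wd_conn : path_connected S;
  wd_F : Hol S F f;
  wd_h : Hol S h h1;
  wd_f : forall z, S z -> f z <> 0;
  wd_smooth : smooth_fun S l;
  wd_lu : forall u v, S (u, v) ->
    is_derive (fun t => l t v) u (fst (h (u, v) * f (u, v))%C);
  wd_lv : forall u v, S (u, v) ->
    is_derive (fun t => l u t) v (fst (Ci * (h (u, v) * f (u, v)))%C)
}.

Lemma conformal_CR (a b c d k : R) :
  0 < k -> a * a + b * b = k -> a * c + b * d = 0 -> c * c + d * d = k ->
  exists e, e * e = 1 /\ c = - e * b /\ d = e * a /\ a * d - b * c = e * k.
Proof.
  (* Orthogonal vectors of equal length differ by a quarter turn; the normalized determinant is its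
     sense. *)
  intros Hk H1 H2 H3. exists ((a * d - b * c) / k).
  assert (Hc : c * k = - (a * d - b * c) * b).
  { rewrite <- H1. replace (c * (a * a + b * b)) with (a * (a * c + b * d) - (a * d - b * c) * b) by ring. rewrite H2. ring. }
  assert (Hd : d * k = (a * d - b * c) * a).
  { rewrite <- H1. replace (d * (a * a + b * b)) with (b * (a * c + b * d) + (a * d - b * c) * a) by ring. rewrite H2. ring. }
  assert (E : (a * d - b * c) * (a * d - b * c) = k * k).
  { replace (k * k) with ((a * a + b * b) * (c * c + d * d) - (a * c + b * d) * (a * c + b * d))
      by (rewrite H1, H2, H3; ring). ring. }
  split; [|split; [|split]].
  - replace (_ * _) with ((a * d - b * c) * (a * d - b * c) / (k * k)) by (field; lra).
    rewrite E. field. lra.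
  - apply Rmult_eq_reg_r with k; [rewrite Hc|lra]. field. lra.
  - apply Rmult_eq_reg_r with k; [rewrite Hd|lra]. field. lra.
  - field. lra.
Qed.

Lemma pu_scal (k : R) (f : R -> R -> R) (u v : R) :
  pu (fun a b => k * f a b) u v = k * pu f u v.
Proof. apply (Derive_scal (fun t => f t v)). Qed.

Lemma pv_scal (k : R) (f : R -> R -> R) (u v : R) :
  pv (fun a b => k * f a b) u v = k * pv f u v.
Proof. apply (Derive_scal (fun t => f u t)). Qed.

Lemma isotropic_data (S : C -> Prop) (X : R -> R -> I3)
    (omega : R -> R -> R) (n : R -> R -> R31) :
  simply_connected_domain S -> spacelike_immersion S X ->
  conformal_coordinates S X omega -> lightlike_gauss_map S X n ->
  zero_mean_curvature S X omega n ->
  exists (e : R) (l : R -> R -> R) (F f h h1 : C -> C),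
    e * e = 1 /\ wsurf_data S l F f h h1 /\
    forall u v, X u v = refl e (wsurf l F u v).
Proof.
  intros ((z0 & Hz0) & HO & HC & _) ((Sl & Sx & Sy) & _) Hc Hn HH.
  set (l := lcf X) in *. set (x := xcf X) in *. set (y := ycf X) in *.
  (* The sign [e] is first found pointwise, as the sign of this Jacobian. Since [J] never vanishes,
     that sign is constant on the connected domain. *)
  set (J := fun u v => pu x u v * pv y u v - pu y u v * pv x u v).
  assert (HCR : forall u v, S (u, v) -> exists e, e * e = 1 /\
     pv x u v = - e * pu y u v /\ pv y u v = e * pu x u v /\
     J u v = e * exp (2 * omega u v)).
  { intros u v Hz. destruct (Hc u v Hz) as (H1 & H2 & H3).
    unfold gI, mink, emb, Du, Dv in H1, H2, H3. simpl in H1, H2, H3.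
    fold l x y in H1, H2, H3.
    apply conformal_CR; [apply exp_pos|unfold lc, xc, yc in *; simpl in *; lra..]. }
  assert (SJ : smooth_fun S J).
  { apply (smooth_fun_plus S (fun u v => pu x u v * pv y u v)
      (fun u v => - (pu y u v * pv x u v)) HO);
      [|apply (smooth_fun_opp S (fun u v => pu y u v * pv x u v) HO)];
      apply smooth_fun_mult; trivial; try apply smooth_fun_pu; try apply smooth_fun_pv; trivial. }
  assert (HJ : forall u v, S (u, v) -> 0 < J u v * J u v).
  { intros u v Hz. destruct (HCR u v Hz) as (e & He & _ & _ & ->).
    generalize (exp_pos (2 * omega u v)). intros. nra. }
  (* The root stands for the absolute value and can be differentiated by rule. *)
  set (sg := fun u v => J u v / sqrt (J u v * J u v)).
  assert (Hsg0 : forall (g : R -> R) t a, 0 < g t * g t -> is_derive g t a ->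
     is_derive (fun s => g s / sqrt (g s * g s)) t 0).
  { intros g t a Hp Hg.
    assert (Hex : ex_derive g t) by (eexists; exact Hg).
    assert (Hs : sqrt (g t * g t) <> 0) by (apply Rgt_not_eq, sqrt_lt_R0, Hp).
    auto_derive; [tauto|].
    assert (E := sqrt_sqrt (g t * g t) (Rlt_le _ _ Hp)).
    change (Derive (fun x0 : R => g x0) t) with (Derive g t).
    replace (/ (2 * sqrt (g t * g t))) with (/ 2 * / sqrt (g t * g t)) by (field; auto).
    set (q := sqrt (g t * g t)) in *.
    transitivity (Derive g t * (q * q - g t * g t) / (q * q * q)); [field; auto|].
    rewrite E. unfold Rdiv. ring. }
  assert (Hsg : forall u v, S (u, v) -> sg u v = sg (fst z0) (snd z0)).
  { intros u v Hz. apply (locally_constant S sg HO HC) with (z := (u, v)); trivial.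
    - intros a b Hab. apply (Hsg0 (fun t => J t b) a (pu J a b)); [now apply HJ|].
      now apply (smooth_fun_derive_u S).
    - intros a b Hab. apply (Hsg0 (fun t => J a t) b (pv J a b)); [now apply HJ|].
      now apply (smooth_fun_derive_v S). }
  assert (Hsge : forall u v e, e * e = 1 -> J u v = e * exp (2 * omega u v) -> sg u v = e).
  { intros u v e He E. unfold sg. rewrite E.
    pose proof (exp_pos (2 * omega u v)) as Hp.
    replace (e * exp (2 * omega u v) * (e * exp (2 * omega u v)))
      with (exp (2 * omega u v) * exp (2 * omega u v))
      by (rewrite <- (Rmult_1_l (exp _ * exp _)), <- He at 1; ring).
    rewrite sqrt_square by lra. field. lra. }
  destruct z0 as [u0 v0].
  destruct (HCR u0 v0 Hz0) as (e & He & _ & _ & EJ0).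
  assert (CR : forall u v, S (u, v) ->
     pv x u v = - e * pu y u v /\ pv y u v = e * pu x u v).
  { intros u v Hz. destruct (HCR u v Hz) as (e' & He' & Hx & Hy & EJ).
    assert (e' = e); [|now subst].
    rewrite <- (Hsge u v e' He' EJ), <- (Hsge u0 v0 e He EJ0). now apply (Hsg u v). }
  assert (SX : forall g, smooth_fun S g -> smooth_fun S (fun u v => e * g u v)).
  { intros g Hg. apply smooth_fun_mult; trivial. now apply smooth_fun_const. }
  set (F := (fun z => (x (fst z) (snd z), e * y (fst z) (snd z))) : C -> C).
  set (f := (fun z => (pu x (fst z) (snd z), e * pu y (fst z) (snd z))) : C -> C).
  assert (HF : Hol S F f).
  { split; [split; simpl; auto|].
    intros [u v] Hz. destruct (CR u v Hz) as (Ex & Ey). split; split; simpl.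
    - now apply (smooth_fun_derive_u S).
    - apply (is_derive_scal (fun t => y t v)). now apply (smooth_fun_derive_u S).
    - eapply is_derive_eq; [now apply (smooth_fun_derive_v S)|]. rewrite Ex. ring.
    - eapply is_derive_eq;
        [apply (is_derive_scal (fun t => y u t)); now apply (smooth_fun_derive_v S)|].
      rewrite Ey. ring_simplify. replace (e ^ 2) with 1 by (simpl; lra). ring. }
  assert (Harm : forall u v, S (u, v) -> pu (pu x) u v + pv (pv x) u v = 0 /\
     pu (pu y) u v + pv (pv y) u v = 0).
  { intros u v Hz.
    rewrite (pv_ext S (pv x) (fun a b => - e * pu y a b) u v HO Hz) by (intros; now apply CR).
    rewrite (pv_ext S (pv y) (fun a b => e * pu x a b) u v HO Hz) by (intros; now apply CR).
    rewrite !pv_scal.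
    rewrite <- (pu_pv_comm S y), <- (pu_pv_comm S x) by trivial.
    rewrite (pu_ext S (pv x) (fun a b => - e * pu y a b) u v HO Hz) by (intros; now apply CR).
    rewrite (pu_ext S (pv y) (fun a b => e * pu x a b) u v HO Hz) by (intros; now apply CR).
    rewrite !pu_scal.
    split.
    - replace (- e * (e * pu (pu x) u v)) with (- (e * e) * pu (pu x) u v) by ring.
      rewrite He. ring.
    - replace (e * (- e * pu (pu y) u v)) with (- (e * e) * pu (pu y) u v) by ring.
      rewrite He. ring. }
  (* [<n, p> = 1] means [n3 = 1 + n0], so pairing a vector of the hyperplane with [n] gives its [l]
     coordinate plus a combination of its [x] and [y] coordinates. As [x] and [y] are harmonic,
     [L + N] is the Laplacian of [l]. *)
  assert (Hl : forall u v, S (u, v) -> pv (pv l) u v = - pu (pu l) u v).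
  { intros u v Hz. destruct (Harm u v Hz) as [Hx Hy].
    pose proof (HH u v Hz) as Hm. destruct (Hn u v Hz) as (_ & _ & _ & Hp).
    unfold mean_curvature in Hm. apply Rmult_integral in Hm.
    destruct Hm as [Hm|Hm].
    { generalize (exp_pos (- 2 * omega u v)). nra. }
    destruct (n u v) as [[[n0 n1] n2] n3].
    unfold mink, emb, pvec in Hm, Hp. simpl in Hm, Hp.
    unfold lc, xc, yc in Hm. simpl in Hm.
    change (lcf (Du X)) with (pu l) in Hm. change (xcf (Du X)) with (pu x) in Hm.
    change (ycf (Du X)) with (pu y) in Hm. change (lcf (Dv X)) with (pv l) in Hm.
    change (xcf (Dv X)) with (pv x) in Hm. change (ycf (Dv X)) with (pv y) in Hm.
    assert (n3 = 1 + n0) by lra. subst n3.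
    replace (pv (pv x) u v) with (- pu (pu x) u v) in Hm by lra.
    replace (pv (pv y) u v) with (- pu (pu y) u v) in Hm by lra. lra. }
  set (P := (fun z => (pu l (fst z) (snd z), - pv l (fst z) (snd z))) : C -> C).
  set (P1 := (fun z => (pu (pu l) (fst z) (snd z), - pu (pv l) (fst z) (snd z))) : C -> C).
  assert (Slu := smooth_fun_pu S l Sl). assert (Slv := smooth_fun_pv S l Sl).
  assert (HP : Hol S P P1).
  { split; [split; simpl; trivial; now apply smooth_fun_opp|].
    intros [u v] Hz. split; split; simpl.
    - now apply (smooth_fun_derive_u S (pu l)).
    - apply (is_derive_opp (V := R_NormedModule) (fun t => pv l t v)).
      now apply (smooth_fun_derive_u S).
    - eapply is_derive_eq; [now apply (smooth_fun_derive_v S (pu l))|].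
      rewrite <- (pu_pv_comm S l) by trivial. ring.
    - eapply is_derive_eq.
      + apply (is_derive_opp (V := R_NormedModule) (fun t => pv l u t)).
        now apply (smooth_fun_derive_v S).
      + unfold opp; simpl. rewrite Hl by trivial. ring. }
  assert (Hf : forall z, S z -> f z <> 0).
  { intros [u v] Hz E. destruct (HCR u v Hz) as (e' & He' & Ex & Ey & EJ).
    injection E as E1 E2. simpl in E1, E2.
    assert (pu y u v = 0) by nra.
    unfold J in EJ. rewrite E1, H in EJ.
    generalize (exp_pos (2 * omega u v)). nra. }
  destruct (Hol_deriv S F f HO HF) as [f1 Hf1].
  exists e, l, F, f, (fun z => P z / f z)%C, (fun z => (P1 z * f z - P z * f1 z) / (f z * f z))%C.
  split; [exact He|split].
  - split; trivial.
    + now apply Hol_div.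
    + intros u v Hz.
      replace (P (u, v) / f (u, v) * f (u, v))%C with (P (u, v)) by (field; auto).
      now apply (smooth_fun_derive_u S).
    + intros u v Hz.
      replace (P (u, v) / f (u, v) * f (u, v))%C with (P (u, v)) by (field; auto).
      simpl. eapply is_derive_eq; [now apply (smooth_fun_derive_v S)|]. ring.
  - intros u v. unfold refl, wsurf, F, lc, xc, yc, l, x, y, lcf, xcf, ycf, lc, xc, yc. simpl.
    replace (e * (e * snd (X u v))) with (snd (X u v))
      by (rewrite <- Rmult_assoc, He; ring).
    now destruct (X u v) as [[? ?] ?].
Qed.

(** * The affine normal of a zero mean curvature surface *)

Definition norm2 (z : C) : R := fst z ^ 2 + snd z ^ 2.

Lemma is_derive_ln_norm2 (g : R -> C) (t : R) (k : C) :
  g t <> 0 -> cderiv g t (g t * k)%C ->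
  is_derive (fun s => ln (norm2 (g s))) t (2 * fst k).
Proof.
  intros Hn [H1 H2]. pose proof (Cnorm2_pos _ Hn) as Hp.
  assert (Hm : is_derive (fun s => norm2 (g s)) t (norm2 (g t) * (2 * fst k))).
  { apply is_derive_ext with (fun s => fst (g s) * fst (g s) + snd (g s) * snd (g s)).
    - intros; unfold norm2; simpl; ring.
    - eapply is_derive_eq.
      + apply (is_derive_plus (V := R_NormedModule));
          [exact (is_derive_Rmult _ _ _ _ _ H1 H1)|exact (is_derive_Rmult _ _ _ _ _ H2 H2)].
      + unfold plus, norm2; simpl. ring. }
  eapply is_derive_eq.
  - apply (is_derive_comp ln (fun s => norm2 (g s))); [|exact Hm].
    now apply is_derive_Reals, derivable_pt_lim_ln.
  - unfold scal; simpl; unfold mult; simpl. field. unfold norm2 in *. lra.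
Qed.

Lemma is_derive_Rpower_norm2 (g : R -> C) (t p : R) (k : C) :
  g t <> 0 -> cderiv g t (g t * k)%C ->
  is_derive (fun s => Rpower (norm2 (g s)) p) t (Rpower (norm2 (g t)) p * (2 * p * fst k)).
Proof.
  intros Hn Hg. unfold Rpower. eapply is_derive_eq.
  - apply (is_derive_comp exp (fun s => p * ln (norm2 (g s)))); [apply is_derive_exp|].
    apply (is_derive_scal (fun s => ln (norm2 (g s)))). exact (is_derive_ln_norm2 g t k Hn Hg).
  - unfold scal; simpl; unfold mult; simpl. ring.
Qed.

(** [Th] need not be holomorphic: [w2] and [Cconj w1] are its logarithmic derivatives in z and in
    the conjugate of z. The product [|Th|^(2p) conj(Th) g] occurs twice below, with [p = -1/2] for
    the flux in the Laplacian and [p = -3/4] for the affine normal. *)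
Lemma cpartials_weighted (Th g : C -> C) (z w1 w2 g1 : C) (p : R) :
  Th z <> 0 ->
  cpartials Th z (Th z * (w2 + Cconj w1))%C (Th z * (Ci * (w2 - Cconj w1)))%C ->
  cpartials g z g1 (Ci * g1)%C ->
  cpartials (fun y => RtoC (Rpower (norm2 (Th y)) p) * (Cconj (Th y) * g y))%C z
    (RtoC (Rpower (norm2 (Th z)) p) * (Cconj (Th z) *
       ((RtoC (2 * p * fst (w1 + w2)%C) + Cconj w2 + w1) * g z + g1)))%C
    (RtoC (Rpower (norm2 (Th z)) p) * (Cconj (Th z) *
       ((RtoC (- (2 * p * snd (w1 + w2)%C)) - Ci * Cconj w2 + Ci * w1) * g z + Ci * g1)))%C.
Proof.
  destruct z as [u v]. intros Hn [Hu Hv] [Ku Kv]. split.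
  - eapply cderiv_eq.
    + apply cderiv_mult; [|apply cderiv_mult; [|exact Ku]].
      * apply cderiv_RtoC.
        exact (is_derive_Rpower_norm2 (fun t => Th (t, v)) u p _ Hn Hu).
      * apply cderiv_conj. exact Hu.
    + cbn [fst snd]. rewrite Cmult_conj, Cplus_conj, Cconj_conj, RtoC_mult.
      replace (fst (w2 + Cconj w1)%C) with (fst (w1 + w2)%C) by (simpl; ring).
      ring.
  - eapply cderiv_eq.
    + apply cderiv_mult; [|apply cderiv_mult; [|exact Kv]].
      * apply cderiv_RtoC.
        exact (is_derive_Rpower_norm2 (fun t => Th (u, t)) v p _ Hn Hv).
      * apply cderiv_conj. exact Hv.
    + cbn [fst snd]. rewrite !Cmult_conj, Cminus_conj, Cconj_conj, RtoC_mult.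
      replace (2 * p * fst (Ci * (w2 - Cconj w1))%C) with (- (2 * p * snd (w1 + w2)%C))
        by (simpl; ring).
      replace (Cconj Ci) with (- Ci)%C by (apply C_eq; simpl; ring).
      ring.
Qed.

Lemma Hol_pu_fst (S : C -> Prop) (f d : C -> C) (u v : R) :
  Hol S f d -> S (u, v) -> pu (fun a b => fst (f (a, b))) u v = fst (d (u, v)).
Proof. intros [_ H] Hz. now apply is_derive_unique, (H (u, v)). Qed.

Lemma Hol_pu_snd (S : C -> Prop) (f d : C -> C) (u v : R) :
  Hol S f d -> S (u, v) -> pu (fun a b => snd (f (a, b))) u v = snd (d (u, v)).
Proof. intros [_ H] Hz. now apply is_derive_unique, (H (u, v)). Qed.

Lemma Hol_pv_fst (S : C -> Prop) (f d : C -> C) (u v : R) :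
  Hol S f d -> S (u, v) -> pv (fun a b => fst (f (a, b))) u v = - snd (d (u, v)).
Proof.
  intros [_ H] Hz. apply is_derive_unique. destruct (H (u, v) Hz) as [_ [K _]].
  eapply is_derive_eq; [exact K|]. simpl. ring.
Qed.

Lemma Hol_pv_snd (S : C -> Prop) (f d : C -> C) (u v : R) :
  Hol S f d -> S (u, v) -> pv (fun a b => snd (f (a, b))) u v = fst (d (u, v)).
Proof.
  intros [_ H] Hz. apply is_derive_unique. destruct (H (u, v) Hz) as [_ [_ K]].
  eapply is_derive_eq; [exact K|]. simpl. ring.
Qed.

Section Affine.

Variables (S : C -> Prop) (X : R -> R -> I3) (l : R -> R -> R) (F f h h1 f1 h2 : C -> C) (e : R).
Hypothesis (HD : wsurf_data S l F f h h1) (He : e * e = 1)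
  (HX : forall u v, X u v = refl e (wsurf l F u v))
  (Hf1 : Hol S f f1) (Hh2 : Hol S h1 h2).

Let HO := wd_open _ _ _ _ _ _ HD.
Let HF := wd_F _ _ _ _ _ _ HD.
Let Hh := wd_h _ _ _ _ _ _ HD.
Let Hf := wd_f _ _ _ _ _ _ HD.

Let P1 := fun z => (h1 z * f z + h z * f1 z)%C.
Let HP1 : Hol S (fun z => h z * f z)%C P1 := Hol_mult _ _ _ _ _ HO Hh Hf1.

Lemma wsurf_first u v : S (u, v) ->
  Du X u v = (fst (h (u, v) * f (u, v))%C, fst (f (u, v)), e * snd (f (u, v))) /\
  Dv X u v = (- snd (h (u, v) * f (u, v))%C, - snd (f (u, v)), e * fst (f (u, v))).
Proof.
  intros Hz. split.
  - unfold Du.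
    rewrite (pu_ext S (lcf X) l) by (trivial; intros; unfold lcf; now rewrite HX).
    rewrite (pu_ext S (xcf X) (fun a b => fst (F (a, b)))) by (trivial; intros; unfold xcf; now rewrite HX).
    rewrite (pu_ext S (ycf X) (fun a b => e * snd (F (a, b)))) by (trivial; intros; unfold ycf; now rewrite HX).
    rewrite pu_scal, (Hol_pu_fst S F f), (Hol_pu_snd S F f) by trivial.
    f_equal; f_equal. apply is_derive_unique. exact (wd_lu _ _ _ _ _ _ HD _ _ Hz).
  - unfold Dv.
    rewrite (pv_ext S (lcf X) l) by (trivial; intros; unfold lcf; now rewrite HX).
    rewrite (pv_ext S (xcf X) (fun a b => fst (F (a, b)))) by (trivial; intros; unfold xcf; now rewrite HX).
    rewrite (pv_ext S (ycf X) (fun a b => e * snd (F (a, b)))) by (trivial; intros; unfold ycf; now rewrite HX).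
    rewrite pv_scal, (Hol_pv_fst S F f), (Hol_pv_snd S F f) by trivial.
    f_equal; f_equal. apply is_derive_unique.
    eapply is_derive_eq; [exact (wd_lv _ _ _ _ _ _ HD _ _ Hz)|]. simpl. ring.
Qed.

Lemma wsurf_second u v : S (u, v) ->
  Du (Du X) u v = (fst (P1 (u, v)), fst (f1 (u, v)), e * snd (f1 (u, v))) /\
  Dv (Du X) u v = (- snd (P1 (u, v)), - snd (f1 (u, v)), e * fst (f1 (u, v))) /\
  Dv (Dv X) u v = (- fst (P1 (u, v)), - fst (f1 (u, v)), - e * snd (f1 (u, v))).
Proof.
  intros Hz. split; [|split].
  - unfold Du at 1.
    rewrite (pu_ext S (lcf (Du X)) (fun a b => fst (h (a, b) * f (a, b))%C)) by (trivial; intros a b Hab; unfold lcf; now rewrite (proj1 (wsurf_first a b Hab))).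
    rewrite (pu_ext S (xcf (Du X)) (fun a b => fst (f (a, b)))) by (trivial; intros a b Hab; unfold xcf; now rewrite (proj1 (wsurf_first a b Hab))).
    rewrite (pu_ext S (ycf (Du X)) (fun a b => e * snd (f (a, b)))) by (trivial; intros a b Hab; unfold ycf; now rewrite (proj1 (wsurf_first a b Hab))).
    now rewrite pu_scal, (Hol_pu_fst S f f1), (Hol_pu_snd S f f1), (Hol_pu_fst S _ P1 u v HP1).
  - unfold Dv.
    rewrite (pv_ext S (lcf (Du X)) (fun a b => fst (h (a, b) * f (a, b))%C)) by (trivial; intros a b Hab; unfold lcf; now rewrite (proj1 (wsurf_first a b Hab))).
    rewrite (pv_ext S (xcf (Du X)) (fun a b => fst (f (a, b)))) by (trivial; intros a b Hab; unfold xcf; now rewrite (proj1 (wsurf_first a b Hab))).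
    rewrite (pv_ext S (ycf (Du X)) (fun a b => e * snd (f (a, b)))) by (trivial; intros a b Hab; unfold ycf; now rewrite (proj1 (wsurf_first a b Hab))).
    now rewrite pv_scal, (Hol_pv_fst S f f1), (Hol_pv_snd S f f1), (Hol_pv_fst S _ P1 u v HP1).
  - unfold Dv at 1.
    rewrite (pv_ext S (lcf (Dv X)) (fun a b => -1 * snd (h (a, b) * f (a, b))%C)) by (trivial; intros a b Hab; unfold lcf; rewrite (proj2 (wsurf_first a b Hab)); unfold lc; cbn [fst snd]; ring).
    rewrite (pv_ext S (xcf (Dv X)) (fun a b => -1 * snd (f (a, b)))) by (trivial; intros a b Hab; unfold xcf; rewrite (proj2 (wsurf_first a b Hab)); unfold xc; cbn [fst snd]; ring).
    rewrite (pv_ext S (ycf (Dv X)) (fun a b => e * fst (f (a, b)))) by (trivial; intros a b Hab; unfold ycf; now rewrite (proj2 (wsurf_first a b Hab))).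
    rewrite !pv_scal, (Hol_pv_fst S f f1), (Hol_pv_snd S f f1), (Hol_pv_snd S _ P1 u v HP1) by trivial.
    f_equal; [f_equal|]; ring.
Qed.

(* The Blaschke metric is |Th|^(-1/2) Re (Th dz^2) up to the sign [e], and
   [w2 + conj w1] below is the logarithmic derivative of [Th] in u. *)
Let Th := fun z => (h1 z * f z * f z * Cconj (f z))%C.

Lemma wsurf_LMN u v : S (u, v) ->
  Lt X u v = e * fst (Th (u, v)) /\ Mt X u v = - e * snd (Th (u, v)) /\
  Nt X u v = - e * fst (Th (u, v)).
Proof.
  intros Hz. unfold Lt, Mt, Nt.
  destruct (wsurf_first u v Hz) as [-> ->], (wsurf_second u v Hz) as (-> & -> & ->).
  unfold Th, P1. simpl. repeat split; ring.
Qed.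

Lemma wsurf_discr u v : S (u, v) -> discr X u v = - norm2 (Th (u, v)).
Proof.
  intros Hz. unfold discr. destruct (wsurf_LMN u v Hz) as (-> & -> & ->).
  unfold norm2. generalize (Th (u, v)). intros t.
  transitivity (- (e * e) * (fst t ^ 2 + snd t ^ 2)); [ring|].
  rewrite He. ring.
Qed.

Hypothesis Hnd : nondegenerate S X.

Lemma wsurf_Th_neq0 z : S z -> Th z <> 0.
Proof.
  destruct z as [u v]. intros Hz E. apply (Hnd u v Hz). rewrite wsurf_discr, E by trivial.
  unfold norm2. simpl. ring.
Qed.

Lemma wsurf_h1_neq0 z : S z -> h1 z <> 0.
Proof. intros Hz E. apply (wsurf_Th_neq0 z Hz). unfold Th. rewrite E. ring. Qed.

Let w1 := fun z => (f1 z / f z)%C.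
Let w2 := fun z => (h2 z / h1 z + 2 * w1 z)%C.

(** The holomorphic factor [h1 f f] of [Th] contributes [w2], the antiholomorphic factor [Cconj f]
    contributes [Cconj w1]. *)
Lemma Th_partials z : S z ->
  cpartials Th z (Th z * (w2 z + Cconj (w1 z)))%C (Th z * (Ci * (w2 z - Cconj (w1 z))))%C.
Proof.
  intros Hz. pose proof (wsurf_h1_neq0 z Hz) as Hn. pose proof (Hf z Hz) as Hn'.
  destruct (proj2 Hf1 z Hz) as [Fu Fv], (proj2 Hh2 z Hz) as [Gu Gv].
  assert (Hc : Cconj (w1 z) = (Cconj (f1 z) / Cconj (f z))%C) by now apply Cdiv_conj.
  assert (Hn2 : Cconj (f z) <> 0).
  { intros E. apply Hn'. rewrite <- (Cconj_conj (f z)), E. apply C_eq; simpl; ring. }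
  rewrite Hc. unfold Th, w2, w1. destruct z as [u v].
  split; (eapply cderiv_eq;
    [apply cderiv_mult; [apply cderiv_mult; [apply cderiv_mult; eassumption|eassumption]|
      apply cderiv_conj; eassumption]|]);
  cbn [fst snd].
  - field. tauto.
  - rewrite Cmult_conj. replace (Cconj Ci) with (- Ci)%C by (apply C_eq; simpl; ring).
    field. tauto.
Qed.

(** The metric has [G = - E]. Hence, with [psi = phi_u - i phi_v], the flux whose divergence enters
    the Laplacian is [e (Re V, Im V)] for [V = |Th|^(-1) conj(Th) psi], and its divergence
    [e (Re V_u + Im V_v)] comes from [cpartials_weighted]. *)
Lemma laplace_wsurf (phi : R -> R -> R) (psi psi1 : C -> C) u v :
  (forall a b, S (a, b) -> pu phi a b = fst (psi (a, b)) /\ pv phi a b = - snd (psi (a, b))) ->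
  Hol S psi psi1 -> S (u, v) ->
  laplace_beltrami (bE X) (bF X) (bG X) phi u v =
  e * fst (RtoC (Rpower (norm2 (Th (u, v))) (- (3 / 4))) *
       (Cconj (Th (u, v)) * (2 * psi1 (u, v) + (w1 (u, v) - w2 (u, v)) * psi (u, v))))%C.
Proof.
  intros Hphi Hpsi Hz.
  set (V := fun y => (RtoC (Rpower (norm2 (Th y)) (- (1 / 2))) * (Cconj (Th y) * psi y))%C).
  assert (HV := cpartials_weighted Th psi (u, v) (w1 (u, v)) (w2 (u, v)) (psi1 (u, v)) (- (1 / 2))
    (wsurf_Th_neq0 _ Hz) (Th_partials _ Hz) (proj2 Hpsi _ Hz)).
  fold V in HV. destruct HV as [[HVu _] [_ HVv]]. cbn [fst snd] in HVu, HVv.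
  (* Here [m = |Th|^2] and [r = m^(-1/4)], so [r^4 m = 1] and the metric determinant is
     [- r^2 m = - 1 / r^2]. *)
  assert (Hr : forall a b, S (a, b) -> exists r q m, 0 < r /\ q = r * r /\ r * r * r * r * m = 1 /\
     m = norm2 (Th (a, b)) /\ r = Rpower m (- / 4) /\ q = Rpower m (- (1 / 2)) /\
     r * r * r = Rpower m (- (3 / 4)) /\
     bE X a b = r * (e * fst (Th (a, b))) /\ bF X a b = r * (- e * snd (Th (a, b))) /\
     bG X a b = r * (- e * fst (Th (a, b))) /\
     bE X a b * bG X a b - bF X a b * bF X a b = - / q /\
     sqrt (Rabs (bE X a b * bG X a b - bF X a b * bF X a b)) = / r).
  { intros a b Hab. exists (Rpower (norm2 (Th (a, b))) (- / 4)), (Rpower (norm2 (Th (a, b))) (- (1 / 2))), (norm2 (Th (a, b))).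
    assert (Hm : 0 < norm2 (Th (a, b))) by apply Cnorm2_pos, (wsurf_Th_neq0 _ Hab).
    set (m := norm2 (Th (a, b))) in *.
    assert (Hp : 0 < Rpower m (- / 4)) by apply exp_pos.
    assert (Hq : Rpower m (- (1 / 2)) = Rpower m (- / 4) * Rpower m (- / 4)).
    { rewrite <- Rpower_plus. f_equal. lra. }
    assert (Hm4 : Rpower m (- / 4) * Rpower m (- / 4) * Rpower m (- / 4) * Rpower m (- / 4) * m = 1).
    { rewrite <- (Rpower_1 m) at 5 by trivial. rewrite <- !Rpower_plus.
      replace (_ + _) with 0 by lra. now apply Rpower_O. }
    assert (H3 : Rpower m (- / 4) * Rpower m (- / 4) * Rpower m (- / 4) = Rpower m (- (3 / 4))).
    { rewrite <- !Rpower_plus. f_equal. lra. }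
    assert (HE : bE X a b = Rpower m (- / 4) * (e * fst (Th (a, b))) /\ bF X a b = Rpower m (- / 4) * (- e * snd (Th (a, b))) /\
     bG X a b = Rpower m (- / 4) * (- e * fst (Th (a, b)))).
    { unfold bE, bF, bG. rewrite wsurf_discr, Rabs_Ropp, Rabs_pos_eq by (trivial; apply Rlt_le, Hm).
      destruct (wsurf_LMN a b Hab) as (-> & -> & ->). auto. }
    destruct HE as (EE & EF & EG).
    assert (HW : bE X a b * bG X a b - bF X a b * bF X a b = - / Rpower m (- (1 / 2))).
    { rewrite EE, EF, EG, Hq. set (r := Rpower m (- / 4)) in *.
      transitivity (- (r * r * (e * e) * m)).
      - unfold m, norm2. simpl. ring.
      - rewrite He. replace m with (/ (r * r * r * r)).
        + field. lra.
        + apply Rmult_eq_reg_l with (r * r * r * r); [rewrite Hm4; field; lra|].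
          repeat apply Rmult_integral_contrapositive_currified; lra. }
    split; [exact Hp|]. split; [exact Hq|]. split; [exact Hm4|].
    split; [reflexivity|]. split; [reflexivity|]. split; [reflexivity|].
    split; [exact H3|]. split; [exact EE|]. split; [exact EF|]. split; [exact EG|].
    split; [exact HW|].
    rewrite HW, Rabs_Ropp, Rabs_pos_eq.
    - rewrite sqrt_inv, Hq, sqrt_square; lra.
    - apply Rlt_le, Rinv_0_lt_compat. rewrite Hq. nra. }
  unfold laplace_beltrami. cbv zeta.
  rewrite (pu_ext S _ (fun a b => e * fst (V (a, b))) u v HO Hz).
  2: { intros a b Hab. destruct (Hr a b Hab) as (r & q & m & Hp & Hq & Hm4 & Em & Er & Eq & _ & EE & EF & EG & EW & ES).
    rewrite ES, EW, EF, EG. destruct (Hphi a b Hab) as [-> ->].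
    unfold V. rewrite <- Em, <- Eq, Hq. simpl. field. lra. }
  rewrite (pv_ext S _ (fun a b => e * snd (V (a, b))) u v HO Hz).
  2: { intros a b Hab. destruct (Hr a b Hab) as (r & q & m & Hp & Hq & Hm4 & Em & Er & Eq & _ & EE & EF & EG & EW & ES).
    rewrite ES, EW, EF, EE. destruct (Hphi a b Hab) as [-> ->].
    unfold V. rewrite <- Em, <- Eq, Hq. simpl. field. lra. }
  assert (EU := is_derive_unique _ _ _ HVu : pu (fun a b => fst (V (a, b))) u v = _).
  assert (EV := is_derive_unique _ _ _ HVv : pv (fun a b => snd (V (a, b))) u v = _).
  rewrite pu_scal, pv_scal, EU, EV.
  destruct (Hr u v Hz) as (r & q & m & Hp & Hq & Hm4 & Em & Er & Eq & E3 & _ & _ & _ & _ & ->).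
  rewrite <- Em, <- Eq, <- E3, Hq. clear - Hp.
  generalize (Th (u, v)) (psi (u, v)) (psi1 (u, v)) (w1 (u, v)) (w2 (u, v)).
  intros a b c d g. simpl. field. lra.
Qed.

(** For [psi = f] the expression [2 psi1 + (w1 - w2) psi] of [laplace_wsurf] is this function,
    because [w1 f = f1]. So the [x + i e y] component of twice the affine normal is
    [e |Th|^(-3/2) conj(Th) kap]. *)
Let kap := fun z => (3 * f1 z - f z * w2 z)%C.

(** The horizontal components already determine the shape operator because [f] does not vanish:
    writing N for [Nn], they give [(N_u - i N_v) / f = - 2 e (tr S + i (s21 - s12))]. A vanishing
    trace leaves an imaginary number, which is a positive multiple of the quotient in the
    conclusion. *)
Lemma wsurf_affine kap1 :
  Hol S kap kap1 ->
  (forall u v, S (u, v) -> is_affine_mean_curvature X u v 0) ->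
  forall z, S z -> fst (((w1 z - 3 * w2 z) * kap z + 4 * kap1 z) / (h1 z * f z * f z))%C = 0.
Proof.
  intros Hk Hmc [u v] Hz.
  set (Nn := fun y => (RtoC (Rpower (norm2 (Th y)) (- (3 / 4))) * (Cconj (Th y) * kap y))%C).
  assert (HN := cpartials_weighted Th kap (u, v) (w1 (u, v)) (w2 (u, v)) (kap1 (u, v)) (- (3 / 4))
    (wsurf_Th_neq0 _ Hz) (Th_partials _ Hz) (proj2 Hk _ Hz)).
  fold Nn in HN.
  set (r := Rpower (norm2 (Th (u, v))) (- (3 / 4))) in *.
  assert (Hr : r <> 0) by (apply Rgt_not_eq, exp_pos).
  match type of HN with cpartials _ _ ?a ?b => set (A := a) in HN; set (B := b) in HN end.
  destruct HN as [[Ax Ay] [Bx By]]. cbn [fst snd] in Ax, Ay, Bx, By.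
  assert (Ex : forall a b, S (a, b) -> xcf (affine_normal X) a b = / 2 * e * fst (Nn (a, b))).
  { intros a b Hab. unfold affine_normal, xcf at 1, xc. cbn [fst snd].
    rewrite (laplace_wsurf (xcf X) f f1); trivial.
    - unfold Nn, kap, w2. rewrite Rmult_assoc. do 3 f_equal. f_equal.
      unfold w1. field. split; [now apply Hf|now apply wsurf_h1_neq0].
    - intros a' b' H'. change (xc (Du X a' b') = fst (f (a', b')) /\ xc (Dv X a' b') = - snd (f (a', b'))).
      now destruct (wsurf_first a' b' H') as [-> ->]. }
  assert (Ey : forall a b, S (a, b) -> ycf (affine_normal X) a b = / 2 * snd (Nn (a, b))).
  { intros a b Hab. unfold affine_normal, ycf at 1, yc. cbn [fst snd].
    (* Since [y = e Im F], one has [y_u - i y_v = - i e f]. *)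
    rewrite (laplace_wsurf (ycf X) (fun z => - (Ci * e) * f z)%C (fun z => - (Ci * e) * f1 z)%C); trivial.
    - f_equal. unfold Nn.
      replace (2 * (- (Ci * e) * f1 (a, b)) + (w1 (a, b) - w2 (a, b)) * (- (Ci * e) * f (a, b)))%C
        with (- (Ci * e) * kap (a, b))%C.
      + simpl. transitivity (e * e * snd (Nn (a, b))); [unfold Nn; simpl; ring|].
        rewrite He. unfold Nn. simpl. ring.
      + unfold kap, w2, w1. field. split; [now apply Hf|now apply wsurf_h1_neq0].
    - intros a' b' H'. change (yc (Du X a' b') = fst (- (Ci * e) * f (a', b'))%C /\ yc (Dv X a' b') = - snd (- (Ci * e) * f (a', b'))%C).
      destruct (wsurf_first a' b' H') as [-> ->]. unfold yc. simpl. split; ring.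
    - now apply Hol_scal. }
  destruct (Hmc u v Hz) as (s11 & s12 & s21 & s22 & [SU SV] & Hs).
  destruct (wsurf_first u v Hz) as [D1 D2]. rewrite D1, D2 in SU, SV.
  unfold Du, Dv in SU, SV.
  rewrite (pu_ext S _ _ u v HO Hz Ex), (pu_ext S _ _ u v HO Hz Ey), !pu_scal in SU.
  rewrite (pv_ext S _ _ u v HO Hz Ex), (pv_ext S _ _ u v HO Hz Ey), !pv_scal in SV.
  rewrite (is_derive_unique _ _ _ Ax : pu (fun a b => fst (Nn (a, b))) u v = _) in SU.
  rewrite (is_derive_unique _ _ _ Ay : pu (fun a b => snd (Nn (a, b))) u v = _) in SU.
  rewrite (is_derive_unique _ _ _ Bx : pv (fun a b => fst (Nn (a, b))) u v = _) in SV.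
  rewrite (is_derive_unique _ _ _ By : pv (fun a b => snd (Nn (a, b))) u v = _) in SV.
  injection SU as _ SU1 SU2. injection SV as _ SV1 SV2.
  change (/ 2 * e * fst A = - (s11 * fst (f (u, v)) + s21 * (- snd (f (u, v))))) in SU1.
  change (/ 2 * snd A = - (s11 * (e * snd (f (u, v))) + s21 * (e * fst (f (u, v))))) in SU2.
  change (/ 2 * e * fst B = - (s12 * fst (f (u, v)) + s22 * (- snd (f (u, v))))) in SV1.
  change (/ 2 * snd B = - (s12 * (e * snd (f (u, v))) + s22 * (e * fst (f (u, v))))) in SV2.
  assert (HAB : (A - Ci * B = f (u, v) * (Ci * RtoC (2 * e * (s12 - s21))))%C).
  { clear - SU1 SU2 SV1 SV2 He Hs. clearbody A B.
    assert (A1 : fst A = 2 * e * (- (s11 * fst (f (u, v)) + s21 * - snd (f (u, v))))).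
    { rewrite <- SU1. transitivity (e * e * fst A); [rewrite He|]; field. }
    assert (B1 : fst B = 2 * e * (- (s12 * fst (f (u, v)) + s22 * - snd (f (u, v))))).
    { rewrite <- SV1. transitivity (e * e * fst B); [rewrite He|]; field. }
    assert (A2 : snd A = 2 * (- (s11 * (e * snd (f (u, v))) + s21 * (e * fst (f (u, v)))))).
    { rewrite <- SU2. field. }
    assert (B2 : snd B = 2 * (- (s12 * (e * snd (f (u, v))) + s22 * (e * fst (f (u, v)))))).
    { rewrite <- SV2. field. }
    assert (s22 = - s11) by lra. subst s22.
    apply C_eq; simpl; rewrite ?A1, ?A2, ?B1, ?B2; ring. }
  assert (HAB2 : (A - Ci * B = RtoC r * (Cconj (Th (u, v)) *
     (/ 2 * ((w1 (u, v) - 3 * w2 (u, v)) * kap (u, v) + 4 * kap1 (u, v)))))%C).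
  (* In [A - i B] the terms with [Cconj w2] cancel, and the real and imaginary parts of [w1 + w2]
     coming from the power of [|Th|] recombine into [w]. *)
  { unfold A, B. set (w := (w1 (u, v) + w2 (u, v))%C).
    transitivity (r * (Cconj (Th (u, v)) * ((RtoC (2 * - (3 / 4)) * (RtoC (fst w) + Ci * RtoC (snd w)) + 2 * w1 (u, v)) * kap (u, v) + 2 * kap1 (u, v))))%C.
    - rewrite !RtoC_opp, !RtoC_mult, RtoC_opp.
      replace (Ci * (r * (Cconj (Th (u, v)) *
        ((- (2 * - RtoC (3 / 4) * snd w) - Ci * Cconj (w2 (u, v)) + Ci * w1 (u, v)) * kap (u, v) + Ci * kap1 (u, v)))))%C
      with (r * (Cconj (Th (u, v)) *
        ((- (2 * - RtoC (3 / 4) * snd w) * Ci - (Ci * Ci) * Cconj (w2 (u, v)) + (Ci * Ci) * w1 (u, v)) * kap (u, v) + (Ci * Ci) * kap1 (u, v))))%C by ring.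
      replace (Ci * Ci)%C with (- (1))%C by (apply C_eq; simpl; ring). ring.
    - replace (RtoC (fst w) + Ci * RtoC (snd w))%C with w by (apply C_eq; simpl; ring).
      replace (RtoC (2 * - (3 / 4))) with (- 3 / 2)%C by (apply C_eq; simpl; field).
      unfold w. do 2 f_equal. field. }
  pose proof (wsurf_h1_neq0 _ Hz) as N1. pose proof (Hf _ Hz) as N2.
  set (D := ((w1 (u, v) - 3 * w2 (u, v)) * kap (u, v) + 4 * kap1 (u, v))%C) in *.
  set (Psi := (h1 (u, v) * f (u, v) * f (u, v))%C) in *.
  assert (N3 : Psi <> 0) by (repeat apply Cmult_neq_0; trivial).
  assert (NC : forall c : C, c <> 0 -> Cconj c <> 0).
  { intros c Hc E. apply Hc. rewrite <- (Cconj_conj c), E. apply C_eq; simpl; ring. }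
  assert (Hr' : RtoC r <> 0) by (intros E; apply Hr; now apply RtoC_inj).
  (* [conj(Th) = conj(Psi) f] cancels the factor [f] of [HAB], and [conj(Psi) = |Psi|^2 / Psi]
     leaves a real denominator. *)
  assert (ED : (D / Psi = Ci * RtoC (4 * e * (s12 - s21) / (r * norm2 Psi)))%C).
  { pose proof (Cnorm2_pos _ N3) as Hm. fold (norm2 Psi) in Hm.
    assert (EP : RtoC (norm2 Psi) = (Psi * Cconj Psi)%C) by (apply C_eq; unfold norm2; simpl; ring).
    rewrite RtoC_div by (apply Rmult_integral_contrapositive_currified; lra).
    rewrite (RtoC_mult r), EP.
    replace (RtoC (4 * e * (s12 - s21))) with (2 * RtoC (2 * e * (s12 - s21)))%C by (apply C_eq; simpl; ring).
    rewrite HAB2 in HAB. unfold Th in HAB. fold Psi in HAB.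
    rewrite Cmult_conj, Cconj_conj in HAB.
    replace D with (2 * (r * (Cconj Psi * f (u, v) * (/ 2 * D))) / (r * Cconj Psi * f (u, v)))%C
      by (field; auto).
    rewrite HAB. field. auto. }
  rewrite ED. simpl. ring.
Qed.

End Affine.

(** * First integrals of the affine minimality equation *)

Lemma cexp_plus (z w : C) : cexp (z + w) = (cexp z * cexp w)%C.
Proof.
  unfold cexp, Re, Im. apply C_eq; simpl; rewrite exp_plus.
  - rewrite cos_plus. ring.
  - rewrite sin_plus. ring.
Qed.

Lemma cexp_0 : cexp 0 = 1.
Proof. unfold cexp. apply C_eq; simpl; rewrite exp_0, ?cos_0, ?sin_0; ring. Qed.

Lemma cexp_opp (z : C) : (cexp z * cexp (- z))%C = 1.
Proof. rewrite <- cexp_plus, Cplus_opp_r. apply cexp_0. Qed.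

Lemma cexp_neq0 (z : C) : cexp z <> 0.
Proof.
  intros E. pose proof (cexp_opp z) as H. rewrite E, Cmult_0_l in H.
  apply C1_nz. now symmetry.
Qed.

Lemma cexp_surj (w : C) : w <> 0 -> exists z, cexp z = w.
Proof.
  intros Hw. destruct w as [x y]. pose proof (Cnorm2_pos _ Hw) as Hp. simpl fst in Hp; simpl snd in Hp.
  set (r := sqrt (x ^ 2 + y ^ 2)).
  assert (Hr : 0 < r) by now apply sqrt_lt_R0.
  assert (Hrr : r * r = x ^ 2 + y ^ 2) by (apply sqrt_sqrt; lra).
  assert (Hb : -1 <= x / r <= 1).
  { assert (x ^ 2 <= r * r) by (rewrite Hrr; generalize (pow2_ge_0 y); lra).
    split; [apply Rmult_le_reg_r with r|apply Rmult_le_reg_r with r]; trivial;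
      unfold Rdiv; rewrite Rmult_assoc, Rinv_l by lra; nra. }
  assert (Hs : sqrt (1 - Rsqr (x / r)) = Rabs y / r).
  { replace (1 - Rsqr (x / r)) with (Rsqr (y / r)).
    - rewrite sqrt_Rsqr_abs. unfold Rdiv. rewrite Rabs_mult. f_equal.
      apply Rabs_pos_eq. now apply Rlt_le, Rinv_0_lt_compat.
    - unfold Rsqr. apply Rmult_eq_reg_r with (r * r); [|nra].
      field_simplify; [|lra|lra]. replace (r ^ 2) with (r * r) by ring. rewrite Hrr. ring. }
  (* [acos] only yields arguments of the closed upper half plane; the lower one uses the opposite
     angle. *)
  destruct (Rle_dec 0 y) as [Hy|Hy].
  - exists (ln r, acos (x / r)). unfold cexp, Re, Im. simpl.
    rewrite exp_ln, cos_acos, sin_acos, Hs, Rabs_pos_eq by trivial.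
    apply C_eq; simpl; field; lra.
  - exists (ln r, - acos (x / r)). unfold cexp, Re, Im. simpl.
    rewrite exp_ln, cos_neg, sin_neg, cos_acos, sin_acos, Hs, Rabs_left by (trivial; lra).
    apply C_eq; simpl; field; lra.
Qed.

Lemma Csqrt_ex (w : C) : exists r : C, (r * r)%C = w.
Proof.
  destruct (Ceq_dec w 0) as [->|Hw].
  - exists (RtoC 0). ring.
  - destruct (cexp_surj w Hw) as [z Hz]. exists (cexp (z / 2)).
    rewrite <- cexp_plus, <- Hz. f_equal. field.
Qed.

Section FirstIntegrals.

Variables (S : C -> Prop) (h h1 s sh shh shhh : C -> C).
Hypothesis (HO : open S) (HC : path_connected S) (z0 : C) (Hz0 : S z0).
Hypothesis (Hh : Hol S h h1) (Hs0 : forall z, S z -> s z <> 0).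
Hypothesis (Hs : Hol S s (fun z => h1 z * sh z)%C)
  (Hsh : Hol S sh (fun z => h1 z * shh z)%C)
  (Hshh : Hol S shh (fun z => h1 z * shhh z)%C).
(** The constancy of [3/4 sh^2 / s - shh], differentiated in [h] and solved for [shhh]. The suffix h
    means a derivative in [h], so the derivative in z of [s] is [h1 * sh]. *)
Hypothesis Hode : forall z, S z ->
  shhh z = (3 / 2 * (sh z * shh z / s z) - 3 / 4 * (sh z * sh z * sh z / (s z * s z)))%C.

Lemma Hol_along_h_constant (g gh : C -> C) :
  Hol S g (fun z => h1 z * gh z)%C -> (forall z, S z -> gh z = 0) ->
  forall z, S z -> g z = g z0.
Proof.
  intros Hg E z Hz. apply (Hol_constant S g _ HO HC Hg); trivial.
  intros w Hw. rewrite E by trivial. ring.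
Qed.

Let t := fun z => (shh z - / 2 * (sh z * sh z / s z))%C.

(** For a local square root [q] of [s] this reads [t_h = (q' / q) t], which says that
    [t / q = 2 q''] is constant. *)
Lemma Hol_t : Hol S t (fun z => h1 z * (sh z * t z / (2 * s z)))%C.
Proof.
  unfold t.
  eapply Hol_ext; [exact HO|reflexivity| |
    apply Hol_minus; [exact HO|exact Hshh|
      apply Hol_scal; [exact HO|
        apply Hol_div; [exact HO|exact Hs0|apply Hol_mult; [exact HO|exact Hsh|exact Hsh]|exact Hs]]]].
  intros z Hz. cbv beta. rewrite Hode by trivial. field. auto.
Qed.

(* Along h, the square root q of s satisfies q''' = 0: t is 2 q q'', and
   t^2/s = 4 q''^2, or sh^2/s = 4 q'^2 when q'' = 0, is a first integral. *)
Lemma s_is_quadratic_square :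
  exists A B D : C, forall z, S z ->
    s z = ((A + B * h z + D * (h z * h z)) * (A + B * h z + D * (h z * h z)))%C.
Proof.
  pose proof Hol_t as Ht.
  assert (HJ : forall z, S z -> (t z * t z / s z = t z0 * t z0 / s z0)%C).
  { apply (Hol_along_h_constant (fun z => t z * t z / s z)%C
       (fun z => ((sh z * t z / (2 * s z) * t z + t z * (sh z * t z / (2 * s z))) * s z
                   - t z * t z * sh z) / (s z * s z))%C).
    - eapply Hol_ext; [exact HO|reflexivity| |
        apply Hol_div; [exact HO|exact Hs0|apply Hol_mult; [exact HO|exact Ht|exact Ht]|exact Hs]].
      intros z Hz. cbv beta. field. auto.
    - intros z Hz. field. auto. }
  (* No branch of the square root of [s] is chosen on [S]; the root is an explicit quotient. It is
     [t / j] if [t <> 0], with [j] in the role of [2 q'']; it is [sh / b] if [t = 0], with [b] in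
     the role of [2 q']; and it is a constant if [sh] vanishes as well. *)
  destruct (Ceq_dec (t z0) 0) as [Ht0|Ht0].
  - assert (Htz : forall z, S z -> t z = 0).
    { intros z Hz. specialize (HJ z Hz). rewrite Ht0 in HJ.
      destruct (Ceq_dec (t z) 0) as [E|E]; trivial. exfalso.
      apply (Cmult_neq_0 _ _ E E).
      replace (t z * t z)%C with (t z * t z / s z * s z)%C by (field; auto).
      rewrite HJ. unfold Cdiv. ring. }
    assert (Eshh : forall z, S z -> shh z = (/ 2 * (sh z * sh z / s z))%C).
    { intros z Hz. generalize (Htz z Hz). unfold t. intros E.
      rewrite <- (Cplus_0_l (/ 2 * _)%C), <- E. ring. }
    assert (HK : forall z, S z -> (sh z * sh z / s z = sh z0 * sh z0 / s z0)%C).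
    { apply (Hol_along_h_constant (fun z => sh z * sh z / s z)%C
         (fun z => ((shh z * sh z + sh z * shh z) * s z - sh z * sh z * sh z) / (s z * s z))%C).
      - eapply Hol_ext; [exact HO|reflexivity| |
          apply Hol_div; [exact HO|exact Hs0|apply Hol_mult; [exact HO|exact Hsh|exact Hsh]|exact Hs]].
        intros z Hz. cbv beta. field. auto.
      - intros z Hz. rewrite Eshh by trivial. field. auto. }
    destruct (Ceq_dec (sh z0) 0) as [Hsh0|Hsh0].
    + assert (Eshz : forall z, S z -> sh z = 0).
      { intros z Hz. specialize (HK z Hz). rewrite Hsh0 in HK.
        destruct (Ceq_dec (sh z) 0) as [E|E]; trivial. exfalso.
        apply (Cmult_neq_0 _ _ E E).
        replace (sh z * sh z)%C with (sh z * sh z / s z * s z)%C by (field; auto).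
        rewrite HK. unfold Cdiv. ring. }
      destruct (Csqrt_ex (s z0)) as [a Ha].
      exists a, (RtoC 0), (RtoC 0). intros z Hz.
      rewrite (Hol_along_h_constant s sh Hs Eshz z Hz), <- Ha. ring.
    + destruct (Csqrt_ex (sh z0 * sh z0 / s z0)%C) as [b Hb].
      assert (Hb0 : b <> 0).
      { intros E. apply (Cmult_neq_0 _ _ Hsh0 Hsh0).
        replace (sh z0 * sh z0)%C with (sh z0 * sh z0 / s z0 * s z0)%C by (field; auto).
        rewrite <- Hb, E. ring. }
      rewrite <- Hb in HK.
      assert (Eq : forall z, S z -> (sh z / b - b / 2 * h z = sh z0 / b - b / 2 * h z0)%C).
      { apply (Hol_along_h_constant (fun z => sh z / b - b / 2 * h z)%C (fun z => shh z / b - b / 2)%C).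
        - eapply Hol_ext; [exact HO| |
            |apply Hol_minus; [exact HO|apply (Hol_scal S (/ b)%C); [exact HO|exact Hsh]|
              apply (Hol_scal S (b / 2)%C); [exact HO|exact Hh]]].
          + intros z Hz. cbv beta. field. auto.
          + intros z Hz. cbv beta. field. auto.
        - intros z Hz. rewrite Eshh, HK by trivial. field. auto. }
      exists (sh z0 / b - b / 2 * h z0)%C, (b / 2)%C, (RtoC 0).
      intros z Hz. rewrite <- (Eq z Hz).
      transitivity (sh z * sh z / (b * b))%C; [|field; auto].
      rewrite <- (HK z Hz). field. split; auto.
      intros E. apply (Cmult_neq_0 _ _ Hb0 Hb0). rewrite <- (HK z Hz), E. unfold Cdiv. ring.
  - destruct (Csqrt_ex (t z0 * t z0 / s z0)%C) as [j Hj].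
    assert (Hj0 : j <> 0).
    { intros E. apply (Cmult_neq_0 _ _ Ht0 Ht0).
      replace (t z0 * t z0)%C with (t z0 * t z0 / s z0 * s z0)%C by (field; auto).
      rewrite <- Hj, E. ring. }
    rewrite <- Hj in HJ.
    set (q := fun z => (t z / j)%C). set (q1 := fun z => (sh z * t z / (2 * s z * j))%C).
    assert (Hq : Hol S q (fun z => h1 z * q1 z)%C).
    { eapply Hol_ext; [exact HO| | |apply (Hol_scal S (/ j)%C); [exact HO|exact Ht]];
        intros z Hz; unfold q, q1; cbv beta; field; auto. }
    assert (Hq1 : Hol S q1 (fun z => h1 z * ((shh z * t z + sh z * (sh z * t z / (2 * s z))) * s z - sh z * t z * sh z) / (2 * j * (s z * s z)))%C).
    { eapply Hol_ext; [exact HO| | |apply (Hol_scal S (/ (2 * j))%C); [exact HO|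
        apply Hol_div; [exact HO|exact Hs0|apply Hol_mult; [exact HO|exact Hsh|exact Ht]|exact Hs]]];
        intros z Hz; unfold q1; cbv beta; field; auto. }
    assert (EB : forall z, S z -> (q1 z - j / 2 * h z = q1 z0 - j / 2 * h z0)%C).
    { apply (Hol_along_h_constant (fun z => q1 z - j / 2 * h z)%C
        (fun z => ((shh z * t z + sh z * (sh z * t z / (2 * s z))) * s z - sh z * t z * sh z) / (2 * j * (s z * s z)) - j / 2)%C).
      - eapply Hol_ext; [exact HO|reflexivity| |
          apply Hol_minus; [exact HO|exact Hq1|
            apply (Hol_scal S (j / 2)%C); [exact HO|exact Hh]]].
        intros z Hz. cbv beta. field. auto.
      - intros z Hz.
        transitivity ((t z * t z / s z - j * j) / (2 * j))%C; [unfold t; field; auto|].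
        rewrite HJ by trivial. field. auto. }
    set (B := (q1 z0 - j / 2 * h z0)%C) in *.
    assert (EA : forall z, S z -> (q z - B * h z - j / 4 * (h z * h z) = q z0 - B * h z0 - j / 4 * (h z0 * h z0))%C).
    { apply (Hol_along_h_constant (fun z => q z - B * h z - j / 4 * (h z * h z))%C
        (fun z => q1 z - B - j / 2 * h z)%C).
      - eapply Hol_ext; [exact HO|reflexivity| |
          apply Hol_minus; [exact HO|apply Hol_minus; [exact HO|exact Hq|apply Hol_scal; [exact HO|exact Hh]]|
            apply (Hol_scal S (j / 4)%C); [exact HO|apply Hol_mult; [exact HO|exact Hh|exact Hh]]]].
        intros z Hz. cbv beta. field.
      - intros z Hz. rewrite <- (EB z Hz). ring. }
    exists (q z0 - B * h z0 - j / 4 * (h z0 * h z0))%C, B, (j / 4)%C.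
    intros z Hz. rewrite <- (EA z Hz).
    transitivity (q z * q z)%C; [|ring].
    unfold q. transitivity (t z * t z / (j * j))%C; [|field; auto].
    rewrite <- (HJ z Hz). field. split; auto.
    intros E. apply (Cmult_neq_0 _ _ Hj0 Hj0). rewrite <- (HJ z Hz), E. unfold Cdiv. ring.
Qed.

End FirstIntegrals.

Definition quad (A B D w : C) : C := (A + B * w + D * (w * w))%C.

(** As [h1] does not vanish, [h] serves as a local coordinate, and division by [h1] turns the
    derivative in z into the derivative in [h]. *)
Lemma Hol_along (S : C -> Prop) (h1 h2 g g' : C -> C) :
  open S -> (forall z, S z -> h1 z <> 0) -> Hol S h1 h2 -> Hol S g g' ->
  exists gh gh', Hol S g (fun z => h1 z * gh z)%C /\ Hol S gh gh'.
Proof.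
  intros HO Hn Hh Hg. destruct (Hol_deriv S g g' HO Hg) as [g'' Hg'].
  exists (fun z => g' z / h1 z)%C. eexists. split.
  - eapply Hol_ext; [exact HO|reflexivity| |exact Hg].
    intros z Hz. cbv beta. field. auto.
  - exact (Hol_div S g' h1 g'' h2 HO Hn Hg' Hh).
Qed.

Lemma affine_minimal_quadratic (S : C -> Prop) (X : R -> R -> I3)
    (l : R -> R -> R) (F f h h1 : C -> C) (e : R) :
  (exists z, S z) -> wsurf_data S l F f h h1 -> e * e = 1 ->
  (forall u v, X u v = refl e (wsurf l F u v)) -> nondegenerate S X ->
  (forall u v, S (u, v) -> is_affine_mean_curvature X u v 0) ->
  (forall z, S z -> h1 z <> 0) /\
  exists A B D : C, fst (B * B - 4 * A * D)%C = 0 /\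
    forall z, S z -> h1 z = (quad A B D (h z) * quad A B D (h z) * f z)%C.
Proof.
  intros [z0 Hz0] HD He HX Hnd Hmc.
  pose proof (wd_open _ _ _ _ _ _ HD) as HO. pose proof (wd_h _ _ _ _ _ _ HD) as Hh.
  pose proof (wd_f _ _ _ _ _ _ HD) as Hf0. pose proof (wd_conn _ _ _ _ _ _ HD) as HC.
  destruct (Hol_deriv _ _ _ HO (wd_F _ _ _ _ _ _ HD)) as [f1 Hf1].
  destruct (Hol_deriv _ _ _ HO Hh) as [h2 Hh2].
  assert (Hn : forall z, S z -> h1 z <> 0).
  { intros z Hz. eapply wsurf_h1_neq0; eassumption. }
  split; [exact Hn|].
  set (s := fun z => (h1 z / f z)%C).
  assert (Hs0 : forall z, S z -> s z <> 0).
  { intros z Hz E. apply (Hn z Hz).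
    replace (h1 z) with (s z * f z)%C by (unfold s; field; auto). rewrite E. ring. }
  destruct (Hol_along S h1 h2 s _ HO Hn Hh2 (Hol_div S h1 f h2 f1 HO Hf0 Hh2 Hf1))
    as (sh & sh' & Hs & Hsh').
  destruct (Hol_along S h1 h2 sh _ HO Hn Hh2 Hsh') as (shh & shh' & Hsh & Hshh').
  destruct (Hol_along S h1 h2 shh _ HO Hn Hh2 Hshh') as (shhh & shhh' & Hshh & Hshhh').
  assert (Ef : forall z, S z -> f z = (h1 z / s z)%C).
  { intros z Hz. unfold s. field. auto. }
  assert (Ef1 : forall z, S z -> f1 z = ((h2 z * s z - h1 z * (h1 z * sh z)) / (s z * s z))%C).
  { intros z Hz.
    exact (Hol_unique S f (fun z => h1 z / s z)%C f1 _ z HO Ef Hf1 (Hol_div _ _ _ _ _ HO Hs0 Hh2 Hs) Hz). }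
  set (Dl := fun z => (3 / 4 * (sh z * sh z / s z) - shh z)%C).
  assert (HDl : forall z, S z -> fst (Dl z) = 0).
  { intros z Hz.
    (* Once [f = h1 / s] is substituted, [h2] cancels and [kap] becomes [- h1^2 sh / s^2]. *)
    assert (Hk : Hol S (fun z => 3 * f1 z - f z * (h2 z / h1 z + 2 * (f1 z / f z)))%C
       (fun z => ((- ((h2 z * h1 z + h1 z * h2 z) * sh z + h1 z * h1 z * (h1 z * shh z))) * (s z * s z)
          - (- (h1 z * h1 z * sh z)) * (h1 z * sh z * s z + s z * (h1 z * sh z))) / (s z * s z * (s z * s z)))%C).
    { eapply Hol_ext; [exact HO| |reflexivity|
        apply Hol_div; [exact HO| |
          apply Hol_opp; [exact HO|apply Hol_mult; [exact HO|apply Hol_mult; [exact HO|exact Hh2|exact Hh2]|exact Hsh]]|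
          apply Hol_mult; [exact HO|exact Hs|exact Hs]]].
      - intros w Hw. cbv beta. rewrite Ef1 by trivial. rewrite (Ef w) by trivial. field. auto.
      - intros w Hw. apply Cmult_neq_0; auto. }
    pose proof (wsurf_affine S X l F f h h1 f1 h2 e HD He HX Hf1 Hh2 Hnd _ Hk Hmc z Hz) as E.
    cbv beta zeta in E. rewrite Ef1 in E by trivial. rewrite (Ef z) in E by trivial.
    match type of E with fst ?a = 0 => replace a with (4 * Dl z)%C in E end.
    - change (4 * fst (Dl z) - 0 * snd (Dl z) = 0) in E. lra.
    - unfold Dl. field. auto. }
  assert (Hode : forall z, S z ->
    shhh z = (3 / 2 * (sh z * shh z / s z) - 3 / 4 * (sh z * sh z * sh z / (s z * s z)))%C).
  { intros z Hz.
    assert (HD1 : Hol S Dl (fun z => 3 / 4 * (((h1 z * shh z * sh z + sh z * (h1 z * shh z)) * s z - sh z * sh z * (h1 z * sh z)) / (s z * s z)) - h1 z * shhh z)%C).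
    { apply Hol_minus; [exact HO| |exact Hshh].
      apply Hol_scal; [exact HO|]. apply Hol_div; trivial. now apply Hol_mult. }
    pose proof (Hol_imaginary S Dl _ HO HD1 HDl z Hz) as E. cbv beta in E.
    assert (Hn' := Hn z Hz).
    transitivity (shhh z + (3 / 4 * (((h1 z * shh z * sh z + sh z * (h1 z * shh z)) * s z - sh z * sh z * (h1 z * sh z)) / (s z * s z)) - h1 z * shhh z) / h1 z)%C.
    - rewrite E. field. auto.
    - field. auto. }
  destruct (s_is_quadratic_square S h h1 s sh shh shhh HO HC z0 Hz0 Hh Hs0 Hs Hsh Hshh Hode)
    as (A & B & D & Eq).
  change (forall z, S z -> s z = (quad A B D (h z) * quad A B D (h z))%C) in Eq.
  exists A, B, D. split.
  - assert (Hq : Hol S (fun z => quad A B D (h z)) (fun z => h1 z * (B + 2 * D * h z))%C).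
    { unfold quad. eapply Hol_ext; [exact HO|reflexivity| |
        apply Hol_plus; [exact HO|apply Hol_plus; [exact HO|apply Hol_const; exact HO|apply Hol_scal; [exact HO|exact Hh]]|
          apply Hol_scal; [exact HO|apply Hol_mult; [exact HO|exact Hh|exact Hh]]]].
      intros z Hz. cbv beta. ring. }
    assert (Esh : forall z, S z -> sh z = (2 * quad A B D (h z) * (B + 2 * D * h z))%C).
    { intros z Hz.
      pose proof (Hol_unique S s _ _ _ z HO Eq Hs (Hol_mult _ _ _ _ _ HO Hq Hq) Hz) as E.
      cbv beta in E. assert (Hn' := Hn z Hz).
      replace (sh z) with (h1 z * sh z / h1 z)%C by (field; auto).
      rewrite E. field. auto. }
    assert (Eshh : shh z0 = (2 * ((B + 2 * D * h z0) * (B + 2 * D * h z0)) + 4 * D * quad A B D (h z0))%C).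
    { assert (HB : Hol S (fun z => B + 2 * D * h z)%C (fun z => 0 + 2 * D * h1 z)%C).
      { apply Hol_plus; [exact HO|now apply Hol_const|now apply Hol_scal]. }
      pose proof (Hol_unique S sh _ _ _ z0 HO Esh Hsh
        (Hol_mult _ _ _ _ _ HO (Hol_scal _ 2 _ _ HO Hq) HB) Hz0) as E.
      cbv beta in E. assert (Hn' := Hn z0 Hz0).
      replace (shh z0) with (h1 z0 * shh z0 / h1 z0)%C by (field; auto).
      rewrite E. field. auto. }
    rewrite <- (HDl z0 Hz0). f_equal. unfold Dl. rewrite Eshh, (Esh z0 Hz0).
    assert (Hq0 : quad A B D (h z0) <> 0).
    { intros E. apply (Hs0 z0 Hz0). rewrite Eq by trivial.
      rewrite E. ring. }
    rewrite (Eq z0 Hz0).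
    (* For [s = q^2] the constant equals [q'^2 - 2 q q''], which for a quadratic polynomial is its
       discriminant. *)
    transitivity (((B + 2 * D * h z0) * (B + 2 * D * h z0)) - 4 * D * quad A B D (h z0))%C.
    + unfold quad. ring.
    + field. auto.
  - intros z Hz. rewrite <- (Eq z Hz). unfold s. field. auto.
Qed.

(** * Similarities of isotropic space *)

Definition hor (Y : I3) : C := (xc Y, yc Y).

(** Every similarity has this form, by [similarity_is_affmap]. On Weierstrass data it acts by
    [f -> a f] and [h -> (lam h + c) / a]. *)
Definition affmap (lam : R) (c a : C) (t0 : R) (t : C) (Y : I3) : I3 :=
  (lam * lc Y + fst (c * hor Y)%C + t0,
   fst (a * hor Y + t)%C, snd (a * hor Y + t)%C).

Lemma I3_eq (Y Z : I3) : lc Y = lc Z -> hor Y = hor Z -> Y = Z.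
Proof.
  destruct Y as [[? ?] ?], Z as [[? ?] ?]. unfold hor, lc, xc, yc; simpl.
  intros -> E. now injection E as -> ->.
Qed.

Lemma I3_plus (a b c a' b' c' : R) :
  plus ((a, b, c) : I3) ((a', b', c') : I3) = (a + a', b + b', c + c').
Proof. reflexivity. Qed.

Lemma I3_scal (k a b c : R) : scal k ((a, b, c) : I3) = (k * a, k * b, k * c).
Proof. reflexivity. Qed.

Lemma R31_plus (a b c d a' b' c' d' : R) :
  plus ((a, b, c, d) : R31) ((a', b', c', d') : R31) = (a + a', b + b', c + c', d + d').
Proof. reflexivity. Qed.

Lemma R31_scal (k a b c d : R) :
  scal k ((a, b, c, d) : R31) = (k * a, k * b, k * c, k * d).
Proof. reflexivity. Qed.

Lemma triple_eq (a b c a' b' c' : R) :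
  a = a' -> b = b' -> c = c' -> (a, b, c) = (a', b', c').
Proof. congruence. Qed.

Lemma quadruple_eq (a b c d a' b' c' d' : R) :
  a = a' -> b = b' -> c = c' -> d = d' -> (a, b, c, d) = (a', b', c', d').
Proof. congruence. Qed.

Lemma isometry_affmap (c a : C) :
  fst a * fst a + snd a * snd a = 1 -> isometry (affmap 1 c a 0 0).
Proof.
  destruct c as [c1 c2], a as [a1 a2]. simpl. intros Ha.
  (* A null rotation about [pvec] followed by the horizontal rotation [a]. Here [k] is [<Y, pvec>],
     which vanishes on the hyperplane; the term with [/ 2 * (c1 * c1 + c2 * c2)] is forced by
     invariance of the form. *)
  apply iso_linear with (fun Y : R31 => let '(y0, y1, y2, y3) := Y in
    let k := y3 - y0 in let m := c1 * y1 - c2 * y2 - / 2 * (c1 * c1 + c2 * c2) * k in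
    (y0 + m, a1 * (y1 - k * c1) - a2 * (y2 + k * c2),
     a2 * (y1 - k * c1) + a1 * (y2 + k * c2), y3 + m)).
  - split; [|split; [|split]].
    + intros [[[? ?] ?] ?] [[[? ?] ?] ?]. rewrite !R31_plus.
      apply quadruple_eq; ring.
    + intros k [[[? ?] ?] ?]. rewrite !R31_scal. apply quadruple_eq; ring.
    + intros [[[p0 p1] p2] p3] [[[q0 q1] q2] q3]. unfold mink.
      set (k := p3 - p0). set (k' := q3 - q0).
      match goal with |- ?L = _ => transitivity
        (L - (a1 * a1 + a2 * a2 - 1) * ((p1 - k * c1) * (q1 - k' * c1) + (p2 + k * c2) * (q2 + k' * c2))) end.
      * rewrite Ha. ring.
      * unfold k, k'. field.
    + unfold det4, det3. transitivity (a1 * a1 + a2 * a2); [field|exact Ha].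
  - unfold pvec. apply quadruple_eq; field.
  - intros [[y0 y1] y2]. unfold emb, affmap, hor, lc, xc, yc; simpl. apply quadruple_eq; field.
Qed.

Lemma similarity_ext (T U : I3 -> I3) : similarity T -> (forall Y, T Y = U Y) -> similarity U.
Proof. intros HT E. replace U with T; trivial. now apply functional_extensionality. Qed.

Lemma similarity_affmap (lam : R) (c a : C) (t0 : R) (t : C) :
  lam <> 0 -> fst a * fst a + snd a * snd a = 1 ->
  similarity (affmap lam (lam * c) (lam * a) t0 t).
Proof.
  intros Hl Ha.
  apply similarity_ext with
    (fun Y => (fun Z => plus Z (t0, fst t, snd t)) ((fun Z : I3 => scal lam Z) (affmap 1 c a 0 0 Y))).
  - apply (sim_comp (fun Z => plus Z (t0, fst t, snd t)) (fun Y => (fun Z : I3 => scal lam Z) (affmap 1 c a 0 0 Y))).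
    + apply sim_isometry, iso_translation.
    + apply (sim_comp (fun Z : I3 => scal lam Z) (affmap 1 c a 0 0)).
      * now apply sim_homothety.
      * now apply sim_isometry, isometry_affmap.
  - intros [[y0 y1] y2]. unfold affmap, hor, lc, xc, yc. rewrite I3_scal, I3_plus. simpl.
    apply triple_eq; ring.
Qed.

(** Records what the uniqueness of the kind uses of a similarity: the shape of the map and its
    invertibility, both stable under composition. *)
Definition is_affmap (T : I3 -> I3) : Prop :=
  exists lam c a t0 t, lam <> 0 /\ a <> RtoC 0 /\ forall Y, T Y = affmap lam c a t0 t Y.

Lemma is_affmap_comp (T U : I3 -> I3) :
  is_affmap T -> is_affmap U -> is_affmap (fun Y => T (U Y)).
Proof.
  intros (lam & c & a & t0 & t & Hl & Ha & HT) (lam' & c' & a' & t0' & t' & Hl' & Ha' & HU).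
  exists (lam * lam'), (lam * c' + c * a')%C, (a * a')%C,
    (lam * t0' + fst (c * t')%C + t0), (a * t' + t)%C.
  split; [now apply Rmult_integral_contrapositive_currified|].
  split; [now apply Cmult_neq_0|].
  intros Y. rewrite HT, HU. unfold affmap, hor, lc, xc, yc; simpl.
  apply triple_eq; ring.
Qed.

Lemma isometry_linear_affmap (A : R31 -> R31) (T : I3 -> I3) :
  is_SO31 A -> A pvec = pvec -> (forall Y, emb (T Y) = A (emb Y)) -> is_affmap T.
Proof.
  intros (Hadd & Hscal & Hmink & Hdet) Hp HT.
  assert (HE1 : A (0, 1, 0, 0) = emb (T (0, 1, 0))) by now rewrite HT.
  assert (HE2 : A (0, 0, 1, 0) = emb (T (0, 0, 1))) by now rewrite HT.
  assert (HE3 : A (0, 0, 0, 1) = plus pvec (scal (-1) (A (1, 0, 0, 0)))).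
  { rewrite <- Hp at 1. rewrite <- Hscal, <- Hadd. f_equal.
    unfold pvec. rewrite R31_scal, R31_plus. apply quadruple_eq; ring. }
  set (V1 := T (0, 1, 0)) in *. set (V2 := T (0, 0, 1)) in *.
  pose proof (Hmink (0, 1, 0, 0) (0, 1, 0, 0)) as M11.
  pose proof (Hmink (0, 1, 0, 0) (0, 0, 1, 0)) as M12.
  pose proof (Hmink (0, 0, 1, 0) (0, 0, 1, 0)) as M22.
  pose proof (Hmink (1, 0, 0, 0) pvec) as M0p. rewrite Hp in M0p.
  rewrite HE1, HE2 in *. rewrite HE3 in Hdet.
  destruct (A (1, 0, 0, 0)) as [[[m0 m1] m2] m3].
  destruct V1 as [[c1 a1] a2] eqn:EV1. destruct V2 as [[c2 b1] b2] eqn:EV2.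
  unfold pvec in Hdet, M0p. rewrite R31_scal, R31_plus in Hdet.
  unfold mink, emb, lc, xc, yc, det4, det3 in M11, M12, M22, M0p, Hdet.
  simpl in M11, M12, M22, M0p, Hdet.
  assert (H11 : a1 * a1 + a2 * a2 = 1) by lra.
  assert (H12 : a1 * b1 + a2 * b2 = 0) by lra.
  assert (H22 : b1 * b1 + b2 * b2 = 1) by lra.
  assert (Hm : m3 = m0 - 1) by lra. subst m3.
  (* Because [A] fixes [pvec], its determinant reduces to that of the horizontal block; this is what
     excludes reflections. *)
  assert (HD : a1 * b2 - a2 * b1 = 1).
  { rewrite <- Hdet. ring. }
  assert (Hb2 : b2 = a1).
  { transitivity (b2 * (a1 * a1 + a2 * a2)); [rewrite H11; ring|].
    transitivity (a1 * (a1 * b2 - a2 * b1) + a2 * (a1 * b1 + a2 * b2)); [ring|].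
    rewrite HD, H12. ring. }
  assert (Hb1 : b1 = - a2).
  { transitivity (b1 * (a1 * a1 + a2 * a2)); [rewrite H11; ring|].
    transitivity (- a2 * (a1 * b2 - a2 * b1) + a1 * (a1 * b1 + a2 * b2)); [ring|].
    rewrite HD, H12. ring. }
  subst b1 b2.
  exists 1, (c1, - c2), (a1, a2), 0, (RtoC 0).
  split; [lra|]. split; [intros E; injection E as -> ->; lra|].
  intros [[y0 y1] y2].
  assert (EY : emb (T (y0, y1, y2)) =
    plus (scal y0 pvec) (plus (scal y1 (emb (c1, a1, a2))) (scal y2 (emb (c2, - a2, a1))))).
  { rewrite HT. rewrite <- Hp.
    rewrite <- HE1, <- HE2, <- !Hscal, <- !Hadd. f_equal.
    unfold emb, pvec, lc, xc, yc. rewrite !R31_scal, !R31_plus. apply quadruple_eq; simpl; ring. }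
  destruct (T (y0, y1, y2)) as [[r0 r1] r2].
  unfold emb, pvec in EY. rewrite !R31_scal, !R31_plus in EY.
  injection EY as E0 E1 E2 _.
  unfold lc, xc, yc in E0, E1, E2. simpl in E0, E1, E2.
  unfold affmap, hor, lc, xc, yc; simpl. rewrite E0, E1, E2. apply triple_eq; ring.
Qed.

Lemma isometry_is_affmap (T : I3 -> I3) : isometry T -> is_affmap T.
Proof.
  induction 1 as [t|A T HA Hp HT|T1 T2 _ IH1 _ IH2].
  - exists 1, (RtoC 0), (RtoC 1), (lc t), (hor t).
    split; [lra|]. split; [exact C1_nz|].
    intros [[y0 y1] y2]. destruct t as [[s0 s1] s2]. rewrite I3_plus.
    unfold affmap, hor, lc, xc, yc; simpl. apply triple_eq; ring.
  - now apply isometry_linear_affmap with A.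
  - now apply is_affmap_comp.
Qed.

Lemma similarity_is_affmap (T : I3 -> I3) : similarity T -> is_affmap T.
Proof.
  induction 1 as [T HT|lam Hl|T1 T2 _ IH1 _ IH2].
  - now apply isometry_is_affmap.
  - exists lam, (RtoC 0), (RtoC lam), 0, (RtoC 0).
    split; [exact Hl|]. split; [intros E; now apply Hl, RtoC_inj|].
    intros [[y0 y1] y2]. rewrite I3_scal.
    unfold affmap, hor, lc, xc, yc; simpl. apply triple_eq; ring.
  - now apply is_affmap_comp.
Qed.

(** * Pieces of explicit surfaces *)

(** Continuity of the partial derivatives is what upgrades them to total differentiability in
    [entire_primitive_Re]. *)
Definition ccont (d : C -> C) : Prop :=
  forall u v, continuity_2d_pt (fun a b => fst (d (a, b))) u v /\
              continuity_2d_pt (fun a b => snd (d (a, b))) u v.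

Lemma ccont_const (c : C) : ccont (fun _ => c).
Proof. intros u v. split; apply continuity_2d_pt_const. Qed.

Lemma ccont_id : ccont (fun z => z).
Proof. intros u v. split; [apply continuity_2d_pt_id1|apply continuity_2d_pt_id2]. Qed.

Lemma ccont_plus (f g : C -> C) : ccont f -> ccont g -> ccont (fun z => f z + g z)%C.
Proof.
  intros Hf Hg u v. destruct (Hf u v), (Hg u v). split; now apply continuity_2d_pt_plus.
Qed.

Lemma ccont_mult (f g : C -> C) : ccont f -> ccont g -> ccont (fun z => f z * g z)%C.
Proof.
  intros Hf Hg u v. destruct (Hf u v), (Hg u v). split; simpl.
  - apply continuity_2d_pt_minus; now apply continuity_2d_pt_mult.
  - apply continuity_2d_pt_plus; now apply continuity_2d_pt_mult.
Qed.

Lemma ccont_cexp (f : C -> C) : ccont f -> ccont (fun z => cexp (f z)).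
Proof.
  intros Hf u v. destruct (Hf u v) as [H1 H2].
  split; simpl; apply continuity_2d_pt_mult; unfold Re, Im.
  - apply (continuity_1d_2d_pt_comp exp); trivial. apply derivable_continuous_pt, derivable_pt_exp.
  - apply (continuity_1d_2d_pt_comp cos); trivial. apply continuity_cos.
  - apply (continuity_1d_2d_pt_comp exp); trivial. apply derivable_continuous_pt, derivable_pt_exp.
  - apply (continuity_1d_2d_pt_comp sin); trivial. apply continuity_sin.
Qed.

Lemma ccont_ext (f g : C -> C) : (forall z, f z = g z) -> ccont f -> ccont g.
Proof.
  intros E Hf u v. destruct (Hf u v) as [H1 H2]. split.
  - apply continuity_2d_pt_ext with (fun a b => fst (f (a, b))); trivial.
    intros a b. now rewrite E.
  - apply continuity_2d_pt_ext with (fun a b => snd (f (a, b))); trivial.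
    intros a b. now rewrite E.
Qed.

(** [G' = d] on all of C, stated as a chain rule along curves so that it composes directly with a
    reparametrization. It applies to the listed data because [h f] extends over the poles of [h]. *)
Definition entire_primitive (G d : C -> C) : Prop :=
  ccont d /\ forall g t a, cderiv g t a -> cderiv (fun s => G (g s)) t (d (g t) * a)%C.

Lemma entire_primitive_Re (G d psi : C -> C) (u v : R) :
  entire_primitive G d -> psi (u, v) = d (u, v) ->
  is_Re_primitive_at (fun a b => fst (G (a, b))) psi u v.
Proof.
  intros [Hc HG] E. unfold is_Re_primitive_at. rewrite E.
  assert (Hu : forall a b, cderiv (fun t => G (t, b)) a (d (a, b))).
  { intros a b. eapply cderiv_eq; [apply (HG (fun t => (t, b)) a 1)|ring].
    split; simpl; [apply (is_derive_id (K := R_AbsRing))|apply (is_derive_const (V := R_NormedModule))]. }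
  assert (Hv : cderiv (fun t => G (u, t)) v (d (u, v) * Ci)%C).
  { apply (HG (fun t => (u, t)) v Ci).
    split; simpl; [apply (is_derive_const (V := R_NormedModule))|apply (is_derive_id (K := R_AbsRing))]. }
  apply filterdiff_differentiable_pt_lim.
  apply filterdiff_ext_lin with
    (fun p : R * R => plus (scal (fst p) (fst (d (u, v)))) (scal (snd p) (- snd (d (u, v))))).
  - apply (is_derive_filterdiff (fun a b => fst (G (a, b))) u v (fun a b => fst (d (a, b)))).
    + apply filter_forall. intros [a b]. apply (Hu a b).
    + eapply is_derive_eq; [exact (proj1 Hv)|]. simpl. ring.
    + exact (proj1 (continuity_2d_pt_filterlim _ u v) (proj1 (Hc u v))).
  - intros [a b]. unfold plus, scal; simpl. unfold mult; simpl. reflexivity.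
Qed.

Lemma entire_primitive_scal (c : C) (G d : C -> C) :
  entire_primitive G d -> entire_primitive (fun z => c * G z)%C (fun z => c * d z)%C.
Proof.
  intros [Hc HG]. split.
  - apply ccont_mult; trivial. apply ccont_const.
  - intros g t a Hg. eapply cderiv_eq; [apply cderiv_mult; [apply cderiv_const|exact (HG g t a Hg)]|]. cbv beta. ring.
Qed.

(* [G] and [P] are primitives of [h f] and [f]; the last two fields express
   that complex conjugation acts on the surface by a similarity. *)
Record primitives (w : wdata) (G P : C -> C) : Prop := {
  prim_h : exists dG, entire_primitive G dG /\
    forall z, snd w z <> 0 -> (fst w z * snd w z = dG z)%C;
  prim_f : entire_primitive P (snd w);
  prim_conj : exists mu : R, mu * mu = 1 /\ forall z,
    fst (G (Cconj z)) = mu * fst (G z) /\ P (Cconj z) = (mu * Cconj (P z))%C;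
  prim_dom : forall z, snd w (Cconj z) = 0 -> snd w z = 0
}.

Definition surf_of (G P : C -> C) : R -> R -> I3 := wsurf (fun u v => fst (G (u, v))) P.

Lemma primitives_surface (w : wdata) (G P : C -> C) :
  primitives w G P -> weierstrass_surface w (surf_of G P).
Proof.
  intros [(dG & HG & E) HP _ _]. destruct w as [h f]. simpl in *.
  intros u v Hz. split; [|split].
  - apply (entire_primitive_Re G dG); auto.
  - apply (entire_primitive_Re P f); trivial. ring.
  - apply differentiable_pt_lim_ext with (fun a b => fst (- Ci * P (a, b))%C).
    + exists (mkposreal 1 Rlt_0_1). intros a b _ _. simpl. unfold ycf, yc, surf_of, wsurf. simpl. ring.
    + apply (entire_primitive_Re (fun z => - Ci * P z)%C (fun z => - Ci * f z)%C
        (fun z => - Ci * f z)%C u v); trivial.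
      now apply entire_primitive_scal.
Qed.

Lemma Hol_local_diffeo (S : C -> Prop) (phi phi1 : C -> C) :
  Hol S phi phi1 -> (forall z, S z -> phi1 z <> 0) -> local_diffeo_on S phi.
Proof.
  intros H Hn. split; [apply H|split; [apply H|]].
  intros u v Hz.
  rewrite (Hol_pu_fst S phi phi1), (Hol_pu_snd S phi phi1), (Hol_pv_fst S phi phi1), (Hol_pv_snd S phi phi1) by trivial.
  generalize (Cnorm2_pos _ (Hn _ Hz)). simpl. lra.
Qed.

Lemma Hol_conj_local_diffeo (S : C -> Prop) (phi phi1 : C -> C) :
  open S -> Hol S phi phi1 -> (forall z, S z -> phi1 z <> 0) ->
  local_diffeo_on S (fun z => Cconj (phi z)).
Proof.
  intros HO H Hn. split; [apply H|split; [simpl; apply smooth_fun_opp; [trivial|apply H]|]].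
  intros u v Hz. simpl.
  replace (pv (fun u0 v0 => - snd (phi (u0, v0))) u v) with (- pv (fun u0 v0 => snd (phi (u0, v0))) u v)
    by (symmetry; apply Derive_opp).
  replace (pu (fun u0 v0 => - snd (phi (u0, v0))) u v) with (- pu (fun u0 v0 => snd (phi (u0, v0))) u v)
    by (symmetry; apply Derive_opp).
  rewrite (Hol_pu_fst S phi phi1), (Hol_pu_snd S phi phi1), (Hol_pv_fst S phi phi1), (Hol_pv_snd S phi phi1) by trivial.
  generalize (Cnorm2_pos _ (Hn _ Hz)). simpl. lra.
Qed.

Lemma Cconj_neq0 (z : C) : z <> 0 -> Cconj z <> 0.
Proof. intros Hz E. apply Hz. rewrite <- (Cconj_conj z), E. apply C_eq; simpl; ring. Qed.

(** The two equations on the data say that [P o phi] and [Re (G o phi)] have the same derivatives as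
    the transformed coordinates of [X]. Connectedness makes the differences [dP] and [dL] constant,
    and a translation absorbs them. *)
Lemma data_piece (S : C -> Prop) (X : R -> R -> I3) (l : R -> R -> R)
    (F f h h1 : C -> C) (e : R) (w : wdata) (G P : C -> C)
    (lam : R) (c a : C) (phi phi1 : C -> C) :
  (exists z, S z) -> wsurf_data S l F f h h1 -> e * e = 1 ->
  (forall u v, X u v = refl e (wsurf l F u v)) -> primitives w G P ->
  lam <> 0 -> fst a * fst a + snd a * snd a = 1 ->
  Hol S phi phi1 ->
  (forall z, S z -> (snd w (phi z) * phi1 z = lam * a * f z)%C) ->
  (forall z, S z -> (fst w (phi z) * a = h z + c)%C) ->
  piece_up_to_similarity S X w.
Proof.
  intros [z0 Hz0] HD He HX Hpr Hlam Ha Hphi Ef Eh.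
  pose proof (wd_open _ _ _ _ _ _ HD) as HO. pose proof (wd_conn _ _ _ _ _ _ HD) as HC.
  pose proof (wd_f _ _ _ _ _ _ HD) as Hf0. pose proof (wd_F _ _ _ _ _ _ HD) as HF.
  assert (Ha0 : a <> 0) by (intros E; rewrite E in Ha; simpl in Ha; lra).
  assert (Hl0 : RtoC lam <> 0) by (intros E; now apply Hlam, RtoC_inj).
  assert (Hfp : forall z, S z -> snd w (phi z) <> 0 /\ phi1 z <> 0).
  { intros z Hz. assert (K : (lam * a * f z)%C <> 0) by (repeat apply Cmult_neq_0; auto).
    rewrite <- Ef in K by trivial. split; intros E; apply K; rewrite E; ring. }
  pose proof (primitives_surface w G P Hpr) as HY.
  destruct Hpr as [(dG & [_ HG] & EG) [_ HP] (mu & Hmu & Hconj) Hdom].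
  set (dP := fun z => (P (phi z) - lam * a * F z)%C).
  set (dL := fun z : C => fst (G (phi z)) - lam * (l (fst z) (snd z) + fst (c * F z)%C)).
  assert (HdP : forall z, S z -> cpartials dP z 0 0).
  { intros [u v] Hz. destruct (proj2 Hphi _ Hz) as [Pu Pv], (proj2 HF _ Hz) as [Fu Fv].
    specialize (Ef _ Hz). split; unfold dP, Cminus.
    - eapply cderiv_eq.
      + apply cderiv_plus; [exact (HP _ _ _ Pu)|]. apply cderiv_opp, cderiv_mult; [apply cderiv_const|exact Fu].
      + cbn [fst snd] in *. rewrite Ef. ring.
    - eapply cderiv_eq.
      + apply cderiv_plus; [exact (HP _ _ _ Pv)|]. apply cderiv_opp, cderiv_mult; [apply cderiv_const|exact Fv].
      + cbn [fst snd] in *.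
        transitivity (Ci * (snd w (phi (u, v)) * phi1 (u, v)) - lam * a * (Ci * f (u, v)))%C; [ring|].
        rewrite Ef. ring. }
  assert (HdL : forall u v, S (u, v) -> is_derive (fun t => dL (t, v)) u 0 /\ is_derive (fun t => dL (u, t)) v 0).
  { intros u v Hz. destruct (proj2 Hphi _ Hz) as [Pu Pv], (proj2 HF _ Hz) as [Fu Fv].
    pose proof (Ef _ Hz) as Efz. pose proof (Eh _ Hz) as Ehz.
    pose proof (EG _ (proj1 (Hfp _ Hz))) as EGz.
    assert (Ekey : (dG (phi (u, v)) * phi1 (u, v) = lam * (h (u, v) * f (u, v) + c * f (u, v)))%C).
    { rewrite <- EGz.
      transitivity (fst w (phi (u, v)) * (snd w (phi (u, v)) * phi1 (u, v)))%C; [ring|].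
      rewrite Efz. transitivity (lam * (fst w (phi (u, v)) * a) * f (u, v))%C; [ring|].
      rewrite Ehz. ring. }
    pose proof (cderiv_mult _ _ _ _ _ (cderiv_const c u) Fu) as Cu.
    pose proof (cderiv_mult _ _ _ _ _ (cderiv_const c v) Fv) as Cv.
    cbn [fst snd] in *.
    split; unfold dL; cbn [fst snd].
    - eapply is_derive_eq.
      + apply (is_derive_minus (V := R_NormedModule)); [exact (proj1 (HG _ _ _ Pu))|].
        apply (is_derive_scal (fun t => l t v + fst (c * F (t, v))%C)).
        apply (is_derive_plus (V := R_NormedModule)); [apply (wd_lu _ _ _ _ _ _ HD _ _ Hz)|exact (proj1 Cu)].
      + cbn [fst snd]. rewrite Ekey. unfold minus, plus, opp, scal; simpl. unfold mult; simpl. ring.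
    - eapply is_derive_eq.
      + apply (is_derive_minus (V := R_NormedModule)); [exact (proj1 (HG _ _ _ Pv))|].
        apply (is_derive_scal (fun t => l u t + fst (c * F (u, t))%C)).
        apply (is_derive_plus (V := R_NormedModule)); [apply (wd_lv _ _ _ _ _ _ HD _ _ Hz)|exact (proj1 Cv)].
      + cbn [fst snd].
        replace (dG (phi (u, v)) * (Ci * phi1 (u, v)))%C with (Ci * (dG (phi (u, v)) * phi1 (u, v)))%C by ring.
        rewrite Ekey. unfold minus, plus, opp, scal; simpl. unfold mult; simpl. ring. }
  assert (EP : forall z, S z -> P (phi z) = (lam * a * F z + dP z0)%C).
  { intros z Hz. rewrite <- (cpartials_constant S dP HO HC HdP z z0 Hz Hz0). unfold dP. ring. }
  assert (EL : forall z, S z -> fst (G (phi z)) = lam * (l (fst z) (snd z) + fst (c * F z)%C) + dL z0).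
  { intros z Hz. replace (dL z0) with (dL z); [unfold dL; ring|].
    rewrite (surjective_pairing z), (surjective_pairing z0).
    apply (locally_constant S (fun a b => dL (a, b)) HO HC); trivial; intros u v Huv.
    - exact (proj1 (HdL u v Huv)).
    - exact (proj2 (HdL u v Huv)). }
  assert (Hee : e = 1 \/ e = -1).
  { destruct (Rmult_integral (e - 1) (e + 1)) as [E|E]; [lra|left; lra|right; lra]. }
  destruct Hee as [-> | ->].
  - exists (affmap lam (lam * c) (lam * a) (dL z0) (dP z0)), (surf_of G P).
    split; [now apply similarity_affmap|]. split; [exact HY|].
    exists phi. split; [apply Hol_local_diffeo with phi1; trivial; intros; now apply Hfp|].
    intros u v Hz. split; [now apply Hfp|].
    rewrite HX. unfold surf_of. apply I3_eq.
    + unfold affmap, wsurf, refl, hor, lc, xc, yc. cbn [fst snd].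
      rewrite <- surjective_pairing, EL by trivial. simpl. ring.
    + unfold affmap, wsurf, refl, hor, lc, xc, yc. cbn [fst snd].
      rewrite <- !surjective_pairing, EP by trivial. apply C_eq; simpl; ring.
  (* For [e = -1] the surface is a mirror image. Replacing [phi] by its conjugate reflects the
     listed surface too, up to the sign [mu], which joins the homothety. *)
  - exists (affmap (mu * lam) ((mu * lam)%R * Cconj c) ((mu * lam)%R * Cconj a) (mu * dL z0) (mu * Cconj (dP z0))), (surf_of G P).
    split; [apply similarity_affmap|split; [exact HY|]].
    + apply Rmult_integral_contrapositive_currified; trivial. intros ->. lra.
    + simpl. lra.
    + exists (fun z => Cconj (phi z)).
      split; [apply Hol_conj_local_diffeo with phi1; trivial; intros; now apply Hfp|].
      intros u v Hz. destruct (Hconj (phi (u, v))) as [E1 E2]. split.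
      * intros E. now apply (proj1 (Hfp _ Hz)), Hdom.
      * rewrite HX. unfold surf_of. apply I3_eq.
        -- unfold affmap, wsurf, refl, hor, lc, xc, yc. cbn [fst snd].
           rewrite <- surjective_pairing, E1, EL by trivial. simpl. ring.
        -- unfold affmap, wsurf, refl, hor, lc, xc, yc. cbn [fst snd].
           rewrite <- !surjective_pairing, E2, EP by trivial. apply C_eq; simpl; ring.
Qed.

(** * Complex hyperbolic functions: conjugation, derivatives, continuity *)

Lemma Ci_sqr : (Ci * Ci)%C = (- (1))%C.
Proof. apply C_eq; simpl; ring. Qed.

Lemma Cconj_Ci : Cconj Ci = (- Ci)%C.
Proof. apply C_eq; simpl; ring. Qed.

Lemma Cconj_RtoC (r : R) : Cconj r = r.
Proof. apply C_eq; simpl; ring. Qed.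

Lemma RtoC_m1 : RtoC (-1) = (- (1))%C.
Proof. apply C_eq; simpl; ring. Qed.

Lemma cexp_conj (z : C) : cexp (Cconj z) = Cconj (cexp z).
Proof. unfold cexp, Re, Im. apply C_eq; simpl; rewrite ?cos_neg, ?sin_neg; ring. Qed.

Lemma csinh_conj (z : C) : csinh (Cconj z) = Cconj (csinh z).
Proof.
  unfold csinh. rewrite <- Copp_conj, !cexp_conj, <- Cminus_conj.
  apply C_eq; simpl; field.
Qed.

Lemma ccosh_conj (z : C) : ccosh (Cconj z) = Cconj (ccosh z).
Proof.
  unfold ccosh. rewrite <- Copp_conj, !cexp_conj, <- Cplus_conj.
  apply C_eq; simpl; field.
Qed.

Lemma cosh_sinh (z : C) : (ccosh z * ccosh z - csinh z * csinh z)%C = 1.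
Proof.
  unfold ccosh, csinh. transitivity (cexp z * cexp (- z))%C; [field|apply cexp_opp].
Qed.

Lemma cderiv_csinh (f : R -> C) (t : R) (a : C) :
  cderiv f t a -> cderiv (fun s => csinh (f s)) t (ccosh (f t) * a)%C.
Proof.
  intros H. unfold csinh, ccosh.
  eapply cderiv_eq.
  - apply (cderiv_mult (fun s => cexp (f s) - cexp (- f s))%C (fun _ => / 2)%C); [|apply cderiv_const].
    apply cderiv_plus; [apply cderiv_cexp; exact H|].
    apply cderiv_opp, cderiv_cexp, cderiv_opp, H.
  - cbv beta. field.
Qed.

Lemma cderiv_ccosh (f : R -> C) (t : R) (a : C) :
  cderiv f t a -> cderiv (fun s => ccosh (f s)) t (csinh (f t) * a)%C.
Proof.
  intros H. unfold csinh, ccosh.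
  eapply cderiv_eq.
  - apply (cderiv_mult (fun s => cexp (f s) + cexp (- f s))%C (fun _ => / 2)%C); [|apply cderiv_const].
    apply cderiv_plus; [apply cderiv_cexp; exact H|].
    apply cderiv_cexp, cderiv_opp, H.
  - cbv beta. field.
Qed.

Lemma ccont_scal (c : C) (f : C -> C) : ccont f -> ccont (fun z => c * f z)%C.
Proof. intros H. apply ccont_mult; [apply ccont_const|exact H]. Qed.

Lemma ccont_csinh (f : C -> C) : ccont f -> ccont (fun z => csinh (f z)).
Proof.
  intros H. apply ccont_ext with (fun z => / 2 * (cexp (f z) + - (1) * cexp (- (1) * f z)))%C.
  - intros z. unfold csinh. replace (- (1) * f z)%C with (- f z)%C by ring. field.
  - apply ccont_scal, ccont_plus; [now apply ccont_cexp|].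
    now apply ccont_scal, ccont_cexp, ccont_scal.
Qed.

Lemma ccont_ccosh (f : C -> C) : ccont f -> ccont (fun z => ccosh (f z)).
Proof.
  intros H. apply ccont_ext with (fun z => / 2 * (cexp (f z) + cexp (- (1) * f z)))%C.
  - intros z. unfold ccosh. replace (- (1) * f z)%C with (- f z)%C by ring. field.
  - apply ccont_scal, ccont_plus; [now apply ccont_cexp|].
    now apply ccont_cexp, ccont_scal.
Qed.

(** * Explicit primitives and conjugation symmetry of the listed data *)

Lemma plane_primitives :
  primitives (fun _ => RtoC 0, fun _ => RtoC 1) (fun _ => RtoC 0) (fun z => z).
Proof.
  split; simpl.
  - exists (fun _ => RtoC 0). split; [split|].
    + apply ccont_const.
    + intros g t a Hg. eapply cderiv_eq; [apply cderiv_const|ring].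
    + intros; ring.
  - split; [apply ccont_const|]. intros g t a Hg. eapply cderiv_eq; [exact Hg|ring].
  - exists 1. split; [ring|]. intros z. split; [ring|]. ring.
  - trivial.
Qed.

Lemma trivial_enneper_primitives :
  primitives (fun z => z, fun _ => Ci) (fun z => Ci / 2 * (z * z))%C (fun z => Ci * z)%C.
Proof.
  split; simpl.
  - exists (fun z => Ci * z)%C. split; [split|].
    + apply ccont_scal, ccont_id.
    + intros g t a Hg.
      eapply cderiv_eq; [apply cderiv_mult; [apply cderiv_const|apply cderiv_mult; exact Hg]|].
      cbv beta. field.
    + intros; ring.
  - split; [apply ccont_const|]. intros g t a Hg.
    eapply cderiv_eq; [apply cderiv_mult; [apply cderiv_const|exact Hg]|]. cbv beta. ring.
  - exists (-1). split; [ring|]. intros z. split; [simpl; field|apply C_eq; simpl; ring].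
  - intros z H. exact H.
Qed.

Lemma helicoid_primitives :
  primitives (fun z => cexp z, fun z => Ci * cexp (- z))%C
    (fun z => Ci * z)%C (fun z => - Ci * cexp (- z))%C.
Proof.
  split; simpl.
  - exists (fun _ => Ci). split; [split|].
    + apply ccont_const.
    + intros g t a Hg.
      eapply cderiv_eq; [apply cderiv_mult; [apply cderiv_const|exact Hg]|]. cbv beta. ring.
    + intros z _. transitivity (Ci * (cexp z * cexp (- z)))%C; [ring|]. rewrite cexp_opp. ring.
  - split.
    + apply ccont_ext with (fun z => Ci * cexp (- (1) * z))%C.
      * intros z. do 2 f_equal. ring.
      * apply ccont_scal, ccont_cexp, ccont_scal, ccont_id.
    + intros g t a Hg.
      eapply cderiv_eq; [apply cderiv_mult; [apply cderiv_const|apply cderiv_cexp, cderiv_opp, Hg]|].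
      cbv beta. ring.
  - exists (-1). split; [ring|]. intros z. split; [simpl; ring|].
    rewrite <- Copp_conj, cexp_conj, Cmult_conj, Copp_conj, Cconj_Ci, RtoC_m1. ring.
  - intros z H. exfalso. apply (Cmult_neq_0 _ _ Ci_nz (cexp_neq0 (- Cconj z)) H).
Qed.

Lemma enneper_primitives :
  primitives (fun z => (1 / z)%C, fun z => (Ci * (z * z))%C)
    (fun z => Ci / 2 * (z * z))%C (fun z => Ci / 3 * (z * (z * z)))%C.
Proof.
  split; simpl.
  - exists (fun z => Ci * z)%C. split; [split|].
    + apply ccont_scal, ccont_id.
    + intros g t a Hg.
      eapply cderiv_eq; [apply cderiv_mult; [apply cderiv_const|apply cderiv_mult; exact Hg]|].
      cbv beta. field.
    + intros z Hz. field. intros E. apply Hz. rewrite E. ring.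
  - split; [apply ccont_scal, ccont_mult; apply ccont_id|]. intros g t a Hg.
    eapply cderiv_eq; [apply cderiv_mult; [apply cderiv_const|apply cderiv_mult; [exact Hg|apply cderiv_mult; exact Hg]]|].
    cbv beta. field.
  - exists (-1). split; [ring|]. intros z. split; [simpl; field|apply C_eq; simpl; field].
  - intros z H. replace (Ci * (z * z))%C with (- Cconj (Ci * (Cconj z * Cconj z)))%C.
    + rewrite H. apply C_eq; simpl; ring.
    + rewrite !Cmult_conj, Cconj_conj, Cconj_Ci. ring.
Qed.

Definition thomsen (alpha beta : R) : wdata :=
  (fun z => (alpha / beta * ccoth (alpha * z / 2))%C,
   fun z => (Ci * (2 * beta / (alpha * alpha))
             * (csinh (alpha * z / 2) * csinh (alpha * z / 2)))%C).

(** Up to a homothety and a rescaling of [z], the Thomsen data depend only on [alpha / beta], here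
    [k]. The choice [beta = 2] makes the argument of the hyperbolic functions [k z]. *)
Lemma thomsen_h (k : R) (z : C) : fst (thomsen (2 * k) 2) z = (k * ccoth (k * z))%C.
Proof.
  simpl. rewrite RtoC_mult. replace (2 * k * z / 2)%C with (k * z)%C by field. field.
Qed.

Lemma thomsen_f (k : R) (z : C) : k <> 0 ->
  snd (thomsen (2 * k) 2) z = (Ci / (k * k) * (csinh (k * z) * csinh (k * z)))%C.
Proof.
  intros Hk. assert (RtoC k <> 0) by (intros E; now apply Hk, RtoC_inj).
  simpl. rewrite RtoC_mult. replace (2 * k * z / 2)%C with (k * z)%C by field. field. trivial.
Qed.

Lemma thomsen_primitives (k : R) : k <> 0 ->
  primitives (thomsen (2 * k) 2)
    (fun z => Ci / (2 * k * k) * (csinh (k * z) * csinh (k * z)))%C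
    (fun z => Ci / (k * k) * (csinh (k * z) * ccosh (k * z) / (2 * k) - z / 2))%C.
Proof.
  intros Hk. assert (Hk' : RtoC k <> 0) by (intros E; now apply Hk, RtoC_inj).
  assert (Hkz : forall g t a, cderiv g t a -> cderiv (fun s => k * g s)%C t (k * a)%C).
  { intros g t a Hg. eapply cderiv_eq; [apply cderiv_mult; [apply cderiv_const|exact Hg]|]. cbv beta. ring. }
  split.
  - exists (fun z => Ci / k * (csinh (k * z) * ccosh (k * z)))%C. split; [split|].
    + apply ccont_scal, ccont_mult; [apply ccont_csinh|apply ccont_ccosh]; apply ccont_scal, ccont_id.
    + intros g t a Hg. apply Hkz in Hg.
      eapply cderiv_eq; [apply cderiv_mult; [apply cderiv_const|apply cderiv_mult; apply cderiv_csinh; exact Hg]|].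
      cbv beta. field. trivial.
    + intros z. rewrite thomsen_h, thomsen_f by trivial. intros Hz. unfold ccoth. field.
      split; trivial. intros E. apply Hz. rewrite E. field. trivial.
  - split.
    + apply ccont_ext with (fun z => Ci / (k * k) * (csinh (k * z) * csinh (k * z)))%C.
      * intros z. symmetry. now apply thomsen_f.
      * apply ccont_scal, ccont_mult; apply ccont_csinh; apply ccont_scal, ccont_id.
    + intros g t a Hg. pose proof (Hkz _ _ _ Hg) as Hg'. rewrite thomsen_f by trivial.
      eapply cderiv_eq.
      * apply cderiv_mult; [apply cderiv_const|].
        apply cderiv_plus.
        -- apply (cderiv_mult (fun s => csinh (k * g s) * ccosh (k * g s))%C (fun _ => / (2 * k))%C);
             [|apply cderiv_const].
           apply cderiv_mult; [apply cderiv_csinh; exact Hg'|apply cderiv_ccosh; exact Hg'].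
        -- apply cderiv_opp, (cderiv_mult g (fun _ => / 2)%C); [exact Hg|apply cderiv_const].
      * cbv beta. set (x := (k * g t)%C).
        transitivity (Ci / (k * k) * ((ccosh x * ccosh x - csinh x * csinh x - 1) / 2
          + csinh x * csinh x) * a)%C; [field; trivial|].
        rewrite cosh_sinh. field. trivial.
  - exists (-1). split; [ring|]. intros z.
    replace (k * Cconj z)%C with (Cconj (k * z)) by (rewrite Cmult_conj, Cconj_RtoC; ring).
    rewrite csinh_conj, ccosh_conj. split.
    + replace (Ci / (2 * k * k) * (Cconj (csinh (k * z)) * Cconj (csinh (k * z))))%C
        with (- Cconj (Ci / (2 * k * k) * (csinh (k * z) * csinh (k * z))))%C.
      * generalize (Ci / (2 * k * k) * (csinh (k * z) * csinh (k * z)))%C. intros w. simpl. ring.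
      * rewrite !Cmult_conj, Cdiv_conj, !Cmult_conj, Cconj_Ci, !Cconj_RtoC by (repeat apply Cmult_neq_0; trivial; intros E; apply RtoC_inj in E; lra).
        field. trivial.
    + rewrite RtoC_m1, !Cmult_conj, Cminus_conj, !Cdiv_conj, !Cmult_conj, Cconj_Ci, !Cconj_RtoC by (repeat apply Cmult_neq_0; trivial; intros E; apply RtoC_inj in E; lra).
      field. trivial.
  - intros z. rewrite !thomsen_f by trivial.
    replace (k * Cconj z)%C with (Cconj (k * z)) by (rewrite Cmult_conj, Cconj_RtoC; ring).
    rewrite csinh_conj. intros E.
    destruct (Ceq_dec (csinh (k * z)) 0) as [E'|E']; [rewrite E'; ring|].
    exfalso. apply Cconj_neq0 in E'.
    apply (Cmult_neq_0 (Ci / (k * k)) _) in E; trivial.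
    + intros E2. apply Ci_nz. replace Ci with (Ci / (k * k) * (k * k))%C by (field; trivial).
      rewrite E2. ring.
    + now apply Cmult_neq_0.
Qed.

(** Splits a constant into what a similarity can absorb: [lam] is [|w|], a homothety factor, and [a]
    is a unimodular square root of [w / |w|], a rotation. *)
Lemma polar_sqrt (w : C) : w <> 0 -> exists (lam : R) (a : C),
  0 < lam /\ fst a * fst a + snd a * snd a = 1 /\ (lam * (a * a) = w)%C.
Proof.
  intros Hw. destruct (Csqrt_ex w) as [r Hr].
  assert (Hr0 : r <> 0) by (intros E; apply Hw; rewrite <- Hr, E; ring).
  pose proof (Cnorm2_pos _ Hr0) as Hp. set (N := fst r ^ 2 + snd r ^ 2) in *.
  assert (Hs : sqrt N * sqrt N = N) by (apply sqrt_sqrt; lra).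
  assert (Hs0 : 0 < sqrt N) by now apply sqrt_lt_R0.
  exists N, (r / RtoC (sqrt N))%C. split; [exact Hp|].
  set (q := sqrt N) in *. clearbody q.
  assert (Hc : RtoC q <> 0) by (intros E; apply RtoC_inj in E; lra).
  split.
  - unfold Cdiv. rewrite <- RtoC_inv by lra. simpl.
    transitivity (N / (q * q)); [unfold N; simpl; field; lra|].
    rewrite Hs. field. lra.
  - rewrite <- Hr. transitivity (N / (q * q) * (r * r))%C; [field; trivial|].
    rewrite <- RtoC_mult, Hs. field. intros E. apply RtoC_inj in E. lra.
Qed.

(** * Normal forms *)

(** The position of the two roots of [q = A + B y + D y^2] on the Riemann sphere relative to
    infinity, which affine maps fix: both at infinity, exactly one at infinity, a finite double
    root, two distinct finite roots. The plane has [h] constant and no such [q]. *)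
Definition kind_cond (K : kind) (A B D : C) : Prop :=
  match K with
  | Plane => False
  | TrivialEnneper => D = 0 /\ B = 0 /\ A <> 0
  | Helicoid => D = 0 /\ B <> 0
  | EnneperType => D <> 0 /\ (B * B - 4 * A * D)%C = 0
  | ThomsenType => D <> 0 /\ (B * B - 4 * A * D)%C <> 0
  end.

Lemma norm2_mult (z w : C) : norm2 (z * w)%C = norm2 z * norm2 w.
Proof. unfold norm2. simpl. ring. Qed.

Lemma norm2_cexp (z : C) : norm2 (cexp z) = exp (2 * fst z).
Proof.
  unfold norm2, cexp, Re, Im. simpl fst; simpl snd.
  replace (2 * fst z) with (fst z + fst z) by ring. rewrite exp_plus.
  pose proof (sin2_cos2 (snd z)) as E. unfold Rsqr in E.
  transitivity (exp (fst z) * exp (fst z) * (sin (snd z) * sin (snd z) + cos (snd z) * cos (snd z)));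
    [ring|]. rewrite E. ring.
Qed.

Section Existence.

Variables (S : C -> Prop) (X : R -> R -> I3) (l : R -> R -> R) (F f h h1 : C -> C) (e : R) (z0 : C).
Hypothesis (Hz0 : S z0) (HD : wsurf_data S l F f h h1) (He : e * e = 1)
  (HX : forall u v, X u v = refl e (wsurf l F u v)).

Let HO := wd_open _ _ _ _ _ _ HD.
Let HC := wd_conn _ _ _ _ _ _ HD.
Let HF := wd_F _ _ _ _ _ _ HD.
Let Hh := wd_h _ _ _ _ _ _ HD.
Let Hf := wd_f _ _ _ _ _ _ HD.
Let Hne : exists z, S z := ex_intro _ z0 Hz0.

Lemma planar_piece : planar S X ->
  exists w, listed Plane w /\ piece_up_to_similarity S X w.
Proof.
  intros (a & b & c & d & Habc & Hpl).
  (* The u- and v-derivatives of the plane equation are the real parts of [(a h + b - i c e) f] and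
     of [i] times it. *)
  assert (Heq : forall z, S z -> (a * h z + b - Ci * (c * e)%R)%C = 0).
  { intros [u v] Hz.
    destruct (proj2 HF _ Hz) as [[Fu1 Fu2] [Fv1 Fv2]]. cbn [fst snd] in *.
    set (g := fun s t => a * l s t + b * fst (F (s, t)) + c * (e * snd (F (s, t)))).
    assert (Eg : forall s t, S (s, t) -> d = g s t).
    { intros s t Hst. rewrite <- (Hpl s t Hst), HX. reflexivity. }
    assert (E1 : a * fst (h (u, v) * f (u, v))%C + b * fst (f (u, v)) + c * (e * snd (f (u, v))) = 0).
    { transitivity (Derive (fun t => g t v) u).
      - symmetry. apply is_derive_unique. unfold g.
        apply (is_derive_plus (V := R_NormedModule)); [apply (is_derive_plus (V := R_NormedModule))|].
        + apply (is_derive_scal (fun t => l t v)), (wd_lu _ _ _ _ _ _ HD _ _ Hz).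
        + apply (is_derive_scal (fun t => fst (F (t, v)))), Fu1.
        + apply (is_derive_scal (fun t => e * snd (F (t, v)))).
          apply (is_derive_scal (fun t => snd (F (t, v)))), Fu2.
      - rewrite <- (Derive_const d u). symmetry. apply Derive_ext_loc.
        apply (open_locally_fst S _ u v HO Hz). intros s Hs. now apply Eg. }
    assert (E2 : a * fst (Ci * (h (u, v) * f (u, v)))%C + b * fst (Ci * f (u, v))%C + c * (e * snd (Ci * f (u, v))%C) = 0).
    { transitivity (Derive (fun t => g u t) v).
      - symmetry. apply is_derive_unique. unfold g.
        apply (is_derive_plus (V := R_NormedModule)); [apply (is_derive_plus (V := R_NormedModule))|].
        + apply (is_derive_scal (fun t => l u t)), (wd_lv _ _ _ _ _ _ HD _ _ Hz).
        + apply (is_derive_scal (fun t => fst (F (u, t)))), Fv1.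
        + apply (is_derive_scal (fun t => e * snd (F (u, t)))).
          apply (is_derive_scal (fun t => snd (F (u, t)))), Fv2.
      - rewrite <- (Derive_const d v). symmetry. apply Derive_ext_loc.
        apply (open_locally_snd S _ u v HO Hz). intros s Hs. now apply Eg. }
    assert (E : ((a * h (u, v) + b - Ci * (c * e)%R) * f (u, v))%C = 0).
    { apply C_eq; simpl in *; lra. }
    destruct (Ceq_dec (a * h (u, v) + b - Ci * (c * e)%R)%C 0) as [K|K]; trivial.
    exfalso. now apply (Cmult_neq_0 _ _ K (Hf _ Hz)). }
  (* A plane with [a = 0] contains the degenerate direction [l], so it carries no spacelike
     immersion. *)
  assert (Ha : a <> 0).
  { intros ->. apply Habc. pose proof (Heq z0 Hz0) as E. injection E as E1 E2. simpl in E1, E2.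
    assert (b = 0) by lra. assert (Hce : c * e = 0) by lra.
    assert (c = 0) by (rewrite <- (Rmult_1_r c), <- He, <- Rmult_assoc, Hce; ring). now subst. }
  assert (Ha' : RtoC a <> 0) by (intros E; now apply Ha, RtoC_inj).
  eexists. split; [apply listed_plane|].
  apply (data_piece S X l F f h h1 e _ _ _ 1 ((b - Ci * (c * e)%R) / a)%C 1 F f Hne HD He HX plane_primitives); trivial.
  - simpl. ring.
  - intros z Hz. simpl. ring.
  - intros z Hz. cbn [fst snd].
    transitivity ((a * h z + b - Ci * (c * e)%R) / a)%C; [|field; trivial].
    rewrite Heq by trivial. field. trivial.
Qed.

Variables (A B D : C).
Hypothesis (Him : fst (B * B - 4 * A * D)%C = 0) (Hn : forall z, S z -> h1 z <> 0)
  (Hq : forall z, S z -> h1 z = (quad A B D (h z) * quad A B D (h z) * f z)%C).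

Lemma trivial_enneper_piece : D = 0 -> B = 0 -> A <> 0 ->
  exists w, listed TrivialEnneper w /\ piece_up_to_similarity S X w.
Proof.
  intros HD0 HB0 HA. eexists. split; [apply listed_trivial_enneper|].
  (* Now [h1 = A^2 f], and the equation on [h] forces [phi = h / a]; the equation on [f] then reads
     [i A^2 = lam a^2]. *)
  destruct (polar_sqrt (Ci * (A * A))%C) as (lam & a & Hl & Ha & Ela).
  { repeat apply Cmult_neq_0; trivial. apply Ci_nz. }
  assert (Ha0 : a <> 0) by (intros E; rewrite E in Ha; simpl in Ha; lra).
  apply (data_piece S X l F f h h1 e _ _ _ lam 0 a (fun z => / a * h z)%C (fun z => / a * h1 z)%C
    Hne HD He HX trivial_enneper_primitives); trivial.
  - lra.
  - apply Hol_scal; [exact HO|exact Hh].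
  - intros z Hz. cbn [fst snd]. rewrite Hq by trivial.
    transitivity (Ci * (A * A) / a * f z)%C; [unfold quad; rewrite HD0, HB0; field; trivial|].
    rewrite <- Ela. field. trivial.
  - intros z Hz. cbn [fst snd]. field. trivial.
Qed.

Lemma helicoid_piece : D = 0 -> B <> 0 ->
  exists w, listed Helicoid w /\ piece_up_to_similarity S X w.
Proof.
  intros HD0 HB. eexists. split; [apply listed_helicoid|].
  set (c := (A / B)%C).
  assert (Hq' : forall z, S z -> h1 z = (B * B * ((h z + c) * (h z + c)) * f z)%C).
  { intros z Hz. rewrite Hq by trivial. unfold quad, c. rewrite HD0. field. trivial. }
  assert (Hhc : forall z, S z -> (h z + c)%C <> 0).
  { intros z Hz E. apply (Hn z Hz). rewrite Hq', E by trivial. ring. }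
  (* For [D = 0] the discriminant is [B^2]; as it is imaginary, [i B^2] is real. *)
  set (lam := fst (Ci * (B * B))%C).
  assert (Elam : (Ci * (B * B))%C = RtoC lam).
  { unfold lam. apply C_eq; [reflexivity|]. rewrite HD0 in Him. simpl in *. lra. }
  assert (Hlam : lam <> 0).
  { intros E. rewrite E in Elam. apply (Cmult_neq_0 _ _ Ci_nz (Cmult_neq_0 _ _ HB HB) Elam). }
  (* [phi] is a logarithm of [h + c] up to a constant. Its derivative is [- i lam (h + c) f], so its
     imaginary part is [- lam (l + Re (c F))], a function on all of [S]; no branch of the argument
     is chosen. *)
  set (phi := (fun z => (/ 2 * ln (norm2 (h z + c)%C), - lam * (l (fst z) (snd z) + fst (c * F z)%C))) : C -> C).
  set (phi1 := fun z => (- Ci * lam * (h z + c) * f z)%C).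
  assert (Hhc1 : Hol S (fun z => h z + c)%C (fun z => h1 z + 0)%C).
  { apply Hol_plus; [exact HO|exact Hh|apply Hol_const; exact HO]. }
  assert (HcF := Hol_scal S c F f HO HF).
  assert (Elog : forall z, S z -> (h1 z + 0 = (h z + c) * phi1 z)%C).
  { intros z Hz. unfold phi1. rewrite Hq' by trivial.
    transitivity (- Ci * (Ci * (B * B)) * ((h z + c) * (h z + c)) * f z)%C.
    - transitivity (- (Ci * Ci) * (B * B) * ((h z + c) * (h z + c)) * f z)%C; [|ring].
      rewrite Ci_sqr. ring.
    - rewrite Elam. ring. }
  assert (Hphi : Hol S phi phi1).
  { split; [split|].
    - simpl. apply smooth_fun_mult; [exact HO|apply smooth_fun_const; exact HO|].
      apply smooth_fun_ln; [exact HO| |].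
      + intros u v Hz. apply Cnorm2_pos. auto.
      + destruct Hhc1 as [[S1 S2] _].
        apply smooth_fun_ext with (fun u v => fst (h (u, v) + c)%C * fst (h (u, v) + c)%C + snd (h (u, v) + c)%C * snd (h (u, v) + c)%C).
        * exact HO.
        * intros u v _. unfold norm2. ring.
        * apply smooth_fun_plus; [exact HO|apply smooth_fun_mult..]; trivial; exact HO.
    - cbn [phi fst snd]. apply smooth_fun_mult; [exact HO|apply smooth_fun_const; exact HO|].
      apply smooth_fun_plus; [exact HO|exact (wd_smooth _ _ _ _ _ _ HD)|]. apply (proj1 HcF).
    - intros [u v] Hz. pose proof (Hhc _ Hz) as Hnz.
      destruct (proj2 Hhc1 _ Hz) as [Hu Hv]. destruct (proj2 HcF _ Hz) as [[Fu _] [Fv _]].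
      cbn [fst snd] in *.
      assert (Hln : forall (g : R -> C) t k, g t <> 0 -> cderiv g t (g t * k)%C ->
        is_derive (fun s => / 2 * ln (norm2 (g s))) t (fst k)).
      { intros g t k Hg Hk. eapply is_derive_eq.
        - apply (is_derive_scal (fun s => ln (norm2 (g s)))). exact (is_derive_ln_norm2 g t k Hg Hk).
        - unfold scal; simpl; unfold mult; simpl. field. }
      split; split.
      + apply (Hln (fun t => h (t, v) + c)%C u (phi1 (u, v)) Hnz). now rewrite <- (Elog _ Hz).
      + cbn [phi fst snd]. eapply is_derive_eq.
        * apply (is_derive_scal (fun t => l t v + fst (c * F (t, v))%C)).
          apply (is_derive_plus (V := R_NormedModule)); [apply (wd_lu _ _ _ _ _ _ HD _ _ Hz)|exact Fu].
        * unfold phi1, scal, plus; simpl. unfold mult; simpl. ring.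
      + apply (Hln (fun t => h (u, t) + c)%C v (Ci * phi1 (u, v))%C Hnz).
        eapply cderiv_eq; [exact Hv|]. rewrite (Elog _ Hz). ring.
      + cbn [phi fst snd]. eapply is_derive_eq.
        * apply (is_derive_scal (fun t => l u t + fst (c * F (u, t))%C)).
          apply (is_derive_plus (V := R_NormedModule)); [apply (wd_lv _ _ _ _ _ _ HD _ _ Hz)|exact Fv].
        * unfold phi1, scal, plus; simpl. unfold mult; simpl. ring. }
  set (g := fun z => ((h z + c) * cexp (- phi z))%C).
  assert (Hg : forall z, S z -> g z = g z0).
  { intros z Hz. apply (cpartials_constant S g HO HC); trivial.
    intros [u v] Huv. destruct (proj2 Hhc1 _ Huv) as [Hu Hv]. destruct (proj2 Hphi _ Huv) as [Pu Pv].
    split; (eapply cderiv_eq; [apply cderiv_mult; [eassumption|apply cderiv_cexp, cderiv_opp; eassumption]|]);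
      cbn [fst snd]; rewrite (Elog _ Huv); cbv beta; ring. }
  (* The remaining constant is unimodular because [Re phi = ln |h + c|], so it can serve as the
     rotation [a]. *)
  assert (Hgn : fst (g z0) * fst (g z0) + snd (g z0) * snd (g z0) = 1).
  { pose proof (Cnorm2_pos _ (Hhc z0 Hz0)) as Hp. fold (norm2 (h z0 + c)%C) in Hp.
    transitivity (norm2 (g z0)); [unfold norm2; ring|].
    unfold g. rewrite norm2_mult, norm2_cexp.
    replace (2 * fst (- phi z0)%C) with (- ln (norm2 (h z0 + c)%C)) by (simpl; field).
    rewrite exp_Ropp, exp_ln by exact Hp. field. lra. }
  apply (data_piece S X l F f h h1 e _ _ _ lam c (g z0) phi phi1 Hne HD He HX helicoid_primitives); trivial.
  - intros z Hz. cbn [fst snd]. rewrite <- (Hg z Hz). unfold g, phi1.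
    transitivity (- (Ci * Ci) * lam * ((h z + c) * cexp (- phi z)) * f z)%C; [ring|].
    rewrite Ci_sqr. ring.
  - intros z Hz. cbn [fst snd]. rewrite <- (Hg z Hz). unfold g.
    transitivity ((h z + c) * (cexp (phi z) * cexp (- phi z)))%C; [ring|]. rewrite cexp_opp. ring.
Qed.

Lemma enneper_piece : D <> 0 -> (B * B - 4 * A * D)%C = 0 ->
  exists w, listed EnneperType w /\ piece_up_to_similarity S X w.
Proof.
  intros HD0 Hdisc. eexists. split; [apply listed_enneper|].
  set (c := (B / (2 * D))%C).
  assert (Hq' : forall z, S z -> h1 z = (D * D * ((h z + c) * (h z + c)) * ((h z + c) * (h z + c)) * f z)%C).
  { intros z Hz. rewrite Hq by trivial.
    assert (E : quad A B D (h z) = (D * ((h z + c) * (h z + c)))%C).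
    { transitivity (D * ((h z + c) * (h z + c)) - (B * B - 4 * A * D) / (4 * D))%C.
      - unfold quad, c. field. trivial.
      - rewrite Hdisc. field. trivial. }
    rewrite E. ring. }
  assert (Hhc : forall z, S z -> (h z + c)%C <> 0).
  { intros z Hz E. apply (Hn z Hz). rewrite Hq', E by trivial. ring. }
  (* With [phi = a / (h + c)] the equation on [f] becomes [- i D^2 a^2 = lam], solved by
     [- i D^2 = lam b^2] and [a = 1 / b]. *)
  destruct (polar_sqrt (- Ci * (D * D))%C) as (lam & b & Hl & Hb & Elb).
  { repeat apply Cmult_neq_0; trivial. intros E. apply Ci_nz. transitivity (- - Ci)%C; [ring|]. rewrite E. ring. }
  set (a := Cconj b).
  assert (Eab : (a * b)%C = 1) by (unfold a; apply C_eq; simpl; lra).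
  assert (Hhc1 : Hol S (fun z => h z + c)%C (fun z => h1 z + 0)%C).
  { apply Hol_plus; [exact HO|exact Hh|apply Hol_const; exact HO]. }
  apply (data_piece S X l F f h h1 e _ _ _ lam c a (fun z => a * / (h z + c))%C
    (fun z => a * (- (h1 z + 0) / ((h z + c) * (h z + c))))%C Hne HD He HX enneper_primitives); trivial.
  - lra.
  - unfold a. simpl. lra.
  - apply Hol_scal; [exact HO|]. now apply Hol_inv.
  - intros z Hz. cbn [fst snd]. pose proof (Hhc z Hz) as Hnz. rewrite Hq' by trivial.
    transitivity (a * a * a * (- Ci * (D * D)) * f z)%C; [field; trivial|].
    rewrite <- Elb. transitivity (lam * a * (a * b) * (a * b) * f z)%C; [ring|].
    rewrite Eab. ring.
  - intros z Hz. cbn [fst snd]. pose proof (Hhc z Hz) as Hnz. field. split; trivial.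
    intros E. rewrite E, Cmult_0_l in Eab. apply C1_nz. now symmetry.
Qed.

Lemma thomsen_piece : D <> 0 -> (B * B - 4 * A * D)%C <> 0 ->
  exists w, listed ThomsenType w /\ piece_up_to_similarity S X w.
Proof.
  intros HD0 Hdisc.
  (* Completing the square, [q(h) = D ((h + c)^2 - d)]. Writing [d = k^2 a^2] with [a] unimodular
     moves the roots to [k] and [- k] in the variable [H = (h + c) / a]. *)
  set (c := (B / (2 * D))%C). set (d := ((B * B - 4 * A * D) / (4 * (D * D)))%C).
  assert (Hd : d <> 0).
  { intros E. apply Hdisc. replace (B * B - 4 * A * D)%C with (d * (4 * (D * D)))%C by (unfold d; field; trivial).
    rewrite E. ring. }
  destruct (polar_sqrt d Hd) as (k2 & a & Hk2 & Ha & Eka).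
  set (k := sqrt k2). assert (Hk : 0 < k) by now apply sqrt_lt_R0.
  assert (Ekk : k * k = k2) by (apply sqrt_sqrt; lra).
  assert (Hk' : RtoC k <> 0) by (intros E; apply RtoC_inj in E; lra).
  assert (Ha0 : a <> 0) by (intros E; rewrite E in Ha; simpl in Ha; lra).
  rewrite <- Ekk, RtoC_mult in Eka.
  set (lam := snd (D * D * (a * a))%C).
  (* The discriminant is [4 k^2 D^2 a^2], so [D^2 a^2] is imaginary along with it. *)
  assert (Elam : (D * D * (a * a))%C = (Ci * lam)%C).
  { assert (E : (B * B - 4 * A * D)%C = ((4 * k * k)%R * (D * D * (a * a)))%C).
    { rewrite !RtoC_mult. transitivity (4 * (D * D) * d)%C; [unfold d; field; trivial|].
      rewrite <- Eka. ring. }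
    rewrite E in Him. change (Re (RtoC (4 * k * k) * (D * D * (a * a)))%C = 0) in Him.
    rewrite re_scal_l in Him.
    assert (E2 : fst (D * D * (a * a))%C = 0).
    { unfold Re in Him. apply Rmult_integral in Him. destruct Him as [K|K]; trivial. nra. }
    unfold lam. apply C_eq; simpl in *; lra. }
  assert (Hlam : lam <> 0).
  { intros E. rewrite E, Cmult_0_r in Elam.
    apply (Cmult_neq_0 _ _ (Cmult_neq_0 _ _ HD0 HD0) (Cmult_neq_0 _ _ Ha0 Ha0) Elam). }
  set (H := fun z => ((h z + c) * / a)%C).
  assert (EH : forall z, (h z + c = a * H z)%C) by (intros z; unfold H; field; trivial).
  set (H1 := fun z => (Ci * ((H z * H z - k * k) * (H z * H z - k * k)) * (lam * a * f z))%C).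
  assert (Eh1 : forall z, S z -> h1 z = (a * H1 z)%C).
  { intros z Hz. rewrite Hq by trivial.
    assert (E : quad A B D (h z) = (D * (a * a) * (H z * H z - k * k))%C).
    { transitivity (D * ((h z + c) * (h z + c) - d))%C; [unfold quad, c, d; field; trivial|].
      rewrite EH, <- Eka. ring. }
    rewrite E. unfold H1.
    transitivity ((D * D * (a * a)) * (a * a) * ((H z * H z - k * k) * (H z * H z - k * k)) * f z)%C; [ring|].
    rewrite Elam. ring. }
  assert (HH : Hol S H H1).
  { eapply Hol_ext; [exact HO| | |apply (Hol_scal S (/ a)%C); [exact HO|
      apply Hol_plus; [exact HO|exact Hh|apply (Hol_const S c); exact HO]]].
    - intros z Hz. unfold H. ring.
    - intros z Hz. cbv beta. rewrite Eh1 by trivial. field. trivial. }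
  assert (Hk2n : forall z, S z -> (H z * H z - k * k)%C <> 0).
  { intros z Hz E. apply (Hn z Hz). rewrite Eh1 by trivial. unfold H1. rewrite E. ring. }
  assert (Hm : forall z, S z -> (H z - k)%C <> 0).
  { intros z Hz E. apply (Hk2n z Hz). transitivity ((H z - k) * (H z + k))%C; [ring|]. rewrite E. ring. }
  assert (Hp : forall z, S z -> (H z + k)%C <> 0).
  { intros z Hz E. apply (Hk2n z Hz). transitivity ((H z - k) * (H z + k))%C; [ring|]. rewrite E. ring. }
  (* A primitive of [dH / (k^2 - H^2)] would be a logarithm. Instead, the target relation
     [P(phi) = lam a F + constant] is solved for the linear term of [P]: there
     [sinh cosh = k H / (H^2 - k^2)], which gives this single-valued formula. *)
  set (phi0 := fun z => (H z / (H z * H z - k * k) + (2 * Ci * (k * k) * (lam * a)) * F z)%C).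
  set (phi1 := fun z => (- Ci * (H z * H z - k * k) * (lam * a * f z))%C).
  assert (Hphi0 : Hol S phi0 phi1).
  { unfold phi0. eapply Hol_ext; [exact HO|reflexivity| |
      apply Hol_plus; [exact HO|apply Hol_div; [exact HO|exact Hk2n|exact HH|
        apply Hol_minus; [exact HO|apply Hol_mult; [exact HO|exact HH|exact HH]|apply Hol_const; exact HO]]|
        apply Hol_scal; [exact HO|exact HF]]].
    intros z Hz. cbv beta. pose proof (Hk2n z Hz). unfold H1, phi1. field. trivial. }
  (* [exp (2 k phi0) (H - k) / (H + k)] is constant; [w0] shifts [phi0] so that the constant becomes
     1, which amounts to [H = k coth (k phi)]. *)
  set (g0 := (cexp (2 * k * phi0 z0) * ((H z0 - k) / (H z0 + k)))%C).
  assert (Hg0 : g0 <> 0).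
  { apply Cmult_neq_0; [apply cexp_neq0|]. intros E. apply (Hm z0 Hz0).
    replace (H z0 - k)%C with ((H z0 - k) / (H z0 + k) * (H z0 + k))%C by (field; auto).
    rewrite E. ring. }
  destruct (cexp_surj (/ g0)%C) as [w0 Hw0].
  { intros E. apply C1_nz. rewrite <- (Cinv_r g0 Hg0), E. ring. }
  set (phi := fun z => (phi0 z + w0 / (2 * k))%C).
  assert (Hphi : Hol S phi (fun z => phi1 z + 0)%C).
  { apply Hol_plus; [exact HO|exact Hphi0|apply Hol_const; exact HO]. }
  assert (Eexp : forall z, S z -> cexp (2 * k * phi z) = ((H z + k) / (H z - k))%C).
  { set (g := fun z => (cexp (2 * k * phi z) * ((H z - k) * / (H z + k)))%C).
    assert (Eg : forall z, S z -> g z = g z0).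
    { intros z Hz. apply (cpartials_constant S g HO HC); trivial.
      intros [u v] Huv. destruct (proj2 HH _ Huv) as [Hu Hv]. destruct (proj2 Hphi _ Huv) as [Pu Pv].
      pose proof (Hp _ Huv) as Hpz. cbn [fst snd] in *.
      split; (eapply cderiv_eq;
        [apply cderiv_mult; [apply cderiv_cexp, cderiv_mult; [apply cderiv_const|eassumption]|
          apply cderiv_mult; [apply cderiv_plus; [eassumption|apply cderiv_const]|
            apply cderiv_inv; [eassumption|apply cderiv_plus; [eassumption|apply cderiv_const]]]]|]);
        cbn [fst snd]; unfold phi1, H1; field; trivial. }
    intros z Hz.
    assert (E1 : g z0 = 1).
    { unfold g, phi.
      replace (2 * k * (phi0 z0 + w0 / (2 * k)))%C with (2 * k * phi0 z0 + w0)%C by (field; trivial).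
      rewrite cexp_plus, Hw0. transitivity (g0 * / g0)%C; [unfold g0; field|now apply Cinv_r].
      repeat split; auto using cexp_neq0. }
    transitivity (g z * ((H z + k) / (H z - k)))%C; [unfold g; field; auto|].
    rewrite Eg, E1 by trivial. ring. }
  assert (Hsc : forall z, S z -> (csinh (k * phi z) * csinh (k * phi z) = k * k / (H z * H z - k * k))%C /\
     (k * ccosh (k * phi z) = H z * csinh (k * phi z))%C).
  { intros z Hz. pose proof (Eexp z Hz) as E. pose proof (cexp_opp (k * phi z)%C) as Eo.
    replace (2 * k * phi z)%C with (k * phi z + k * phi z)%C in E by ring. rewrite cexp_plus in E.
    unfold csinh, ccosh. set (y := cexp (k * phi z)) in *. set (y' := cexp (- (k * phi z))) in *.
    assert (Hy : y <> 0) by apply cexp_neq0.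
    assert (Ey' : y' = (/ y)%C) by (rewrite <- (Cmult_1_r (/ y)), <- Eo; field; trivial).
    pose proof (Hm z Hz). pose proof (Hp z Hz). pose proof (Hk2n z Hz).
    assert (Eyy : (/ (y * y) = (H z - k) / (H z + k))%C) by (rewrite E; field; auto).
    rewrite Ey'. split.
    - transitivity ((y * y + / (y * y) - 2) / 4)%C; [field; trivial|].
      rewrite Eyy, E. field. auto.
    - transitivity (/ 2 * (k * (y * y) + k) * / y)%C; [field; trivial|].
      transitivity (/ 2 * (H z * (y * y) - H z) * / y)%C; [|field; trivial].
      f_equal. f_equal. rewrite E. field. auto. }
  assert (HSn : forall z, S z -> csinh (k * phi z) <> 0).
  { intros z Hz E. destruct (Hsc z Hz) as [E1 _]. rewrite E in E1.
    apply (Cmult_neq_0 _ _ Hk' Hk').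
    transitivity (k * k / (H z * H z - k * k) * (H z * H z - k * k))%C; [field; auto|].
    rewrite <- E1. ring. }
  exists (thomsen (2 * k) 2). split; [apply listed_thomsen; lra|].
  apply (data_piece S X l F f h h1 e _ _ _ lam c a phi _ Hne HD He HX (thomsen_primitives k (Rgt_not_eq _ _ Hk)) Hlam Ha Hphi).
  - intros z Hz. rewrite thomsen_f by lra. destruct (Hsc z Hz) as [-> _].
    pose proof (Hk2n z Hz). unfold phi1.
    transitivity (- (Ci * Ci) * (lam * a * f z))%C; [field; auto|]. rewrite Ci_sqr. ring.
  - intros z Hz. rewrite thomsen_h. unfold ccoth. destruct (Hsc z Hz) as [_ E]. pose proof (HSn z Hz).
    rewrite EH. transitivity (k * ccosh (k * phi z) / csinh (k * phi z) * a)%C; [field; auto|].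
    rewrite E. field. auto.
Qed.

End Existence.

(** * Uniqueness of the kind *)

(** The identity for [e = 1] and conjugation for [e = -1], so that both orientations are treated at
    once. *)
Definition cj (e : R) (z : C) : C := (fst z, e * snd z).

Lemma cj_mult (e : R) (z w : C) : e * e = 1 -> cj e (z * w)%C = (cj e z * cj e w)%C.
Proof.
  intros He. apply C_eq; simpl; [|ring].
  transitivity (fst z * fst w - (e * e) * (snd z * snd w)); [rewrite He|]; ring.
Qed.

Lemma cj_plus (e : R) (z w : C) : cj e (z + w)%C = (cj e z + cj e w)%C.
Proof. apply C_eq; simpl; ring. Qed.

Lemma cj_minus (e : R) (z w : C) : cj e (z - w)%C = (cj e z - cj e w)%C.
Proof. apply C_eq; simpl; ring. Qed.

Lemma cj_Ci (e : R) : cj e Ci = (e * Ci)%C.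
Proof. apply C_eq; simpl; ring. Qed.

Lemma cj_RtoC (e r : R) : cj e (RtoC r) = RtoC r.
Proof. apply C_eq; simpl; ring. Qed.

Lemma cj_cj (e : R) (z : C) : e * e = 1 -> cj e (cj e z) = z.
Proof. intros He. apply C_eq; simpl; trivial. rewrite <- Rmult_assoc, He. ring. Qed.

Lemma cj_neq0 (e : R) (z : C) : e * e = 1 -> z <> 0 -> cj e z <> 0.
Proof. intros He Hz E. apply Hz. rewrite <- (cj_cj e z He), E. apply C_eq; simpl; ring. Qed.

Lemma cj_eq0 (e : R) (z : C) : e * e = 1 -> cj e z = 0 -> z = 0.
Proof. intros He E. rewrite <- (cj_cj e z He), E. apply C_eq; simpl; ring. Qed.

Lemma cderiv_cj (e : R) (f : R -> C) (t : R) (a : C) : cderiv f t a -> cderiv (fun s => cj e (f s)) t (cj e a).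
Proof.
  intros [H1 H2]. split; simpl; trivial. now apply (is_derive_scal (fun s => snd (f s))).
Qed.

Lemma kind_cond_cj (e : R) (K : kind) (A B D : C) : e * e = 1 ->
  kind_cond K A B D -> kind_cond K (cj e A) (cj e B) (cj e D).
Proof.
  intros He. assert (E0 : cj e 0 = 0) by (apply C_eq; simpl; ring).
  assert (Ed : (cj e B * cj e B - 4 * cj e A * cj e D)%C = cj e (B * B - 4 * A * D)%C).
  { now rewrite cj_minus, !cj_mult, cj_RtoC. }
  destruct K; unfold kind_cond; rewrite ?Ed; intuition; subst; auto using cj_neq0;
    match goal with H : _ = RtoC 0 |- _ => rewrite H; auto | _ => idtac end;
    match goal with H : cj e _ = _ |- _ => apply cj_eq0 in H; auto end.
Qed.

(** The new coefficients are those of [s q(m y + n)]. An affine substitution keeps the number of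
    roots at infinity, and the discriminant is multiplied by [s^2 m^2]. *)
Lemma kind_cond_affine (K : kind) (A B D s m n : C) : s <> RtoC 0 -> m <> RtoC 0 ->
  kind_cond K A B D ->
  kind_cond K (s * (A + B * n + D * (n * n)))%C (s * (B * m + 2 * D * m * n))%C (s * (D * (m * m)))%C.
Proof.
  intros Hs Hm.
  assert (Ed : (s * (B * m + 2 * D * m * n) * (s * (B * m + 2 * D * m * n)) -
    4 * (s * (A + B * n + D * (n * n))) * (s * (D * (m * m))))%C = (s * s * (m * m) * (B * B - 4 * A * D))%C) by ring.
  assert (Hsm : (s * s * (m * m))%C <> 0) by (repeat apply Cmult_neq_0; trivial).
  destruct K; unfold kind_cond; rewrite ?Ed.
  - trivial.
  - intros (-> & -> & HA). split; [ring|split; [ring|]].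
    replace (s * _)%C with (s * A)%C by ring. now apply Cmult_neq_0.
  - intros (-> & HB). split; [ring|].
    replace (s * _)%C with (s * (B * m))%C by ring. repeat apply Cmult_neq_0; trivial.
  - intros (HD & E). split; [repeat apply Cmult_neq_0; trivial|]. rewrite E. ring.
  - intros (HD & E). split; repeat apply Cmult_neq_0; trivial.
Qed.

Lemma listed_ode (K : kind) (w : wdata) : listed K w ->
  (K = Plane /\ forall z, fst w z = 0) \/
  (K <> Plane /\ exists A B D, kind_cond K A B D /\
     forall g t a, snd w (g t) <> 0 -> cderiv g t a ->
       quad A B D (fst w (g t)) <> 0 /\
       cderiv (fun s => fst w (g s)) t
         (quad A B D (fst w (g t)) * quad A B D (fst w (g t)) * snd w (g t) * a)%C).
Proof.
  (* The factor [i] of the listed forms enters [q^2 f], so the coefficients of [q] need square roots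
     of [i] and of [1 / i], namely [j] and [i j]. *)
  destruct (Csqrt_ex Ci) as [j Hj].
  assert (Hj0 : j <> 0) by (intros E; apply Ci_nz; rewrite <- Hj, E; ring).
  assert (Hij : (Ci * j * (Ci * j) * Ci)%C = 1).
  { transitivity (Ci * Ci * (j * j) * Ci)%C; [ring|]. rewrite Hj.
    transitivity (Ci * Ci * (Ci * Ci))%C; [ring|]. rewrite Ci_sqr. ring. }
  destruct 1 as [ | | | |alpha beta Ha Hb]; [left; now split|right; split; [discriminate|]..].
  - exists (Ci * j)%C, (RtoC 0), (RtoC 0). unfold quad; cbn [fst snd].
    assert (Hn : (Ci * j)%C <> 0) by (apply Cmult_neq_0; trivial; apply Ci_nz).
    split; [repeat split; trivial|]. intros g t a _ Hg. split.
    + intros E. apply Hn. rewrite <- E. ring.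
    + eapply cderiv_eq; [exact Hg|].
      transitivity (Ci * j * (Ci * j) * Ci * a)%C; [rewrite Hij|]; ring.
  - exists (RtoC 0), (Ci * j)%C, (RtoC 0). unfold quad; cbn [fst snd].
    assert (Hn : (Ci * j)%C <> 0) by (apply Cmult_neq_0; trivial; apply Ci_nz).
    split; [repeat split; trivial|]. intros g t a _ Hg. split.
    + intros E. apply (Cmult_neq_0 _ _ Hn (cexp_neq0 (g t))). rewrite <- E. ring.
    + eapply cderiv_eq; [apply cderiv_cexp, Hg|].
      transitivity (Ci * j * (Ci * j) * Ci * cexp (g t) * (cexp (g t) * cexp (- g t)) * a)%C; [|ring].
      rewrite Hij, cexp_opp. ring.
  - exists (RtoC 0), (RtoC 0), j. unfold quad; cbn [fst snd].
    split; [split; [trivial|ring]|]. intros g t a Hz Hg.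
    assert (Hg0 : g t <> 0) by (intros E; apply Hz; rewrite E; ring).
    split.
    + intros E. apply Hj0. transitivity (j * (1 / g t * (1 / g t)) * (g t * g t))%C; [field; trivial|].
      transitivity ((0 + 0 * (1 / g t) + j * (1 / g t * (1 / g t))) * (g t * g t))%C; [ring|]. rewrite E. ring.
    + eapply cderiv_eq.
      * apply (cderiv_mult (fun _ => 1) (fun s => / g s)%C); [apply cderiv_const|apply cderiv_inv; eassumption].
      * cbv beta. transitivity ((j * j) * Ci * (/ (g t * g t)) * a)%C; [|field; trivial].
        rewrite Hj, Ci_sqr. field. trivial.
  - assert (HA : RtoC alpha <> 0) by (intros E; apply RtoC_inj in E; lra).
    assert (HB : RtoC beta <> 0) by (intros E; apply RtoC_inj in E; lra).
    assert (H4 : RtoC 4 <> 0) by (intros E; apply RtoC_inj in E; lra).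
    set (D := (j * beta / 2)%C).
    assert (HD : D <> 0).
    { intros E. apply (Cmult_neq_0 _ _ Hj0 HB). transitivity (2 * D)%C; [unfold D; field|rewrite E; ring]. }
    set (r := (alpha / beta)%C).
    assert (Hr : r <> 0).
    { intros E. apply HA. transitivity (r * beta)%C; [unfold r; field; trivial|rewrite E; ring]. }
    (* [q = D (y^2 - r^2)] has its roots at the two values that [h = r coth] omits;
       [D^2 = i beta^2 / 4] then matches [h']. *)
    exists (- D * (r * r))%C, (RtoC 0), D. unfold quad; cbn [fst snd].
    split; [split; trivial|].
    { replace (_ - _)%C with (4 * (D * D) * (r * r))%C by ring.
      exact (Cmult_neq_0 _ _ (Cmult_neq_0 _ _ H4 (Cmult_neq_0 _ _ HD HD)) (Cmult_neq_0 _ _ Hr Hr)). }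
    intros g t a Hz Hg. set (x := (alpha * g t / 2)%C) in *.
    assert (Hx : csinh x <> 0) by (intros E; apply Hz; rewrite E; ring).
    assert (Eq : (- D * (r * r) + 0 * (r * ccoth x) + D * (r * ccoth x * (r * ccoth x)))%C
       = (D * (r * r) / (csinh x * csinh x))%C).
    { transitivity (D * (r * r) * (ccosh x * ccosh x - csinh x * csinh x) / (csinh x * csinh x))%C.
      - unfold ccoth. field. trivial.
      - rewrite cosh_sinh. field. trivial. }
    fold r. rewrite Eq. split.
    + intros E. apply (Cmult_neq_0 _ _ HD (Cmult_neq_0 _ _ Hr Hr)).
      transitivity (D * (r * r) / (csinh x * csinh x) * (csinh x * csinh x))%C; [field; trivial|].
      rewrite E. ring.
    + assert (Hg' : cderiv (fun s => alpha * g s / 2)%C t (alpha * a / 2)%C).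
      { eapply cderiv_eq; [apply (cderiv_mult (fun s => alpha * g s)%C (fun _ => / 2)%C);
          [apply cderiv_mult; [apply cderiv_const|exact Hg]|apply cderiv_const]|]. cbv beta. field. }
      eapply cderiv_eq.
      * apply cderiv_mult; [apply cderiv_const|].
        apply (cderiv_mult (fun s => ccosh (alpha * g s / 2))%C (fun s => / csinh (alpha * g s / 2))%C).
        -- apply cderiv_ccosh, Hg'.
        -- apply cderiv_inv; [exact Hx|]. apply cderiv_csinh, Hg'.
      * cbv beta. fold x.
        transitivity (r * (- (ccosh x * ccosh x - csinh x * csinh x) * (alpha * a / 2)) / (csinh x * csinh x))%C;
          [field; trivial|].
        rewrite cosh_sinh.
        transitivity (D * D * (r * r * (r * r)) * Ci * (2 * beta / (alpha * alpha)) * a / (csinh x * csinh x))%C;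
          [|field; auto].
        transitivity ((j * j) * Ci * alpha * alpha * a / (2 * beta) / (csinh x * csinh x))%C;
          [|unfold D, r; field; auto].
        rewrite Hj, Ci_sqr. unfold r. field. auto.
Qed.

Lemma Re_primitive_along (Y : R -> R -> R) (psi : C -> C) (g : R -> C) (t : R) (a : C) :
  is_Re_primitive_at Y psi (fst (g t)) (snd (g t)) -> cderiv g t a ->
  is_derive (fun s => Y (fst (g s)) (snd (g s))) t (fst (psi (g t) * a)%C).
Proof.
  intros HY [H1 H2]. apply is_derive_Reals.
  replace (fst (psi (g t) * a)%C) with
    (Re (psi (fst (g t), snd (g t))) * fst a + - Im (psi (fst (g t), snd (g t))) * snd a)
    by (rewrite <- surjective_pairing; unfold Re, Im; simpl; ring).
  apply (derivable_pt_lim_comp_2d Y); trivial; now apply is_derive_Reals.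
Qed.

(** The equation [dh = q(h)^2 dF] of the listed surface is transported to [X]. The parameter change
    is only a real local diffeomorphism, so the data are compared by differentiating [T X = Y o phi]
    along both coordinate directions. *)
Lemma piece_ode (S : C -> Prop) (X : R -> R -> I3) (l : R -> R -> R)
    (F f h h1 : C -> C) (e : R) (K : kind) (w : wdata) :
  (exists z, S z) -> wsurf_data S l F f h h1 -> e * e = 1 ->
  (forall u v, X u v = refl e (wsurf l F u v)) ->
  listed K w -> piece_up_to_similarity S X w ->
  (K = Plane /\ forall z, S z -> h1 z = 0) \/
  (K <> Plane /\ (forall z, S z -> h1 z <> 0) /\ exists A B D, kind_cond K A B D /\
     forall z, S z -> h1 z = (quad A B D (h z) * quad A B D (h z) * f z)%C).
Proof.
  intros [z0 Hz0] HD He HX HK (T & Y & HT & HY & phi & Hdiff & Hphi).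
  pose proof (wd_open _ _ _ _ _ _ HD) as HO. pose proof (wd_f _ _ _ _ _ _ HD) as Hf.
  pose proof (wd_F _ _ _ _ _ _ HD) as HF. pose proof (wd_h _ _ _ _ _ _ HD) as Hh.
  destruct (similarity_is_affmap T HT) as (lam & c & a & t0 & t & Hlam & Ha & ET).
  assert (Hlam' : RtoC lam <> 0) by (intros E; now apply Hlam, RtoC_inj).
  destruct w as [hw fw]. unfold wdomain in Hphi. cbn [fst snd] in *.
  destruct Hdiff as (Sp1 & Sp2 & _).
  assert (Hpd : forall u v, S (u, v) -> exists al be,
     cderiv (fun s => phi (s, v)) u al /\ cderiv (fun s => phi (u, s)) v be).
  { intros u v Hz.
    exists (pu (fun u v => fst (phi (u, v))) u v, pu (fun u v => snd (phi (u, v))) u v),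
           (pv (fun u v => fst (phi (u, v))) u v, pv (fun u v => snd (phi (u, v))) u v).
    split; split; simpl.
    - exact (smooth_fun_derive_u S _ u v Sp1 Hz).
    - exact (smooth_fun_derive_u S _ u v Sp2 Hz).
    - exact (smooth_fun_derive_v S _ u v Sp1 Hz).
    - exact (smooth_fun_derive_v S _ u v Sp2 Hz). }
  assert (Hcomp : forall u v, S (u, v) ->
     lc (Y (fst (phi (u, v))) (snd (phi (u, v)))) = lam * l u v + fst (c * cj e (F (u, v)))%C + t0 /\
     hor (Y (fst (phi (u, v))) (snd (phi (u, v)))) = (a * cj e (F (u, v)) + t)%C).
  { intros u v Hz. destruct (Hphi u v Hz) as [_ E]. rewrite <- E, ET, HX. split.
    - reflexivity.
    - unfold affmap. unfold hor at 1. cbn [xc yc fst snd]. now rewrite <- surjective_pairing. }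
  (* Along one curve the horizontal coordinates give a complex equation, but [l] only the real part
     of one. *)
  assert (Hcurve : forall (g : R -> C) (s0 : R) (al dF : C) (dl : R),
    S (g s0) -> locally s0 (fun s => S (g s)) ->
    cderiv (fun s => phi (g s)) s0 al -> cderiv (fun s => F (g s)) s0 dF ->
    is_derive (fun s => l (fst (g s)) (snd (g s))) s0 dl ->
    (fw (phi (g s0)) * al = a * cj e dF)%C /\
    fst (hw (phi (g s0)) * (a * cj e dF))%C = lam * dl + fst (c * cj e dF)%C).
  { intros g s0 al dF dl Hg0 Hgl Hal HdF Hdl.
    assert (Hg0' : S (fst (g s0), snd (g s0))) by now rewrite <- surjective_pairing.
    destruct (Hphi _ _ Hg0') as [Hdom _]. rewrite <- surjective_pairing in Hdom.
    assert (Hdom' : wdomain (hw, fw) (fst (phi (g s0)), snd (phi (g s0)))).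
    { unfold wdomain. now rewrite <- surjective_pairing. }
    destruct (HY _ _ Hdom') as (Hl & Hx & Hy).
    pose proof (Re_primitive_along _ _ (fun s => phi (g s)) s0 al Hl Hal) as Dl.
    pose proof (Re_primitive_along _ _ (fun s => phi (g s)) s0 al Hx Hal) as Dx.
    pose proof (Re_primitive_along _ _ (fun s => phi (g s)) s0 al Hy Hal) as Dy.
    pose proof (cderiv_plus _ _ _ _ _ (cderiv_mult _ _ _ _ _ (cderiv_const a s0) (cderiv_cj e _ _ _ HdF))
                  (cderiv_const t s0)) as [Ex Ey].
    pose proof (cderiv_mult _ _ _ _ _ (cderiv_const c s0) (cderiv_cj e _ _ _ HdF)) as [Ec _].
    assert (EL : fst (hw (phi (g s0)) * fw (phi (g s0)) * al)%C = lam * dl + fst (c * cj e dF)%C).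
    { rewrite <- (is_derive_unique _ _ _ Dl). apply is_derive_unique.
      apply is_derive_ext_loc with (fun s => lam * l (fst (g s)) (snd (g s)) + fst (c * cj e (F (g s)))%C + t0).
      - generalize Hgl. apply filter_imp. intros s Hs.
        rewrite (surjective_pairing (g s)) in Hs. destruct (Hcomp _ _ Hs) as [E _].
        rewrite <- surjective_pairing in E. symmetry. exact E.
      - eapply is_derive_eq.
        + apply (is_derive_plus (V := R_NormedModule));
            [apply (is_derive_plus (V := R_NormedModule));
              [apply (is_derive_scal (fun s => l (fst (g s)) (snd (g s)))), Hdl|exact Ec]
            |apply (is_derive_const (V := R_NormedModule))].
        + unfold plus, scal, zero; simpl. unfold mult; simpl. ring. }
    assert (Eh : forall s, S (g s) -> hor (Y (fst (phi (g s))) (snd (phi (g s)))) = (a * cj e (F (g s)) + t)%C).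
    { intros s Hs. rewrite (surjective_pairing (g s)) in Hs. destruct (Hcomp _ _ Hs) as [_ E].
      now rewrite <- surjective_pairing in E. }
    assert (EF : (fw (phi (g s0)) * al = a * cj e dF)%C).
    { apply C_eq.
      - transitivity (fst (1 * fw (phi (g s0)) * al)%C); [now rewrite Cmult_1_l|].
        rewrite <- (is_derive_unique _ _ _ Dx). apply is_derive_unique.
        apply is_derive_ext_loc with (fun s => fst (a * cj e (F (g s)) + t)%C).
        + generalize Hgl. apply filter_imp. intros s Hs. now rewrite <- Eh.
        + eapply is_derive_eq; [exact Ex|]. simpl. ring.
      - transitivity (fst (- Ci * fw (phi (g s0)) * al)%C); [simpl; ring|].
        rewrite <- (is_derive_unique _ _ _ Dy). apply is_derive_unique.
        apply is_derive_ext_loc with (fun s => snd (a * cj e (F (g s)) + t)%C).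
        + generalize Hgl. apply filter_imp. intros s Hs. now rewrite <- Eh.
        + eapply is_derive_eq; [exact Ey|]. simpl. ring. }
    split; [exact EF|]. rewrite <- EF, <- EL. f_equal. ring. }
  assert (Hkey : forall u v, S (u, v) -> exists al,
     fw (phi (u, v)) <> 0 /\ cderiv (fun s => phi (s, v)) u al /\
     (fw (phi (u, v)) * al = a * cj e (f (u, v)))%C /\
     (hw (phi (u, v)) * a = lam * cj e (h (u, v)) + c)%C).
  { intros u v Hz. destruct (Hpd u v Hz) as (al & be & Hal & Hbe).
    destruct (proj2 HF _ Hz) as [Fu Fv]. cbn [fst snd] in Fu, Fv.
    destruct (Hcurve (fun s => (s, v)) u al (f (u, v)) _ Hz
      (open_locally_fst S (fun s => S (s, v)) u v HO Hz (fun _ H => H)) Hal Fu (wd_lu _ _ _ _ _ _ HD _ _ Hz)) as [E1 E2].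
    destruct (Hcurve (fun s => (u, s)) v be (Ci * f (u, v))%C _ Hz
      (open_locally_snd S (fun s => S (u, s)) u v HO Hz (fun _ H => H)) Hbe Fv (wd_lv _ _ _ _ _ _ HD _ _ Hz)) as [_ E3].
    exists al. split; [apply (Hphi u v Hz)|]. split; [exact Hal|]. split; [exact E1|].
    set (W := (hw (phi (u, v)) * a - (lam * cj e (h (u, v)) + c))%C).
    assert (He' : RtoC e <> 0) by (intros E; apply RtoC_inj in E; rewrite E in He; lra).
    (* The equations for [l] along u and along v say that [W cj(f)] and [e i W cj(f)] have zero real
       part. *)
    assert (EW : (W * cj e (f (u, v)))%C = 0).
    { assert (F1 : fst (W * cj e (f (u, v)))%C = 0).
      { replace (fst (h (u, v) * f (u, v))%C) with (fst (cj e (h (u, v)) * cj e (f (u, v)))%C) in E2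
          by (now rewrite <- cj_mult).
        generalize E2. unfold W. generalize (cj e (f (u, v))) (cj e (h (u, v))) (hw (phi (u, v))).
        intros p q r E. simpl in *. lra. }
      assert (F2 : fst ((e * Ci) * (W * cj e (f (u, v))))%C = 0).
      { rewrite !cj_mult, cj_Ci in E3 by trivial.
        replace (fst (Ci * (h (u, v) * f (u, v)))%C) with (fst (e * Ci * (cj e (h (u, v)) * cj e (f (u, v))))%C) in E3
          by (now rewrite <- cj_Ci, <- !cj_mult).
        generalize E3. unfold W. generalize (cj e (f (u, v))) (cj e (h (u, v))) (hw (phi (u, v))).
        intros p q r E. simpl in *. lra. }
      apply C_eq; [exact F1|].
      simpl in F2 |- *. apply Rmult_eq_reg_l with e; [|intros E; rewrite E in He; lra]. lra. }
    destruct (Ceq_dec W 0) as [E|E].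
    - transitivity (W + (lam * cj e (h (u, v)) + c))%C; [unfold W; ring|]. rewrite E. ring.
    - exfalso. apply (Cmult_neq_0 _ _ E (cj_neq0 e _ He (Hf _ Hz)) EW). }
  assert (EH : forall u v, S (u, v) -> hw (phi (u, v)) = (lam / a * cj e (h (u, v)) + c / a)%C).
  { intros u v Hz. destruct (Hkey u v Hz) as (_ & _ & _ & _ & E).
    transitivity (hw (phi (u, v)) * a / a)%C; [field; trivial|]. rewrite E. field. trivial. }
  assert (EH1 : forall u v d, S (u, v) -> cderiv (fun s => hw (phi (s, v))) u d ->
     d = (lam / a * cj e (h1 (u, v)))%C).
  { intros u v d Hz Hd. destruct (proj2 Hh _ Hz) as [Hu _]. cbn [fst snd] in Hu.
    apply (cderiv_unique _ _ _ _ Hd).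
    apply cderiv_ext_loc with (fun s => lam / a * cj e (h (s, v)) + c / a)%C.
    - apply (open_locally_fst S _ u v HO Hz). intros s Hs. symmetry. now apply EH.
    - eapply cderiv_eq.
      + apply cderiv_plus; [apply cderiv_mult; [apply cderiv_const|apply cderiv_cj; exact Hu]|apply cderiv_const].
      + cbv beta. field. trivial. }
  assert (Hla : (lam / a)%C <> 0).
  { intros E. apply Hlam'. transitivity (lam / a * a)%C; [field; trivial|]. rewrite E. ring. }
  destruct (listed_ode K (hw, fw) HK) as [[EK Eh0]|[EK (A & B & D & Hcond & Hode)]].
  - left. split; [exact EK|]. intros [u v] Hz. cbn [fst] in Eh0.
    apply (cj_eq0 e _ He).
    assert (E : (lam / a * cj e (h1 (u, v)))%C = 0).
    { symmetry. apply (EH1 u v 0 Hz).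
      apply cderiv_ext_loc with (fun _ => RtoC 0); [|apply cderiv_const].
      apply filter_forall. intros s. now rewrite Eh0. }
    destruct (Ceq_dec (cj e (h1 (u, v))) 0) as [E'|E']; trivial.
    exfalso. now apply (Cmult_neq_0 _ _ Hla E').
  - right. split; [exact EK|].
    (* Substituting [hw = m cj(h) + n] into the equation of [hw] and dividing by [m] leaves the
       factor [a^2 / lam]; its square root is absorbed into [q]. *)
    destruct (Csqrt_ex (a * a / lam)%C) as [sg Hsg].
    assert (Hsg0 : sg <> 0).
    { intros E. apply (Cmult_neq_0 _ _ Ha Ha). transitivity (sg * sg * lam)%C; [rewrite Hsg; field; trivial|].
      rewrite E. ring. }
    set (m := (lam / a)%C) in *. set (n := (c / a)%C) in *.
    assert (Eq1 : forall u v, S (u, v) ->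
       quad A B D (m * cj e (h (u, v)) + n)%C <> 0 /\
       (cj e (h1 (u, v)) = sg * quad A B D (m * cj e (h (u, v)) + n) * (sg * quad A B D (m * cj e (h (u, v)) + n)) * cj e (f (u, v)))%C).
    { intros u v Hz. destruct (Hkey u v Hz) as (al & Hfw & Hal & Eal & _).
      destruct (Hode (fun s => phi (s, v)) u al Hfw Hal) as [Hq0 Hq1]. cbn [fst snd] in Hq0, Hq1.
      pose proof (EH1 u v _ Hz Hq1) as E. rewrite (EH u v Hz) in E, Hq0. fold m in E, Hq0.
      split; [exact Hq0|]. set (q := quad A B D _) in *.
      transitivity (a / lam * (m * cj e (h1 (u, v))))%C; [unfold m; field; auto|].
      rewrite <- E. transitivity (a / lam * (q * q) * (fw (phi (u, v)) * al))%C; [ring|].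
      rewrite Eal. transitivity ((sg * sg) * (q * q) * cj e (f (u, v)))%C; [rewrite Hsg; field; trivial|ring]. }
    split.
    + intros [u v] Hz E. destruct (Eq1 u v Hz) as [Hq0 Eq]. rewrite E in Eq.
      apply (Cmult_neq_0 _ _ (Cmult_neq_0 _ _ (Cmult_neq_0 _ _ Hsg0 Hq0) (Cmult_neq_0 _ _ Hsg0 Hq0)) (cj_neq0 e _ He (Hf _ Hz))).
      rewrite <- Eq. apply C_eq; simpl; ring.
    + eexists _, _, _. split.
      * exact (kind_cond_cj e K _ _ _ He (kind_cond_affine K A B D sg m n Hsg0 Hla Hcond)).
      * intros [u v] Hz. destruct (Eq1 u v Hz) as [_ Eq].
        rewrite <- (cj_cj e (h1 (u, v)) He), Eq.
        set (q := quad A B D (m * cj e (h (u, v)) + n)%C) in *.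
        transitivity (cj e sg * cj e q * (cj e sg * cj e q) * f (u, v))%C;
          [now rewrite !cj_mult, cj_cj|].
        assert (Ecj : (cj e sg * cj e q)%C =
          quad (cj e (sg * (A + B * n + D * (n * n)))) (cj e (sg * (B * m + 2 * D * m * n))) (cj e (sg * (D * (m * m)))) (h (u, v))).
        { transitivity (quad (cj e (sg * (A + B * n + D * (n * n)))) (cj e (sg * (B * m + 2 * D * m * n)))
            (cj e (sg * (D * (m * m)))) (cj e (cj e (h (u, v))))); [|now rewrite cj_cj].
          rewrite <- cj_mult by trivial. unfold q, quad. generalize (cj e (h (u, v))). intros y.
          rewrite <- !cj_mult, <- !cj_plus by trivial. f_equal. ring. }
        rewrite Ecj. reflexivity.
Qed.

(** * Polynomial identities in [h] and comparison of kinds *)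

Definition poly4 (p0 p1 p2 p3 p4 y : C) : C :=
  (p0 + y * (p1 + y * (p2 + y * (p3 + y * p4))))%C.

(** Differentiating in z and dividing by [h1] differentiates the polynomial in [h]. The result is
    kept in degree 4, with top coefficient 0, so that the lemma can be iterated. *)
Lemma poly4_along_zero (S : C -> Prop) (h h1 : C -> C) (p0 p1 p2 p3 p4 : C) :
  open S -> Hol S h h1 -> (forall z, S z -> h1 z <> 0) ->
  (forall z, S z -> poly4 p0 p1 p2 p3 p4 (h z) = 0) ->
  forall z, S z -> poly4 p1 (2 * p2) (3 * p3) (4 * p4) 0 (h z) = 0.
Proof.
  intros HO Hh Hn E z Hz.
  assert (HP : Hol S (fun z => poly4 p0 p1 p2 p3 p4 (h z))
     (fun z => h1 z * poly4 p1 (2 * p2) (3 * p3) (4 * p4) 0 (h z))%C).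
  { eapply Hol_ext; [exact HO|reflexivity| |unfold poly4;
      repeat first [apply Hol_plus|apply Hol_mult|exact Hh|apply Hol_const]; exact HO].
    intros w Hw. unfold poly4. cbv beta. ring. }
  pose proof (Hol_unique S _ (fun _ => RtoC 0) _ _ z HO E HP (Hol_const S 0 HO) Hz) as K.
  cbv beta in K.
  destruct (Ceq_dec (poly4 p1 (2 * p2) (3 * p3) (4 * p4) 0 (h z)) 0) as [K'|K']; trivial.
  exfalso. apply (Cmult_neq_0 _ _ (Hn z Hz) K' K).
Qed.

(** The fourth derivative in [h] is [24 p4], and evaluation at one point then removes the
    coefficients from the top down. *)
Lemma poly4_zero (S : C -> Prop) (h h1 : C -> C) (p0 p1 p2 p3 p4 : C) :
  open S -> (exists z, S z) -> Hol S h h1 -> (forall z, S z -> h1 z <> 0) ->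
  (forall z, S z -> poly4 p0 p1 p2 p3 p4 (h z) = 0) ->
  p0 = 0 /\ p1 = 0 /\ p2 = 0 /\ p3 = 0 /\ p4 = 0.
Proof.
  intros HO [z Hz] Hh Hn E0.
  pose proof (poly4_along_zero S h h1 _ _ _ _ _ HO Hh Hn E0) as E1.
  pose proof (poly4_along_zero S h h1 _ _ _ _ _ HO Hh Hn E1) as E2.
  pose proof (poly4_along_zero S h h1 _ _ _ _ _ HO Hh Hn E2) as E3.
  pose proof (poly4_along_zero S h h1 _ _ _ _ _ HO Hh Hn E3) as E4.
  specialize (E0 z Hz). specialize (E1 z Hz). specialize (E2 z Hz). specialize (E3 z Hz). specialize (E4 z Hz).
  unfold poly4 in *.
  assert (K4 : (24 * p4)%C = 0) by (rewrite <- E4; ring).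
  assert (p4 = 0) by (transitivity (/ 24 * (24 * p4))%C; [field|rewrite K4; ring]).
  subst p4.
  assert (K3 : (6 * p3)%C = 0) by (rewrite <- E3; ring).
  assert (p3 = 0) by (transitivity (/ 6 * (6 * p3))%C; [field|rewrite K3; ring]).
  subst p3.
  assert (K2 : (2 * p2)%C = 0) by (rewrite <- E2; ring).
  assert (p2 = 0) by (transitivity (/ 2 * (2 * p2))%C; [field|rewrite K2; ring]).
  subst p2.
  assert (K1 : p1 = 0) by (rewrite <- E1; ring). subst p1.
  repeat split. rewrite <- E0. ring.
Qed.

Lemma Cdiff_eq (a b : C) : (a - b)%C = 0 -> a = b.
Proof. intros E. transitivity (a - b + b)%C; [ring|]. rewrite E. ring. Qed.

Lemma Csqr_eq (a b : C) : (a * a)%C = (b * b)%C -> a = b \/ a = (- b)%C.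
Proof.
  intros E. destruct (Ceq_dec (a - b)%C 0) as [K|K]; [left; now apply Cdiff_eq|].
  right. destruct (Ceq_dec (a + b)%C 0) as [K'|K'].
  - transitivity (a + b - b)%C; [ring|]. rewrite K'. ring.
  - exfalso. apply (Cmult_neq_0 _ _ K K'). transitivity (a * a - b * b)%C; [ring|]. rewrite E. ring.
Qed.

Lemma Cmult_cancel (a b c : C) : a <> 0 -> (a * b)%C = (a * c)%C -> b = c.
Proof.
  intros Ha E. transitivity (/ a * (a * b))%C; [field; trivial|]. rewrite E. field. trivial.
Qed.

(** The three equations compare the coefficients of [q^2] in degrees 2, 3 and 4. They fix [D^2]; for
    [D = 0] they fix [B^2] directly, and for [D <> 0] through [(B D)^2 / D^2], which gives the
    discriminant as [3 B^2 - 2 (B^2 + 2 A D)]. *)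
Lemma kind_cond_unique (K K' : kind) (A B D A' B' D' : C) :
  kind_cond K A B D -> kind_cond K' A' B' D' ->
  (B * B + 2 * A * D = B' * B' + 2 * A' * D')%C -> (B * D = B' * D')%C ->
  (D * D = D' * D')%C -> K = K'.
Proof.
  intros H H' E2 E3 E4.
  assert (HD : D = 0 <-> D' = 0).
  { destruct (Csqr_eq _ _ E4) as [-> | ->]; split; trivial.
    - intros E. transitivity (- - D')%C; [ring|]. rewrite E. ring.
    - intros ->. ring. }
  assert (HB : D = 0 -> (B = 0 <-> B' = 0)).
  { intros E. pose proof (proj1 HD E) as E'. subst D D'.
    assert (EB : (B * B = B' * B')%C).
    { transitivity (B * B + 2 * A * 0)%C; [ring|]. rewrite E2. ring. }
    destruct (Csqr_eq _ _ EB) as [-> | ->]; split; trivial.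
    - intros E. transitivity (- - B')%C; [ring|]. rewrite E. ring.
    - intros ->. ring. }
  assert (Hdisc : D <> 0 -> (B * B - 4 * A * D = B' * B' - 4 * A' * D')%C).
  { intros HD0.
    assert (EB : (B * B = B' * B')%C).
    { apply (Cmult_cancel (D * D)); [now apply Cmult_neq_0|].
      transitivity ((B * D) * (B * D))%C; [ring|]. rewrite E3, E4. ring. }
    transitivity (3 * (B * B) - 2 * (B * B + 2 * A * D))%C; [ring|]. rewrite E2, EB. ring. }
  destruct K, K'; unfold kind_cond in H, H'; try reflexivity; exfalso; try tauto;
    destruct H as [H1 H2], H' as [H1' H2']; try tauto;
    rewrite (Hdisc H1) in H2; tauto.
Qed.

(** [h1] vanishes everywhere for the plane and nowhere for the other kinds. For two nonplanar kinds,
    [h1 / f] equals two squares of quadratic polynomials at [h], and these agree as polynomials by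
    [poly4_zero]. *)
Lemma piece_kind_unique (S : C -> Prop) (X : R -> R -> I3) (l : R -> R -> R)
    (F f h h1 : C -> C) (e : R) (K K' : kind) (w w' : wdata) :
  (exists z, S z) -> wsurf_data S l F f h h1 -> e * e = 1 ->
  (forall u v, X u v = refl e (wsurf l F u v)) ->
  listed K w -> piece_up_to_similarity S X w ->
  listed K' w' -> piece_up_to_similarity S X w' -> K = K'.
Proof.
  intros Hne HD He HX HK HP HK' HP'.
  destruct (piece_ode S X l F f h h1 e K w Hne HD He HX HK HP)
    as [[-> E]|(_ & Hn & A & B & D & Hc & Eq)];
  destruct (piece_ode S X l F f h h1 e K' w' Hne HD He HX HK' HP')
    as [[-> E']|(_ & Hn' & A' & B' & D' & Hc' & Eq')]; trivial.
  - destruct Hne as [z Hz]. exfalso. apply (Hn' z Hz), E, Hz.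
  - destruct Hne as [z Hz]. exfalso. apply (Hn z Hz), E', Hz.
  - destruct (poly4_zero S h h1 (A * A - A' * A') (2 * (A * B - A' * B'))
      (B * B + 2 * A * D - (B' * B' + 2 * A' * D')) (2 * (B * D - B' * D')) (D * D - D' * D')
      (wd_open _ _ _ _ _ _ HD) Hne (wd_h _ _ _ _ _ _ HD) Hn) as (_ & _ & E2 & E3 & E4).
    + intros z Hz.
      transitivity (quad A B D (h z) * quad A B D (h z) - quad A' B' D' (h z) * quad A' B' D' (h z))%C;
        [unfold poly4, quad; ring|].
      pose proof (wd_f _ _ _ _ _ _ HD z Hz) as Hf.
      transitivity (h1 z / f z - h1 z / f z)%C; [|ring].
      rewrite (Eq z Hz) at 1. rewrite (Eq' z Hz). field. trivial.
    + apply (kind_cond_unique K K' A B D A' B' D' Hc Hc'); apply Cdiff_eq; trivial.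
      transitivity (/ 2 * (2 * (B * D - B' * D')))%C; [field|]. rewrite E3. ring.
Qed.

Theorem theorem6p2
    (Sigma : C -> Prop) (X : R -> R -> I3)
    (omega : R -> R -> R) (n : R -> R -> R31)
    (HSigma : simply_connected_domain Sigma)
    (HX : spacelike_immersion Sigma X)
    (Homega : conformal_coordinates Sigma X omega)
    (Hn : lightlike_gauss_map Sigma X n)
    (HH : zero_mean_curvature Sigma X omega n)
    (Haff : affine_minimal Sigma X) :
  exists! K : kind,
    exists w : wdata, listed K w /\ piece_up_to_similarity Sigma X w.
Proof.
  destruct (isotropic_data Sigma X omega n HSigma HX Homega Hn HH)
    as (e & l & F & f & h & h1 & He & HD & HXe).
  assert (Hne : exists z, Sigma z) by apply HSigma.
  assert (Hex : exists K w, listed K w /\ piece_up_to_similarity Sigma X w).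
  { destruct Hne as [z0 Hz0].
    destruct Haff as [[Hnd Hmc]|Hpl].
    - destruct (affine_minimal_quadratic Sigma X l F f h h1 e (ex_intro _ z0 Hz0) HD He HXe Hnd Hmc)
        as (Hn1 & A & B & D & Him & Hq).
      destruct (Ceq_dec D 0) as [HD0|HD0].
      + destruct (Ceq_dec B 0) as [HB0|HB0].
        * exists TrivialEnneper. eapply trivial_enneper_piece; try eassumption.
          (* [q = 0] would make [h1] vanish, against nondegeneracy. *)
          intros HA0. apply (Hn1 z0 Hz0). rewrite Hq by trivial. unfold quad.
          rewrite HA0, HB0, HD0. ring.
        * exists Helicoid. eapply helicoid_piece; eassumption.
      + destruct (Ceq_dec (B * B - 4 * A * D)%C 0) as [Hd|Hd].
        * exists EnneperType. eapply enneper_piece; eassumption.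
        * exists ThomsenType. eapply thomsen_piece; eassumption.
    - exists Plane. eapply planar_piece; eassumption. }
  destruct Hex as (K & w & HK & HP). exists K. split; [now exists w|].
  intros K' (w' & HK' & HP').
  exact (piece_kind_unique Sigma X l F f h h1 e K K' w w' Hne HD He HXe HK HP HK' HP').
Qed.
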